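(* Let $H$ be an arbitrary finite graph with chromatic number $\chi(H)\ge 2$, and let $x\in[0,1]$. Then for every $\epsilon>0$ there exists a number $n_0\in\mathbb{N}$ such that the following holds. Suppose that $G$ is a graph of order $n>n_0$ with minimum degree at least $$\left(x\left(1-\frac{1}{\chi_{\mathrm{cr}}(H)}\right)+(1-x)\left(1-\frac{1}{\chi(H)-1}\right)\right)n .$$ Then $$\mathsf{til}(H,G)\ge\frac{(x-\epsilon)n}{v(H)} .$$ Furthermore, if $x\in[0,1)$ then for every $\epsilon>0$ there exist numbers $n_0\in\mathbb{N}$ and $\delta>0$ such that the following holds. Suppose that $G$ is a graph of order $n>n_0$ with minimum degree at least $$\left(x\left(1-\frac{1}{\chi_{\mathrm{cr}}(H)}\right)+(1-x)\left(1-\frac{1}{\chi(H)-1}\right)\right)n .$$ Then $$\mathsf{til}(H,G)\ge\frac{(x+\delta)n}{v(H)},$$ unless $G$ is $\epsilon$-close in the edit distance to an $n$-vertex bottleneck graph with parameters $x$ and $\chi_{\mathrm{cr}}(H)$.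
   Context: All graphs are finite and simple; $v(H)$ is the number of vertices of $H$ and $\chi(H)$ its chromatic number. Tiling number: $\mathsf{til}(H,G)$ is the maximum number of vertex-disjoint (not necessarily induced) copies of $H$ in $G$. Critical chromatic number: let $H$ have order $h$ and chromatic number $r\ge 2$, and let $\ell$ be the order of the smallest possible color class in any proper $r$-coloring of $H$. Then $\chi_{\mathrm{cr}}(H)=\frac{(r-1)h}{h-\ell}$. One has $\chi_{\mathrm{cr}}(H)\in(\chi(H)-1,\chi(H)]$. Bottleneck graph: let $x\in[0,1]$, $\chi_{\mathrm{cr}}\in(1,\infty)$ and $r=\lceil\chi_{\mathrm{cr}}\rceil$. An $n$-vertex graph is a bottleneck graph with parameters $x$ and $\chi_{\mathrm{cr}}$ if its vertex set can be partitioned into $r$ classes $U_1,\dots,U_r$ such that, up to rounding to integers (each size differing from the given real number by less than $1$), $|U_1|=\dots=|U_{r-1}|=n\cdot\frac{\chi_{\mathrm{cr}}-x(\chi_{\mathrm{cr}}+1-r)}{\chi_{\mathrm{cr}}(r-1)}$ and $|U_r|=n\cdot\frac{x(\chi_{\mathrm{cr}}+1-r)}{\chi_{\mathrm{cr}}}$; all pairs of vertices in different classes are edges; each of $U_1,\dots,U_{r-1}$ is an independent set; and the edges inside $U_r$ are arbitrary. Edit distance: for two $n$-vertex graphs $G$ and $G'$, the edit distance is the minimum, over all identifications (bijections) of $V(G)$ with $V(G')$, of the number of edges that have to be added or deleted to get $G'$ from $G$. $G$ is $\epsilon$-close to $G'$ in the edit distance if their edit distance is at most $\epsilon\binom{n}{2}$.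 *)

(* Defs.v *)
From mathcomp Require Import all_boot all_order all_algebra.
From mathcomp Require Import reals.

Set Implicit Arguments.
Unset Strict Implicit.
Unset Printing Implicit Defensive.

Import Order.TTheory GRing.Theory Num.Theory.
Local Open Scope ring_scope.

Record graph := Graph {
  vertex :> finType;
  adj : rel vertex;
  adj_sym : symmetric adj;
  adj_irr : irreflexive adj }.

Definition degree (G : graph) (v : G) : nat := #|[set w | adj v w]|.

(* The default #|G| exceeds every degree, so it only matters for the graph
   without vertices. *)
Definition min_degree (G : graph) : nat := \big[minn/#|G|]_(v : G) degree v.

Section Coloring.
Variable G : graph.

Definition proper_coloring k (c : {ffun G -> 'I_k}) : bool :=
  [forall u, forall v, adj u v ==> (c u != c v)].

Definition colorable k : bool :=
  [exists c : {ffun G -> 'I_k}, proper_coloring c].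

Lemma ex_colorable : exists k, colorable k.
Proof.
exists #|G|; apply/existsP; exists [ffun v => enum_rank v].
apply/forallP => u; apply/forallP => v; apply/implyP => uv.
rewrite !ffunE (inj_eq enum_rank_inj).
by apply: contraTneq uv => ->; rewrite adj_irr.
Qed.

Definition chi : nat := ex_minn ex_colorable.

(* The order of the smallest color class over all proper colorings with chi
   colors; every class has at most #|G| elements, so the default value does
   not affect the minimum. *)
Definition min_color_class : nat :=
  \big[minn/#|G|]_(c : {ffun G -> 'I_chi} | proper_coloring c)
    \big[minn/#|G|]_(i : 'I_chi) #|[set v | c v == i]|.

End Coloring.

(* Meaningful for 2 <= chi G, in which case min_color_class G < #|G|. *)
Definition chi_cr (R : realType) (G : graph) : R :=
  ((chi G)%:R - 1) * #|G|%:R / (#|G|%:R - (min_color_class G)%:R).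

Section Tiling.
Variables H G : graph.

Definition embedding (f : {ffun H -> G}) : bool :=
  injectiveb f && [forall u, forall v, adj u v ==> adj (f u) (f v)].

(* Embeddings with disjoint images give different copies as soon as H has a
   vertex, so that #|F| counts copies, not labelings of copies. *)
Definition tiling (F : {set {ffun H -> G}}) : bool :=
  [forall f in F, embedding f] &&
  [forall f in F, forall g in F, (f != g) ==> [disjoint codom f & codom g]].

Definition til : nat := \max_(F : {set {ffun H -> G}} | tiling F) #|F|.

End Tiling.

(* The partition is given by the map p sending a vertex to the index of its
   class; the classes U_1, ..., U_r are the fibers over 0, ..., r.-1, and may be
   empty (U_r is, up to rounding, when x = 0). *)
Definition bottleneck (R : realType) (x c : R) (G : graph) : Prop :=
  let r := `|Num.ceil c|%N in
  let n : R := #|G|%:R in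
  exists p : {ffun G -> 'I_r},
  [/\ forall i : 'I_r, (i < r.-1)%N ->
        `| #|[set v | p v == i]|%:R
           - n * ((c - x * (c + 1 - r%:R)) / (c * (r%:R - 1))) | < 1,
      forall i : 'I_r, i = r.-1 :> nat ->
        `| #|[set v | p v == i]|%:R - n * (x * (c + 1 - r%:R) / c) | < 1,
      forall u v, p u != p v -> adj u v
    & forall u v, p u = p v -> (p u < r.-1)%N -> ~~ adj u v].

Section EditDistance.
Variables G G' : graph.

(* The unordered pairs of vertices of G that are an edge in exactly one of G
   and G', after identifying v with f v. *)
Definition edits (f : {ffun G -> G'}) : {set {set G}} :=
  [set [set e.1; e.2] | e : G * G & adj e.1 e.2 != adj (f e.1) (f e.2)].

(* To be used for #|G| = #|G'|: then the injections are the bijections, and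
   'C(#|G|, 2) is an upper bound on the number of edits. *)
Definition edit_distance : nat :=
  \big[minn/'C(#|G|, 2)]_(f : {ffun G -> G'} | injectiveb f) #|edits f|.

End EditDistance.

Definition edit_close (R : realType) (eps : R) (G G' : graph) : Prop :=
  #|G| = #|G'| /\ (edit_distance G G')%:R <= eps * 'C(#|G|, 2)%:R.

(* Main.v *)
Require Import Defs.
From mathcomp Require Import all_boot all_order all_algebra.
From mathcomp Require Import reals ring lra zify.

(* Neither the regularity lemma nor linear programming duality is needed.

   Let h, l, chi = m + 1 be the order, smallest class and chromatic number of
   H, and z = x l / h, y = (1 - z) / m; the degree condition says that every
   vertex of G has at most y n nonneighbours, and the classes of a bottleneck
   graph have order y n (m times) and z n.

   Covers.  Let c >= 0 on the vertices of a graph give total weight at least 1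
   to every homomorphic copy of H.  Choosing greedily v_1, ..., v_{m+1}, each
   of smallest c among the common neighbours of the previous ones, the weights
   a_i = c(v_i) increase, sum c >= n (y (a_1 + ... + a_m) + z a_{m+1}), and the
   colourings of H on this clique give sum c >= (x / h) n.  If x < 1 and the sum
   is barely larger, then c is small on a K_{m+1}-free set of about m y n
   vertices; any m-clique in it determines the partition of a nearby bottleneck
   graph through its neighbourhoods.

   From covers to tilings.  Group the vertices of G into clusters of h vertices,
   the members of a maximum tiling among them, and sample s clusters at
   random, forgetting the edges inside clusters.  If with positive probability
   every cover of the sample is large, then Blackwell's approachability argument
   gives many copies of H in the sample with small loads, and a blow-up of the
   sample in G (which exists by Erdos's theorem on complete s-partite
   hypergraphs) can be tiled accordingly; by maximality the tiling of G is at
   least as good.  Otherwise most samples have the structure above, and by the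
   second moment method so has G. *)

Set Implicit Arguments.
Unset Strict Implicit.
Unset Printing Implicit Defensive.

Import Order.TTheory GRing.Theory Num.Theory.
Local Open Scope ring_scope.

(** * Averaging and approachability *)

(** The number z comes from the extremal graphs: when the last class is independent too, every copy
    of [H] uses at least l of its roughly z n vertices, so there are about z n / l = x n / h
    disjoint copies at most. Homomorphic copies suffice in samples because vertices with the same
    image are separated in a blow-up. The fractional tiling given by Blackwell's argument is a list
    of N homomorphisms with loads at most T, where N and T do not depend on the individual sample;
    so finitely many lists compete, one of them serves a positive proportion of the samples, and
    Erdos's theorem applies to these. Clusters are sampled instead of vertices because an exchange
    must not cut a member of the maximum tiling: a union of clusters contains each member that it
    meets. N is then compared with the number of members in the block, which is controlled since a
    typical sample contains them in the right proportion. Structure is transferred from a sample to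
    the whole by testing sets defined from a few sampled vertices; the variance bound tolerates
    dependence on boundedly many coordinates. *)

Lemma exists_nat_ge (R : realType) (x : R) : exists n : nat, x <= n%:R.
Proof.
exists (Num.bound x); have [x0|/ltW x0] := lerP 0 x.
  by apply/ltW/archi_boundP.
by apply: le_trans x0 _.
Qed.

Lemma markov_count (R : realFieldType) (T : finType) (f : T -> R) (a : R) :
  (forall i, 0 <= f i) -> a * #|[set i | a < f i]|%:R <= \sum_i f i.
Proof.
move=> f0; rewrite mulr_natr -sumr_const [leRHS](bigID (mem [set i | a < f i])) /=.
rewrite -[leLHS]addr0; apply: lerD; last by apply: sumr_ge0.
by apply: ler_sum => i; rewrite inE => /ltW.
Qed.

Lemma exists_average (R : realFieldType) (T : finType) (f : T -> R) (a : R) :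
  a * #|T|%:R < \sum_i f i -> exists i, a < f i.
Proof.
move=> lt; apply/existsP; apply: contraTT lt; rewrite negb_exists => /forallP le.
rewrite -leNgt mulr_natr -sumr_const; apply: ler_sum => i _.
by rewrite leNgt; apply: le.
Qed.

Section Blackwell.
Variables (R : realFieldType) (I J : finType) (A : J -> I -> R) (a b : R).
Hypothesis A_itv : forall j i, 0 <= A j i <= b.
Hypothesis a_itv : 0 <= a <= b.
Hypothesis respond : forall c : I -> R, (forall i, 0 <= c i) ->
  exists j, \sum_i A j i * c i <= a * \sum_i c i.

(* Blackwell's approachability argument: answering the current excesses keeps
   the sum of their squares growing only linearly. *)
Lemma blackwell N : exists t : N.-tuple J,
  \sum_i (Num.max 0 (\sum_(j <- t) A j i - a * N%:R)) ^+ 2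
  <= N%:R * (#|I|%:R * b ^+ 2).
Proof.
elim: N => [|N [t IH]].
  exists [tuple]; rewrite mul0r big1 // => i _.
  by rewrite big_nil mulr0 subrr maxxx expr0n.
pose c i := Num.max 0 (\sum_(j <- t) A j i - a * N%:R).
have c0 i : 0 <= c i by rewrite /c le_max lexx.
have [j jP] := respond c0.
exists [tuple of j :: t] => /=.
(* The square of the new excess is expanded: by the choice of [j] the cross terms have sum at most
   0, and [(A j i - a) ^+ 2] is at most [b ^+ 2]. *)
apply: (@le_trans _ _ (\sum_i (c i ^+ 2 + 2 * (A j i * c i - a * c i) + b ^+ 2))).
  apply: ler_sum => i _; rewrite big_cons.
  have := A_itv j i; have := a_itv; have := c0 i.
  have : \sum_(j <- t) A j i - a * N%:R <= c i by rewrite /c le_max lexx orbT.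
  move: (c i) (A j i) => ci Aji; rewrite -[N.+1%:R]natr1; move: (\sum_(_ <- _) _) => S.
  move=> Sc ci0 /andP[a0 ab] /andP[A0 Ab].
  have -> : Aji + S - a * (N%:R + 1) = (S - a * N%:R) + (Aji - a) by ring.
  move: (S - a * N%:R) Sc => u uc.
  have d2 : (Aji - a) ^+ 2 <= b ^+ 2.
    by rewrite -subr_ge0 subr_sqr mulr_ge0 //; lra.
  have cE : (ci + (Aji - a)) ^+ 2 = ci ^+ 2 + 2 * (Aji * ci - a * ci) + (Aji - a) ^+ 2.
    by ring.
  apply: (@le_trans _ _ ((ci + (Aji - a)) ^+ 2)); last by rewrite cE lerD2l.
  case: (lerP (u + (Aji - a)) 0) => [_|ud]; first by rewrite expr0n sqr_ge0.
  by rewrite lerXn2r ?nnegrE //; lra.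
have -> : N.+1%:R * (#|I|%:R * b ^+ 2) = N%:R * (#|I|%:R * b ^+ 2) + \sum_(i : I) b ^+ 2.
  by rewrite sumr_const -[N.+1%:R]natr1 mulrDl mul1r -[b ^+ 2 *+ _]mulr_natl.
rewrite !big_split /= -mulr_sumr big_split /= sumrN -!mulr_sumr lerD2r.
apply: le_trans IH; rewrite -/c gerDl.
by move: jP; rewrite -subr_le0; lra.
Qed.

End Blackwell.

(** * Fractional covers and tilings *)

Lemma card_pairs (A B : finType) (P : A -> pred B) :
  #|[set p : A * B | P p.1 p.2]| = (\sum_a #|[set b | P a b]|)%N.
Proof.
transitivity (\sum_a \sum_(b | P a b) 1)%N; last first.
  by apply: eq_bigr => a _; rewrite -sum1_card; apply: eq_bigl => b; rewrite inE.
by rewrite pair_big_dep -sum1_card /=; apply: eq_bigl => p; rewrite inE.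
Qed.

Definition is_hom (H : graph) (I : finType) (e : rel I) (f : {ffun H -> I}) :=
  [forall u, forall v, adj u v ==> e (f u) (f v)].

Lemma is_homP (H : graph) (I : finType) (e : rel I) (f : {ffun H -> I}) :
  reflect (forall u v, adj u v -> e (f u) (f v)) (is_hom e f).
Proof.
apply: (iffP forallP) => [hom u v | hom u].
  by have /forallP/(_ v)/implyP := hom u.
by apply/forallP => v; apply/implyP; apply: hom.
Qed.

(** Fractional covers are dual to fractional tilings by homomorphic copies; a copy counts the weight
    of a point as often as it uses the point. *)
Definition fcover (R : realType) (H : graph) (I : finType) (e : rel I)
    (c : I -> R) :=
  (forall i, 0 <= c i) /\
  (forall f : {ffun H -> I}, is_hom e f -> 1 <= \sum_u c (f u)).

Lemma sum_fibers (R : realType) (A I : finType) (f : A -> I) (c : I -> R) :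
  \sum_i #|[set u | f u == i]|%:R * c i = \sum_u c (f u).
Proof.
rewrite [RHS](partition_big f xpredT) //=; apply: eq_bigr => i _.
rewrite (eq_bigr (fun=> c i)) => [|u /eqP -> //].
by rewrite sumr_const mulr_natl; congr (_ *+ _); apply: eq_card => u; rewrite inE.
Qed.

(** If every copy had weight above [tau^-1] times the total, rescaling [c] to total weight [tau]
    would give a forbidden cover; if the total is 0, then [c] itself would be one. *)
Lemma no_cover_respond (R : realType) (H : graph) (I : finType) (e : rel I)
    (tau : R) : 0 < tau ->
  (forall c, fcover H e c -> tau < \sum_i c i) ->
  forall c : I -> R, (forall i, 0 <= c i) ->
  exists f : {f : {ffun H -> I} | is_hom e f},
    \sum_i #|[set u | val f u == i]|%:R * c i <= tau^-1 * \sum_i c i.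
Proof.
move=> tau0 nocov c c0.
suff /existsP : [exists f : {f : {ffun H -> I} | is_hom e f},
    \sum_i #|[set u | val f u == i]|%:R * c i <= tau^-1 * \sum_i c i] by [].
apply/contraT; rewrite negb_exists => /forallP big.
have {}big (f : {ffun H -> I}) : is_hom e f ->
    tau^-1 * \sum_i c i < \sum_u c (f u).
  by move=> hf; have := big (exist _ f hf); rewrite -ltNge sum_fibers.
have S0 : 0 <= \sum_i c i by apply: sumr_ge0.
have [Sz|/eqP Snz] := eqVneq (\sum_i c i) 0.
  have /nocov : fcover H e c.
    split=> // f /big; rewrite Sz mulr0 big1 ?ltxx // => u _.
    by have /psumr_eq0P -> := Sz.
  by rewrite Sz ltNge ltW.
have Sp : 0 < \sum_i c i by rewrite lt0r S0 andbT; apply/eqP.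
have /nocov : fcover H e (fun i => tau / (\sum_i c i) * c i).
  split=> [i|f /big lt]; first by rewrite mulr_ge0 ?divr_ge0 // ltW.
  rewrite -mulr_sumr -ler_pdivrMl ?divr_gt0 // mulr1 invf_div mulrC.
  exact: ltW.
by rewrite -mulr_sumr divfK ?ltxx //; apply/eqP.
Qed.

(** A fractional tiling of weight [N / T] with integral data: after each point is replaced by [T]
    clones, it becomes [N] disjoint copies. *)
Definition tileable (H : graph) (I : finType) (e : rel I) (N T : nat) :=
  exists2 t : {ffun 'I_N -> {ffun H -> I}}, (forall k, is_hom e (t k)) &
    forall i, (#|[set p : 'I_N * H | t p.1 p.2 == i]| <= T)%N.

(** After [N] rounds the squared excesses of the loads over [a * N] add up to at most
    [N * q * b ^+ 2], so each excess is of order sqrt N and falls below [e4 * N]. The order of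
    quantifiers matters: [N] and [T] are fixed before the graph on [q] points. *)
Lemma tileable_of_no_cover (R : realType) (H : graph) (rho eps : R) (q : nat) :
  0 < eps -> (0 < q)%N -> exists N T : nat,
  [/\ (0 < T)%N, (rho - eps) * q%:R * T%:R <= N%:R &
   forall (I : finType) (e : rel I), #|I| = q ->
     (forall c : I -> R, fcover H e c -> rho * q%:R < \sum_i c i) ->
     tileable H e N T].
Proof.
move=> eps0 q0; have [rho0|rho0] := lerP rho 0.
  exists 0%N, 1%N; split=> //; first by rewrite mulr1 mulr_le0_ge0 //; lra.
  move=> I e _ _; exists [ffun k : 'I_0 => False_rect _ (notF (ltn_ord k))].
    by case.
  by move=> i; apply: leq_trans (max_card _) _; rewrite card_prod card_ord.
have q0' : 0 < q%:R :> R by rewrite ltr0n.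
have tau0 : 0 < rho * q%:R by rewrite mulr_gt0.
pose a := (rho * q%:R)^-1; have a0 : 0 < a by rewrite invr_gt0.
have aE : rho * q%:R * a = 1 by rewrite divff // gt_eqF.
pose b : R := #|H|%:R + a.
(* The slack [eps * q * a * N] is shared: half pays for the excess [e4 * N] of the loads, half for
   rounding [T] up. *)
pose e4 := eps * a / (2 * rho).
have e40 : 0 < e4 by rewrite divr_gt0 ?mulr_gt0.
have e4E : 2 * rho * e4 = eps * a by rewrite mulrC divfK // gt_eqF ?mulr_gt0.
have [N1 N1P] := exists_nat_ge (q%:R * b ^+ 2 / e4 ^+ 2).
have [N2 N2P] := exists_nat_ge (2 * rho / (eps * a)).
pose N := maxn N1 N2.
have {}N1P : q%:R * b ^+ 2 <= e4 ^+ 2 * N%:R.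
  rewrite [leRHS]mulrC -ler_pdivrMr ?exprn_gt0 //; apply: le_trans N1P _.
  by rewrite ler_nat leq_maxl.
have {}N2P : 2 * rho <= eps * a * N%:R.
  rewrite [leRHS]mulrC -ler_pdivrMr ?mulr_gt0 //; apply: le_trans N2P _.
  by rewrite ler_nat leq_maxr.
have load0 : 0 <= (a + e4) * N%:R by rewrite mulr_ge0 // addr_ge0 // ltW.
exists N, (Num.truncn ((a + e4) * N%:R)).+1; split=> //.
  have [le0|gt0] := lerP (rho - eps) 0.
    by rewrite (le_trans _ (ler0n _ _)) // mulr_le0_ge0 // mulr_le0_ge0 // ltW.
  have := leqnn (Num.truncn ((a + e4) * N%:R)); rewrite truncn_ge_nat // -natr1.
  move: (Num.truncn _) => T TP.
  have k1 : (rho - eps) * q%:R * (T%:R + 1) <=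
      (rho - eps) * q%:R * ((a + e4) * N%:R + 1).
    by rewrite ler_pM2l ?mulr_gt0 // lerD2r.
  apply: le_trans k1 _.
  have k2 : (rho - eps) * q%:R * (e4 * N%:R + 1) <= rho * q%:R * (e4 * N%:R + 1).
    rewrite ler_pM2r ?ler_pM2r //; first by lra.
    by rewrite ltr_wpDl // mulr_ge0 // ltW.
  have k3 : (rho - eps) * q%:R * ((a + e4) * N%:R + 1) =
      N%:R * (rho * q%:R * a) - eps * q%:R * a * N%:R
      + (rho - eps) * q%:R * (e4 * N%:R + 1) by ring.
  have k4 : 2 * (rho * q%:R * (e4 * N%:R + 1)) =
     q%:R * ((2 * rho * e4) * N%:R + 2 * rho) by ring.
  have k5 : q%:R * (2 * rho) <= q%:R * (eps * a * N%:R) by rewrite ler_pM2l.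
  rewrite k3 aE; rewrite e4E mulrDr in k4.
  have k6 : eps * q%:R * a * N%:R = q%:R * (eps * a * N%:R) by ring.
  by rewrite k6; lra.
move=> I e Iq nocov.
pose A (f : {f : {ffun H -> I} | is_hom e f}) (i : I) : R :=
  #|[set u | val f u == i]|%:R.
have Aab f i : 0 <= A f i <= b.
  by rewrite ler0n; apply: ler_wpDr; [apply: ltW | rewrite ler_nat max_card].
have aab : 0 <= a <= b by rewrite ltW // lerDr ler0n.
have [t tP] := blackwell Aab aab (no_cover_respond tau0 nocov) N.
exists [ffun k => val (tnth t k)] => [k|i]; first by rewrite ffunE; apply: (valP (tnth t k)).
have -> : #|[set p : 'I_N * H | [ffun k => val (tnth t k)] p.1 p.2 == i]| =
    (\sum_(k < N) #|[set u | val (tnth t k) u == i]|)%N.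
  rewrite -card_pairs; apply: eq_card => p; rewrite !inE.
  by rewrite ffunE.
apply: leqW; rewrite truncn_ge_nat // natr_sum.
have sumE : \sum_(j <- t) A j i = \sum_(k < N) A (tnth t k) i.
  by rewrite big_tuple.
rewrite -[leLHS]/(\sum_(k < N) A (tnth t k) i) -sumE.
suff : Num.max 0 (\sum_(j <- t) A j i - a * N%:R) <= e4 * N%:R.
  by rewrite ge_max mulrDl => /andP[_]; rewrite lerBlDl.
have m0 : 0 <= Num.max 0 (\sum_(j <- t) A j i - a * N%:R).
  by rewrite le_max lexx.
rewrite -(@ler_pXn2r _ 2) ?nnegrE //; last by rewrite mulr_ge0 // ltW.
apply: (@le_trans _ _ (N%:R * (e4 ^+ 2 * N%:R))); last first.
  by rewrite [leRHS]exprMn [leLHS]mulrCA -expr2.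
apply: le_trans (_ : N%:R * (#|I|%:R * b ^+ 2) <= _); last first.
  by rewrite Iq ler_wpM2l.
apply: le_trans tP; rewrite (bigD1 i) //= lerDl.
by apply: sumr_ge0 => k _; apply: sqr_ge0.
Qed.

(** * Complete blocks in dense families *)

Definition fcons (C : Type) s (c : C) (g : {ffun 'I_s -> C}) :
    {ffun 'I_s.+1 -> C} :=
  [ffun i => if unlift ord0 i is Some j then g j else c].

Lemma fcons0 (C : Type) s (c : C) (g : {ffun 'I_s -> C}) : fcons c g ord0 = c.
Proof. by rewrite ffunE unlift_none. Qed.

Lemma fconsS (C : Type) s (c : C) (g : {ffun 'I_s -> C}) j :
  fcons c g (lift ord0 j) = g j.
Proof. by rewrite ffunE liftK. Qed.

Lemma big_fcons (C : finType) s (M : nmodType) (F : {ffun 'I_s.+1 -> C} -> M) :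
  \sum_g F g = \sum_c \sum_g F (fcons c g).
Proof.
rewrite pair_bigA /=.
rewrite (reindex (fun p : C * {ffun 'I_s -> C} => fcons p.1 p.2)) //=.
apply: onW_bij; exists (fun g : {ffun 'I_s.+1 -> C} =>
    (g ord0, [ffun j => g (lift ord0 j)])) => [[c g] | g] /=.
  by rewrite fcons0; congr (_, _); apply/ffunP => j; rewrite ffunE fconsS.
apply/ffunP => i; case: (unliftP ord0 i) => [j|] ->; last by rewrite fcons0.
by rewrite fconsS ffunE.
Qed.

Lemma card_fcons (C : finType) s (P : pred {ffun 'I_s.+1 -> C}) :
  #|[set g | P g]| = (\sum_(g : {ffun 'I_s -> C}) #|[set c | P (fcons c g)]|)%N.
Proof.
rewrite cardsE -sum1_card big_mkcond big_fcons exchange_big /=.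
by apply: eq_bigr => g _; rewrite -big_mkcond sum1_card cardsE.
Qed.

Lemma ffact_ge (n t : nat) : ((n - t) ^ t <= n ^_ t)%N.
Proof.
elim: t n => [|t IH] [|n] //=; first by rewrite expnS sub0n mul0n.
by rewrite ffactSS subSS expnS (leq_mul (leqW (leq_subr _ _)) (IH n)).
Qed.

(* Erdos's theorem on complete s-partite s-uniform hypergraphs. *)
Lemma dense_block (R : realType) (s t : nat) (gam : R) : 0 < gam ->
  exists n0 : nat, forall (C : finType) (F : {set {ffun 'I_s -> C}}),
    (n0 < #|C|)%N -> gam * #|C|%:R ^+ s <= #|F|%:R ->
    exists2 b : 'I_s -> 'I_t -> C, (forall i, injective (b i)) &
      forall tau : 'I_s -> 'I_t, [ffun i => b i (tau i)] \in F.
Proof.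
elim: s gam => [|s IH] gam gam0.
  exists 0%N => C F _; rewrite expr0 mulr1 => gF.
  have /card_gt0P [g gin] : (0 < #|F|)%N by rewrite -(ltr_nat R) (lt_le_trans gam0).
  exists (fun i : 'I_0 => False_rect _ (notF (ltn_ord i))) => [[]//|tau].
  by rewrite (_ : [ffun _ => _] = g) //; apply/ffunP; case.
pose gam' := gam / 4 * (gam / 4) ^+ t.
have gam'0 : 0 < gam' by rewrite mulr_gt0 ?exprn_gt0 //; lra.
have [n1 IHn1] := IH _ gam'0.
have [n2 n2P] := exists_nat_ge (4 * t%:R / gam).
exists (maxn n1 n2) => C F; rewrite gtn_max => /andP[n1C n2C] gF.
have C0 : 0 < #|C|%:R :> R by rewrite ltr0n (leq_ltn_trans _ n1C).
have [n nE] : {n : R | #|C|%:R = n} by eexists.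
rewrite nE in C0 gF.
pose D (y : {ffun 'I_s -> C}) := [set c | fcons c y \in F].
pose Y := [set y | gam / 2 * n <= #|D y|%:R].
have FE : #|F| = (\sum_y #|D y|)%N.
  by rewrite -(card_fcons (mem F)); apply: eq_card => g; rewrite inE.
have cardO : #|{ffun 'I_s -> C}|%:R = n ^+ s by rewrite card_ffun card_ord natrX nE.
have Yge : gam / 2 * n ^+ s <= #|Y|%:R.
  have : #|F|%:R <= \sum_(y : {ffun 'I_s -> C}) (gam / 2 * n + n * (y \in Y)%:R).
    rewrite FE natr_sum; apply: ler_sum => y _; rewrite inE.
    have [yY|yY] := lerP (gam / 2 * n) #|D y|%:R; last by rewrite mulr0 addr0 ltW.
    rewrite mulr1; apply: ler_wpDl; last by rewrite -nE ler_nat max_card.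
    by rewrite mulr_ge0 ?ltW //; lra.
  have -> : \sum_(y : {ffun 'I_s -> C}) (gam / 2 * n + n * (y \in Y)%:R) =
      gam / 2 * n * n ^+ s + n * (\sum_y (y \in Y))%N%:R.
    rewrite big_split /=; congr (_ + _); last by rewrite -mulr_sumr -natr_sum.
    by rewrite -cardO [RHS]mulr_natr -sumr_const.
  rewrite (eq_bigr (fun y => if y \in Y then 1 else 0)%N) => [|y _]; last by case: (_ \in _).
  rewrite -big_mkcond sum1_card => le1.
  move: (le_trans gF le1); rewrite exprS => le2.
  rewrite -(ler_pM2l C0); lra.
(* Double counting of pairs of an injective tuple [T] and a tail [y] with all of [T] in [D y]: each
   of the at least [gam / 2 * n ^+ s] tails in [Y] accepts at least [(gam / 4 * n) ^+ t] of the at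
   most [n ^+ t] tuples. So some [T] is accepted by a proportion [gam'] of all tails, to which the
   induction hypothesis applies. *)
pose good (T : {ffun 'I_t -> C}) := [set y | [forall p, T p \in D y]].
pose inj := [set T : {ffun 'I_t -> C} | injectiveb T].
have tot : (\sum_(T in inj) #|good T| = \sum_y #|D y| ^_ t)%N.
  rewrite (eq_bigr (fun T : {ffun 'I_t -> C} => \sum_y ([forall p, T p \in D y] : nat))%N); last first.
    by move=> T _; rewrite -sum1_card big_mkcond; apply: eq_bigr => y _; rewrite inE; case: [forall p, _].
  rewrite exchange_big /=; apply: eq_bigr => y _.
  rewrite -[t in RHS]card_ord -card_inj_ffuns_on -sum1_card [RHS]big_mkcond [LHS]big_mkcond.
  apply: eq_bigr => T _.
  have onE : (T \in ffun_on (mem (D y))) = [forall p, T p \in D y].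
    by apply/ffun_onP/forallP.
  rewrite -onE /inj [T \in [set f | injectiveb _]]in_set.
  rewrite [T \in [set f in _ | _]]in_set.
  by case: (T \in ffun_on _); case: (injectiveb T).
have dbig y : y \in Y -> (gam / 4 * n) ^+ t <= (#|D y| ^_ t)%:R.
  rewrite inE => yY.
  have tn : t%:R <= gam / 4 * n.
    have : 4 * t%:R / gam <= n by apply: le_trans n2P _; rewrite -nE ler_nat ltnW.
    rewrite ler_pdivrMr //; lra.
  have tD : (t <= #|D y|)%N.
    rewrite -(ler_nat R); apply: le_trans tn (le_trans _ yY).
    by rewrite ler_pM2r //; lra.
  apply: (@le_trans _ _ ((#|D y| - t) ^ t)%:R); last by rewrite ler_nat ffact_ge.
  rewrite natrX lerXn2r ?nnegrE ?ler0n //; first by rewrite mulr_ge0 ?ltW //; lra.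
  by rewrite natrB //; lra.
have [T injT Tgood] : exists2 T, T \in inj & gam' * n ^+ s <= #|good T|%:R.
  apply/exists_inP; apply: contraT; rewrite negb_exists_in => /forall_inP small.
  have up : \sum_(T in inj) #|good T|%:R <= n ^+ t * (gam' * n ^+ s) :> R.
    apply: (@le_trans _ _ (\sum_(T in inj) gam' * n ^+ s)).
      by apply: ler_sum => T /small; rewrite -ltNge => /ltW.
    rewrite sumr_const -[_ *+ _]mulr_natl ler_wpM2r //.
      by rewrite mulr_ge0 ?exprn_ge0 ?ltW.
    rewrite -nE -natrX ler_nat -[X in (_ <= _ ^ X)%N](card_ord t) -card_ffun.
    exact: max_card.
  have : \sum_(y in Y) (gam / 4 * n) ^+ t <= \sum_(T in inj) #|good T|%:R.
    rewrite -natr_sum tot natr_sum [leRHS](bigID (mem Y)) /= -[leLHS]addr0.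
    by apply: lerD; [apply: ler_sum | apply: sumr_ge0].
  rewrite sumr_const -[_ *+ _]mulr_natr => low.
  have : (gam / 4 * n) ^+ t * (gam / 2 * n ^+ s) <= (gam / 4 * n) ^+ t * #|Y|%:R.
    by rewrite ler_wpM2l // exprn_ge0 // mulr_ge0 ?ltW //; lra.
  move=> /le_trans /(_ low) /le_trans /(_ up).
  have -> : n ^+ t * (gam' * n ^+ s) = (gam / 4 * n) ^+ t * (gam / 4 * n ^+ s).
    by rewrite exprMn /gam'; ring.
  rewrite ler_pM2l ?exprn_gt0 ?mulr_gt0 //; last by lra.
  by rewrite ler_pM2r ?exprn_gt0 //; lra.
have [b injb bP] := IHn1 C (good T) n1C (eq_ind_r (fun n => gam' * n ^+ s <= _) Tgood nE).
exists (fun i => if unlift ord0 i is Some j then b j else T) => [i|tau].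
  case: (unlift ord0 i) => [j|]; first exact: injb.
  by apply/injectiveP; move: injT; rewrite inE.
have := bP (fun j => tau (lift ord0 j)); rewrite inE => /forallP /(_ (tau ord0)).
rewrite inE; congr (_ \in F); apply/ffunP => i; rewrite !ffunE.
by case: (unliftP ord0 i) => [j|] -> //; rewrite ffunE.
Qed.

(** * Random samples *)

Section Sampling.
Variables (R : realType) (C : finType) (s : nat).
Implicit Types (g : {ffun 'I_s -> C}) (j k : 'I_s) (c : C).

Definition upd g j c := [ffun k => if k == j then c else g k].

Lemma upd_eq g j c : upd g j c j = c.
Proof. by rewrite ffunE eqxx. Qed.

Lemma upd_neq g j c k : k != j -> upd g j c k = g k.
Proof. by move=> kj; rewrite ffunE (negPf kj). Qed.

(** Exchanging [g j] with [c] is an involution on the pairs [(g, c)]; hence one coordinate may be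
    redrawn independently. *)
Lemma resample (Phi : {ffun 'I_s -> C} -> R) j :
  #|C|%:R * \sum_g Phi g = \sum_g \sum_c Phi (upd g j c).
Proof.
rewrite pair_bigA /=.
pose h (p : {ffun 'I_s -> C} * C) := (upd p.1 j p.2, p.1 j).
have hK : cancel h h.
  case=> g c; rewrite /h /= upd_eq; congr (_, _); apply/ffunP => k.
  by rewrite !ffunE; case: eqP => [->|].
rewrite (reindex_inj (can_inj hK)) /=.
rewrite (eq_bigr (fun p => Phi p.1)) => [|[g c] _]; last first.
  by have := congr1 fst (hK (g, c)) => /= ->.
rewrite -(pair_bigA _ (fun g c => Phi g)) /= mulr_sumr; apply: eq_bigr => g _.
by rewrite sumr_const mulr_natl.
Qed.

Lemma card_samples : #|{ffun 'I_s -> C}|%:R = #|C|%:R ^+ s :> R.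
Proof. by rewrite card_ffun card_ord natrX. Qed.

Variables (f : {ffun 'I_s -> C} -> C -> R) (K : {set 'I_s}).
Hypothesis f_itv : forall g c, 0 <= f g c <= 1.
Hypothesis f_dep : forall g j c d, j \notin K -> f (upd g j c) d = f g d.
Hypothesis C0 : (0 < #|C|)%N.

Definition mean g : R := (\sum_c f g c) / #|C|%:R.
Definition empirical g : R := (\sum_j f g (g j)) / s%:R.

Lemma mean_itv g : 0 <= mean g <= 1.
Proof.
have n0 : 0 < #|C|%:R :> R by rewrite ltr0n.
apply/andP; split.
  by rewrite divr_ge0 ?ler0n // sumr_ge0 // => c _; case/andP: (f_itv g c).
rewrite ler_pdivrMr // mul1r -sumr_const; apply: ler_sum => c _.
by case/andP: (f_itv g c).
Qed.

Lemma mean_upd g j c : j \notin K -> mean (upd g j c) = mean g.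
Proof.
by move=> jK; rewrite /mean; congr (_ / _); apply: eq_bigr => d _; apply: f_dep.
Qed.

Lemma sum_centred g : \sum_c (f g c - mean g) = 0.
Proof.
have n0 : #|C|%:R != 0 :> R by rewrite pnatr_eq0 -lt0n.
rewrite sumrB [X in _ - X]sumr_const -mulr_natr divfK ?subrr //.
Qed.

(** If [j] is outside [K] and differs from [k], redrawing coordinate [j] leaves [f g], [mean g] and
    [g k] fixed and averages the factor of [j] to 0. The remaining pairs are bounded trivially;
    there are at most [(#|K| + 1) * s] of them. *)
Lemma covariance_le j k :
  \sum_g (f g (g j) - mean g) * (f g (g k) - mean g) <=
  ((j \in K) || (j == k))%:R * #|C|%:R ^+ s.
Proof.
have n0 : 0 < #|C|%:R :> R by rewrite ltr0n.
case: (boolP ((j \in K) || (j == k))) => [_|]; last first.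
  rewrite negb_or => /andP[jK jk].
  rewrite mul0r -(ler_pM2l n0) mulr0 (resample _ j) big1 // => g _.
  under eq_bigr do rewrite upd_eq !f_dep // mean_upd // upd_neq 1?eq_sym //.
  by rewrite -mulr_suml sum_centred mul0r.
rewrite mul1r -card_samples -sumr_const.
apply: ler_sum => g _; have := f_itv g (g j); have := f_itv g (g k).
have := mean_itv g; move: (f g _) (f g _) (mean g) => u v w.
by move=> /andP[? ?] /andP[? ?] /andP[? ?]; nra.
Qed.

Lemma second_moment :
  \sum_g (\sum_j (f g (g j) - mean g)) ^+ 2 <=
  (#|K| + 1)%:R * s%:R * #|C|%:R ^+ s.
Proof.
apply: (@le_trans _ _ (\sum_(j < s) \sum_(k < s) \sum_g
    (f g (g j) - mean g) * (f g (g k) - mean g))).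
  under [leRHS]eq_bigr do rewrite exchange_big /=.
  rewrite [leRHS]exchange_big /=; apply: ler_sum => g _.
  by rewrite expr2 mulr_suml; apply: ler_sum => j _; rewrite mulr_sumr.
apply: (@le_trans _ _ (\sum_(j < s) \sum_(k < s)
   ((j \in K)%:R + (j == k)%:R) * #|C|%:R ^+ s)).
  apply: ler_sum => j _; apply: ler_sum => k _.
  apply: le_trans (covariance_le j k) _.
  rewrite ler_wpM2r ?exprn_ge0 ?ler0n // -natrD ler_nat.
  by case: (j \in K); case: (j == k).
under eq_bigr do rewrite -mulr_suml.
rewrite -mulr_suml ler_wpM2r ?exprn_ge0 ?ler0n //.
under eq_bigr => j _.
  rewrite big_split /= sumr_const card_ord -[_ *+ s]mulr_natr.
  rewrite (bigD1 j) //= eqxx big1 ?addr0 => [|k /negPf jk]; last by rewrite eq_sym jk.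
  over.
rewrite big_split /= sumr_const card_ord -mulr_suml natrD mulrDl mul1r lerD2r.
rewrite ler_wpM2r // -natr_sum ler_nat -sum1_card [leqRHS]big_mkcond.
by apply: leq_sum => j _; case: (j \in K).
Qed.

(** Chebyshev's inequality for a test function that may itself be determined by the coordinates in
    [K] of the sample, such as the neighbourhood of a sampled vertex. *)
Lemma deviation (eps : R) : (0 < s)%N -> 0 < eps ->
  eps ^+ 2 * s%:R * #|[set g | eps < `|empirical g - mean g|]|%:R <=
  (#|K| + 1)%:R * #|C|%:R ^+ s.
Proof.
move=> s0 eps0; have s0' : 0 < s%:R :> R by rewrite ltr0n.
rewrite -(ler_pM2r s0').
have -> : (#|K| + 1)%:R * #|C|%:R ^+ s * s%:R =
  (#|K| + 1)%:R * s%:R * #|C|%:R ^+ s :> R by rewrite mulrAC.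
apply: le_trans second_moment; rewrite mulrAC.
have -> : eps ^+ 2 * s%:R * s%:R = (eps * s%:R) ^+ 2 by ring.
pose F g := (\sum_j (f g (g j) - mean g)) ^+ 2.
have F0 g : 0 <= F g by apply: sqr_ge0.
apply: le_trans (markov_count ((eps * s%:R) ^+ 2) F0).
rewrite ler_wpM2l ?sqr_ge0 // ler_nat subset_leq_card //; apply/subsetP => g.
rewrite !inE => lt; rewrite -[ltRHS]real_normK ?num_real //.
rewrite ltr_pXn2r ?nnegrE ?normr_ge0 ?mulr_ge0 ?ltW //.
have -> : \sum_j (f g (g j) - mean g) = (empirical g - mean g) * s%:R.
  rewrite sumrB sumr_const card_ord mulrBl /empirical divfK ?gt_eqF //.
  by rewrite [mean g * _]mulr_natr.
by rewrite normrM (gtr0_norm s0') ltr_pM2r.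
Qed.

End Sampling.

(** * Bottle colourings *)

Lemma bigminn_le (I : finType) (P : pred I) (F : I -> nat) x i0 : P i0 ->
  (\big[minn/x]_(i | P i) F i <= F i0)%N.
Proof.
move=> Pi0; have : i0 \in index_enum I by apply: mem_index_enum.
elim: (index_enum I) => //= i r IH; rewrite inE big_cons => /predU1P[<-|ir].
  by rewrite Pi0 geq_minl.
by case: ifP => _; rewrite ?(leq_trans (geq_minr _ _)) ?IH.
Qed.

Lemma bigminn_attained (I : finType) (P : pred I) (F : I -> nat) x :
  \big[minn/x]_(i | P i) F i = x \/
  exists2 i, P i & \big[minn/x]_(i | P i) F i = F i.
Proof.
elim/big_ind: _ => [|a b aP bP|i Pi]; [by left| |by right; exists i].
by rewrite /minn; case: ifP.
Qed.

Section Bottle.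
Variable H : graph.

Lemma colorable_chi : colorable H (chi H).
Proof. by rewrite /chi; case: ex_minnP. Qed.

Lemma chi_le k : colorable H k -> (chi H <= k)%N.
Proof. by rewrite /chi; case: ex_minnP => m _ /[apply]. Qed.

Lemma min_color_class_le_class (c : {ffun H -> 'I_(chi H)}) i :
  proper_coloring c -> (min_color_class H <= #|[set v | c v == i]|)%N.
Proof.
by move=> cP; apply: leq_trans (bigminn_le _ _ cP) (bigminn_le _ _ _).
Qed.

Lemma sum_color_classes k (c : {ffun H -> 'I_k}) :
  (\sum_i #|[set v | c v == i]| = #|H|)%N.
Proof.
rewrite -[RHS]sum1_card (partition_big c xpredT) //=; apply: eq_bigr => i _.
by rewrite -sum1_card; apply: eq_bigl => v; rewrite inE.
Qed.

Lemma min_color_class_mul_le : (min_color_class H * chi H <= #|H|)%N.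
Proof.
have /existsP[c cP] := colorable_chi.
rewrite -(sum_color_classes c) mulnC -[X in (X * _)%N]card_ord -sum_nat_const.
by apply: leq_sum => i _; apply: min_color_class_le_class.
Qed.

Hypothesis chi_ge2 : (2 <= chi H)%N.

Lemma card_gt0_of_chi : (0 < #|H|)%N.
Proof.
rewrite lt0n; apply/eqP => H0.
suff /chi_le : colorable H 1 by rewrite leqNgt chi_ge2.
apply/existsP; exists [ffun=> ord0]; apply/forallP => u.
by have := card0_eq H0 u; rewrite inE.
Qed.

(** With at least two classes, [min_color_class_mul_le] puts the minimum strictly below the default
    value [#|H|], so a coloring attains it. *)
Lemma min_color_class_attained :
  exists2 c : {ffun H -> 'I_(chi H)}, proper_coloring c &
    exists i, #|[set v | c v == i]| = min_color_class H.
Proof.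
have : min_color_class H <> #|H|.
  move=> mE; have := min_color_class_mul_le; rewrite mE leqNgt => /negP; apply.
  by rewrite -{1}(muln1 #|H|) ltn_pmul2l // card_gt0_of_chi.
rewrite /min_color_class => nE.
have [//|[c cP cE]] := bigminn_attained (@proper_coloring H (chi H))
  (fun c : {ffun H -> 'I_(chi H)} => \big[minn/#|H|]_i #|[set v | c v == i]|) #|H|.
rewrite cE in nE *.
have [//|[i _ iE]] := bigminn_attained xpredT
  (fun i : 'I_(chi H) => #|[set v | c v == i]|) #|H|.
by exists c => //; exists i.
Qed.

(** The value [None] singles out a smallest class and leaves the other colors in ['I_m], where they
    can be shifted cyclically. *)
Lemma bottle_coloring m : chi H = m.+1 ->
  exists2 f : H -> option 'I_m, (forall u v, adj u v -> f u != f v) &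
    #|[set u | f u == None]| = min_color_class H.
Proof.
move=> chiE; have := min_color_class_attained; rewrite chiE => -[c cP [i iE]].
exists (fun u => unlift i (c u)) => [u v uv|].
  move: cP => /forallP/(_ u)/forallP/(_ v)/implyP/(_ uv) cuv.
  apply: contraNneq cuv.
  case: (unliftP i (c u)) => [j|] ->; case: (unliftP i (c v)) => [k|] -> //.
  by case=> ->.
rewrite -iE; apply: eq_card => u; rewrite !inE.
by case: unliftP => [j|] ->; rewrite ?eqxx // [RHS]eq_sym (negPf (neq_lift _ _)).
Qed.

(** An empty class could be omitted, giving a proper coloring with fewer than [chi H] colors. *)
Lemma min_color_class_gt0 : (0 < min_color_class H)%N.
Proof.
case chiE: (chi H) (chi_ge2) => [|[|m]] // _.
have [f fP fE] := bottle_coloring chiE.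
rewrite lt0n -fE; apply/eqP => /card0_eq f0.
suff /chi_le : colorable H m.+1 by rewrite chiE ltnn.
apply/existsP; exists [ffun u => odflt ord0 (f u)].
apply/forallP => u; apply/forallP => v; apply/implyP => /fP; rewrite !ffunE.
by have := f0 u; have := f0 v; rewrite !inE; case: (f u) (f v) => [a|] [b|].
Qed.

End Bottle.

Section Clique.
Variables (R : realType) (H : graph) (I : finType) (e : rel I) (m : nat).
Hypothesis e_sym : symmetric e.
Hypothesis chi_ge2 : (2 <= chi H)%N.
Hypothesis chiE : chi H = m.+1.

Let h : R := #|H|%:R.
Let l : R := (min_color_class H)%:R.

(* The clique v_1, ..., v_m, w supports colourings of H whose smallest class is
   at w; averaging over the cyclic shifts of the other classes makes these
   contribute equally. *)
Lemma clique_weight (c : I -> R) (v : 'I_m -> I) (w : I) : fcover H e c ->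
  (forall i j, i != j -> e (v i) (v j)) -> (forall i, e w (v i)) ->
  m%:R <= (h - l) * \sum_i c (v i) + m%:R * l * c w.
Proof.
case=> c0 cP vv wv.
(* Writing [m] as a successor makes addition on the indices cyclic. *)
case: m v vv wv chiE => [|m'] v vv wv chiE'; first by move: chi_ge2; rewrite chiE'.
have [f fP fE] := bottle_coloring chi_ge2 chiE'.
pose phi k : {ffun H -> I} :=
  [ffun u => if f u is Some i then v (i + k) else w].
have phi_hom k : is_hom e (phi k).
  apply/is_homP => x y /fP; rewrite !ffunE.
  case: (f x) (f y) => [i|] [j|] // ij; last by rewrite e_sym.
  by apply: vv; apply: contraNneq ij => /addIr ->.
have : \sum_(k < m'.+1) 1 <= \sum_(k < m'.+1) \sum_u c (phi k u).
  by apply: ler_sum => k _; apply: cP.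
rewrite sumr_const card_ord exchange_big /= (bigID (fun u => f u == None)) /=.
move=> /le_trans; apply; rewrite addrC; apply: lerD.
  rewrite (eq_bigr (fun=> \sum_i c (v i))) => [|u].
    rewrite sumr_const -mulr_natl ler_wpM2r ?sumr_ge0 // lerBrDr -natrD.
    rewrite ler_nat -fE -(cardC [set u | f u == None]) addnC leq_add2l.
    by apply: eq_leq; apply: eq_card => u; rewrite !inE.
  case fu: (f u) => [i|//] _; rewrite [RHS](reindex_inj (addrI i)) /=.
  by apply: eq_bigr => k _; rewrite ffunE fu.
rewrite (eq_bigr (fun=> m'.+1%:R * c w)) => [|u /eqP fu].
  rewrite sumr_const -[leLHS]mulr_natl mulrA [_ * l]mulrC /l -fE.
  have -> : #|[set u | f u == None]| = #|[pred u | f u == None]|.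
    by apply: eq_card => u; rewrite inE.
  by [].
rewrite (eq_bigr (fun=> c w)) => [|k _]; last by rewrite ffunE fu.
by rewrite sumr_const card_ord mulr_natl.
Qed.

End Clique.

(** * Covers of graphs of large minimum degree *)

Section Greedy.
Variables (R : realType) (I : finType) (e : rel I) (X : {set I}) (D : R).
Hypothesis e_sym : symmetric e.
Hypothesis D_ge0 : 0 <= D.
Hypothesis nonadj_le : forall v, v \in X -> #|[set u in X | ~~ e v u]|%:R <= D.

Lemma card_neighbours_ge (Y : {set I}) v : Y \subset X -> v \in Y ->
  #|Y|%:R - D <= #|[set u in Y | e v u]|%:R.
Proof.
move=> YX vY; have := nonadj_le (subsetP YX v vY).
have : (#|Y| <= #|[set u in Y | e v u]| + #|[set u in X | ~~ e v u]|)%N.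
  rewrite -(cardsID [set u | e v u] Y) leq_add //.
    by apply: subset_leq_card; apply/subsetP => u; rewrite !inE.
  apply: subset_leq_card; apply/subsetP => u; rewrite !inE => /andP[-> uY].
  by rewrite (subsetP YX).
by rewrite -(ler_nat R) natrD; lra.
Qed.

(* Picking each vertex with c minimal among the common neighbours of the
   previous ones makes the values of c on the successive common neighbourhoods
   increase; the bound is Abel summation over their sizes. *)
Lemma greedy_clique (c : I -> R) k (Y : {set I}) :
  (forall i, 0 <= c i) -> Y \subset X -> k%:R * D < #|Y|%:R + D ->
  exists (v : 'I_k -> I) (A : {set I}),
  [/\ forall i j, i != j -> e (v i) (v j), A \subset Y,
      forall i, v i \in Y,
      forall u i, u \in A -> e u (v i) /\ c (v i) <= c u &
      #|Y|%:R - k%:R * D <= #|A|%:R /\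
      forall b, (forall i, c (v i) <= b) -> (forall u, u \in A -> b <= c u) ->
        D * \sum_i c (v i) + (#|Y|%:R - k%:R * D) * b <= \sum_(u in Y) c u].
Proof.
move=> c0; elim: k Y => [|k IH] Y YX lt.
  exists (fun i : 'I_0 => False_rect _ (notF (ltn_ord i))), Y.
  split=> //; try by case.
    by move=> u [].
  split=> [|b _ bP]; first by rewrite mul0r subr0.
  rewrite big_ord0 mulr0 add0r mul0r subr0 mulr_natl -sumr_const.
  exact: ler_sum.
have kD0 : 0 <= k%:R * D by rewrite mulr_ge0 ?ler0n.
have /card_gt0P[u0 u0Y] : (0 < #|Y|)%N.
  by rewrite -(ltr_nat R); move: lt; rewrite -natr1; lra.
case: (arg_minP c u0Y) => v0 v0Y v0min.
pose Y' := [set u in Y | e v0 u].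
have Y'Y : Y' \subset Y by apply/subsetP => u; rewrite inE => /andP[].
have Y'card := card_neighbours_ge YX v0Y; rewrite -/Y' in Y'card.
have lt' : k%:R * D < #|Y'|%:R + D by move: lt; rewrite -natr1; lra.
have [v [A [vv AY vY AP [Acard Asum]]]] := IH Y' (subset_trans Y'Y YX) lt'.
have v0v j : e v0 (v j) by have := vY j; rewrite inE => /andP[].
pose w i := if unlift ord0 i is Some j then v j else v0.
have w0 : w ord0 = v0 by rewrite /w unlift_none.
have wS j : w (lift ord0 j) = v j by rewrite /w liftK.
exists w, A; split.
- move=> i j; case: (unliftP ord0 i) => [i'|] ->; case: (unliftP ord0 j) => [j'|] ->;
    rewrite ?w0 ?wS ?eqxx //.
    by rewrite (inj_eq (lift_inj (h := ord0))); apply: vv.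
  by rewrite e_sym.
- exact: subset_trans AY Y'Y.
- by move=> i; case: (unliftP ord0 i) => [i'|] ->; rewrite ?w0 ?wS // (subsetP Y'Y).
- move=> u i uA; have uY' := subsetP AY u uA.
  case: (unliftP ord0 i) => [i'|] ->; rewrite ?w0 ?wS; first exact: AP.
  by move: uY'; rewrite inE => /andP[uY vu]; rewrite e_sym; split=> //; apply: v0min.
have kE : k.+1%:R * D = k%:R * D + D by rewrite -natr1 mulrDl mul1r.
split; first by rewrite kE; lra.
move=> b bP bA; rewrite big_ord_recl w0 (eq_bigr (fun i => c (v i))) => [|i _]; last by rewrite wS.
have {}Asum := Asum b (fun i => eq_ind _ (fun t => c t <= b) (bP (lift ord0 i)) _ (wS i)) bA.
have b0 := bP ord0; rewrite w0 in b0.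
rewrite (big_setID Y') /= (setIidPr Y'Y).
have low : (#|Y|%:R - #|Y'|%:R) * c v0 <= \sum_(u in Y :\: Y') c u.
  have -> : #|Y|%:R - #|Y'|%:R = #|Y :\: Y'|%:R :> R.
    by rewrite -(cardsID Y' Y) (setIidPr Y'Y) natrD addrC addKr.
  rewrite mulr_natl -sumr_const; apply: ler_sum => u.
  by rewrite inE => /andP[_]; apply: v0min.
(* If fewer than [D] vertices are lost at [v0], the surplus survives to later neighbourhoods and is
   charged there at the rate [b], which is at least [c v0]. *)
have fin : 0 <= (D - (#|Y|%:R - #|Y'|%:R)) * (b - c v0) by rewrite mulr_ge0 //; lra.
rewrite kE; move: fin low Asum; move: (\sum_(_ < k) _) (\sum_(_ in _) _) (\sum_(_ in _) _).
move=> s1 s2 s3; lra.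
Qed.

End Greedy.

(** A copy through a vertex of weight above 1 remains covered by that vertex alone. Weights at most
    1 allow the value 1 for the last vertex of a greedy clique when no common neighbour is left. *)
Lemma fcover_min1 (R : realType) (H : graph) (I : finType) (e : rel I)
    (c : I -> R) : fcover H e c -> fcover H e (fun i => Num.min 1 (c i)).
Proof.
case=> c0 cP; have m0 i : 0 <= Num.min 1 (c i) by rewrite le_min ler01 c0.
split=> // f /cP le1.
case: (boolP [forall u, c (f u) <= 1]) => [/forallP small|].
  apply: le_trans le1 _; apply: ler_sum => u _.
  by rewrite le_min small lexx.
rewrite negb_forall => /existsP[u]; rewrite -ltNge => big.
by rewrite (bigD1 u) //= (min_l (ltW big)) lerDl sumr_ge0.
Qed.

Section CoverBound.
Variables (R : realType) (H : graph) (m : nat).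
Hypothesis chi_ge2 : (2 <= chi H)%N.
Hypothesis chiE : chi H = m.+1.

Let h : R := #|H|%:R.
Let l : R := (min_color_class H)%:R.
Let M : R := m%:R.

Lemma card_ge1 : 1 <= h.
Proof. by rewrite ler1n card_gt0_of_chi. Qed.

Lemma min_color_class_ge1 : 1 <= l.
Proof. by rewrite ler1n min_color_class_gt0. Qed.

Lemma pred_chi_ge1 : 1 <= M.
Proof. by rewrite ler1n; move: chi_ge2; rewrite chiE. Qed.

Lemma min_color_class_mul_leR : l * (M + 1) <= h.
Proof. by rewrite natr1 -natrM ler_nat -chiE min_color_class_mul_le. Qed.

Lemma min_color_class_leR : l <= h.
Proof. by have := min_color_class_mul_leR; have := min_color_class_ge1; have := pred_chi_ge1; nra. Qed.

Section Graph.
Variables (I : finType) (e : rel I) (X : {set I}) (D : R).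
Hypothesis e_sym : symmetric e.
Hypothesis D_ge0 : 0 <= D.
Hypothesis nonadj_le : forall v, v \in X -> #|[set u in X | ~~ e v u]|%:R <= D.

(** Here [a] is the total weight of the [m] greedy vertices and [b] the weight of the lightest
    vertex of their common neighbourhood [A], which completes the clique. If [A] is empty, [b = 1]
    satisfies the clique inequality because [l] is at least 1. *)
Lemma cover_profile (c : I -> R) : fcover H e c -> (forall i, c i <= 1) ->
  M * D < #|X|%:R + D ->
  exists (a b : R) (A : {set I}),
  [/\ 0 <= a, 0 <= b <= 1, M <= (h - l) * a + M * l * b,
      D * a + (#|X|%:R - M * D) * b <= \sum_(u in X) c u &
      [/\ A \subset X, #|X|%:R - M * D <= #|A|%:R &
          forall u, u \in A -> b <= c u]].
Proof.
move=> cov c1 lt; have c0 := cov.1.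
have [v [A [vv AX vX AP [Acard Asum]]]] :=
  greedy_clique e_sym D_ge0 nonadj_le c0 (subxx X) lt.
exists (\sum_i c (v i)).
have a0 : 0 <= \sum_i c (v i) by apply: sumr_ge0.
have [A0|[u0 u0A]] := set_0Vmem A.
  exists 1, A; split=> //; first by rewrite ler01 lexx.
  - have := min_color_class_ge1; have := min_color_class_leR; have := pred_chi_ge1; nra.
  - by apply: Asum => [i|u]; [apply: c1 | rewrite A0 inE].
  by split=> // u; rewrite A0 inE.
case: (arg_minP c u0A) => w wA wmin; exists (c w), A; split=> //.
- by rewrite c0 c1.
- by apply: clique_weight => // i; case: (AP w i wA).
by apply: Asum => [i|u]; [case: (AP w i wA) | apply: wmin].
Qed.

End Graph.

Variable x : R.
Hypothesis x_itv : 0 <= x <= 1.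
Let z : R := x * l / h.
Let y : R := (1 - z) / M.

Lemma last_density_mul : h * z = x * l.
Proof. by rewrite /z mulrC divfK // gt_eqF //; have := card_ge1; lra. Qed.

Lemma first_density_mul : M * y = 1 - z.
Proof. by rewrite /y mulrC divfK // gt_eqF //; have := pred_chi_ge1; lra. Qed.

Lemma last_density_ge0 : 0 <= z.
Proof.
by have := last_density_mul; have := min_color_class_ge1; have := card_ge1; move: x_itv => /andP[? ?]; nra.
Qed.

Lemma last_density_le : z * (M + 1) <= 1.
Proof.
have h0 : 0 < h by have := card_ge1; lra.
rewrite -(ler_pM2l h0) mulr1 mulrA last_density_mul -mulrA.
have := min_color_class_mul_leR; have := min_color_class_ge1; have := pred_chi_ge1; move: x_itv => /andP[? ?].
by move: (l * (M + 1)) => t ? ? ?; nra.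
Qed.

Lemma first_density_gt0 : 0 < y.
Proof.
have z1 : z < 1 by have := last_density_le; have := last_density_ge0; have := pred_chi_ge1; nra.
by apply: divr_gt0; [lra | have := pred_chi_ge1; lra].
Qed.

Lemma first_density_le1 : y <= 1.
Proof.
have : 0 <= (M - 1) * y by rewrite mulr_ge0 ?(ltW first_density_gt0) ?subr_ge0 ?pred_chi_ge1.
by rewrite mulrBl mul1r first_density_mul; have := last_density_ge0; lra.
Qed.

(** The expression [y * a + z * b] is [x / (h * M)] times the right-hand side of the clique
    inequality plus [(1 - x) / M * a]. The latter is the surplus that keeps [a] small in a nearly
    optimal cover when [x < 1]. *)
Lemma profile_bound (a b : R) : 0 <= a -> M <= (h - l) * a + M * l * b ->
  x / h + (1 - x) / M * a <= y * a + z * b.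
Proof.
move=> a0 le; have h0 : 0 < h by have := card_ge1; lra.
have M0 : 0 < M by have := pred_chi_ge1; lra.
have -> : y * a + z * b = x / (h * M) * ((h - l) * a + M * l * b) + (1 - x) / M * a.
  by rewrite /y /z; field; rewrite !gt_eqF.
rewrite lerD2r; have -> : x / h = x / (h * M) * M by field; rewrite !gt_eqF.
rewrite ler_wpM2l // divr_ge0 //; first by case/andP: x_itv.
by rewrite mulr_ge0 ?ltW.
Qed.

Section Estimate.
Variables (I : finType) (e : rel I) (X : {set I}) (eps : R).
Hypothesis e_sym : symmetric e.
Hypothesis eps_gt0 : 0 < eps.
Hypothesis eps_lt : M * eps < y.
Hypothesis I_gt0 : (0 < #|I|)%N.
Let q : R := #|I|%:R.
Hypothesis X_large : (1 - eps) * q <= #|X|%:R.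
Hypothesis nonadj_le : forall v, v \in X ->
  #|[set u in X | ~~ e v u]|%:R <= (y + eps) * q.

(** The set [X] may miss [eps * q] points and each of the [m] greedy steps may lose [eps * q] points
    too many; as [b <= 1], this costs at most [(M + 1) * eps * q] in weight. *)
Lemma estimate_profile (c : I -> R) : fcover H e c -> (forall i, c i <= 1) ->
  exists (a b : R) (A : {set I}),
  [/\ 0 <= a, 0 <= b <= 1, M <= (h - l) * a + M * l * b,
      q * ((y * a + z * b) - (M + 1) * eps) <= \sum_(u in X) c u &
      [/\ A \subset X, q * (z - (M + 1) * eps) <= #|A|%:R &
          forall u, u \in A -> b <= c u]].
Proof.
move=> cov c1; have q0 : 0 < q by rewrite ltr0n.
have D0 : 0 <= (y + eps) * q.
  by rewrite mulr_ge0 ?(ltW q0) // addr_ge0 ?(ltW first_density_gt0) ?(ltW eps_gt0).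
have XD : q * (z - (M + 1) * eps) <= #|X|%:R - M * ((y + eps) * q).
  have -> : q * (z - (M + 1) * eps) = (1 - eps) * q - (1 - z + M * eps) * q by ring.
  have -> : M * ((y + eps) * q) = (1 - z + M * eps) * q by rewrite -first_density_mul; ring.
  by rewrite lerD2r.
have lt : M * ((y + eps) * q) < #|X|%:R + (y + eps) * q.
  have -> : M * ((y + eps) * q) = (1 - z + M * eps) * q by rewrite -first_density_mul; ring.
  apply: lt_le_trans (_ : (1 - eps) * q + (y + eps) * q <= _); last by rewrite lerD2r.
  rewrite -mulrDl ltr_pM2r //; have := last_density_ge0; have := eps_lt; lra.
have [a [b [A [a0 b01 ab sumX [AX cardA bA]]]]] :=
  cover_profile e_sym D0 nonadj_le cov c1 lt.
exists a, b, A; split=> //; last by split=> //; apply: le_trans cardA.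
apply: le_trans sumX.
have /andP[b0 b1] := b01.
have bXD : q * (z - (M + 1) * eps) * b <= (#|X|%:R - M * ((y + eps) * q)) * b.
  by rewrite ler_wpM2r.
have err1 : 0 <= eps * q * a by rewrite !mulr_ge0 // ltW.
have err2 : 0 <= q * ((M + 1) * eps) * (1 - b).
  rewrite !mulr_ge0 //; try exact: ltW; last by lra.
  by have := pred_chi_ge1; lra.
have -> : (y + eps) * q * a = q * (y * a) + eps * q * a by ring.
move: bXD; have -> : q * (z - (M + 1) * eps) * b =
  q * (y * a + z * b - (M + 1) * eps) - q * (y * a) + q * ((M + 1) * eps) * (1 - b)
  by ring.
by lra.
Qed.

Lemma cover_sum_ge (c : I -> R) : fcover H e c ->
  (x / h - (M + 1) * eps) * q <= \sum_i c i.
Proof.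
move=> cov; have cov1 := fcover_min1 cov; have q0 : 0 < q by rewrite ltr0n.
have c1 i : Num.min 1 (c i) <= 1 by rewrite ge_min lexx.
have [a [b [A [a0 b01 ab sumX _]]]] := estimate_profile cov1 c1.
apply: (@le_trans _ _ (\sum_(u in X) Num.min 1 (c u))); last first.
  rewrite [leRHS](bigID (mem X)) /= -[leLHS]addr0 lerD ?sumr_ge0 //.
    by apply: ler_sum => u _; rewrite ge_min lexx orbT.
  by move=> u _; apply: cov.1.
apply: le_trans sumX; rewrite mulrC ler_pM2l // lerD2r.
apply: le_trans (profile_bound a0 ab); rewrite lerDl mulr_ge0 // divr_ge0 //.
by rewrite subr_ge0; case/andP: x_itv.
Qed.

(** The surplus in [profile_bound] gives [a <= kap], so the clique inequality makes [l * b] nearly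
    1. The vertices of [A], about [z * q] at least, then use up almost the whole weight, and few
    others can have weight above [eta]. On the light vertices [T] a clique with [m.+1] vertices
    would violate the clique inequality. *)
Lemma clique_free_part (kap del : R) (c : I -> R) : x < 1 ->
  h * kap <= 1 / 2 -> del + (M + 1) * eps <= (1 - x) / M * kap ->
  fcover H e c -> \sum_i c i <= (x / h + del) * q ->
  exists T : {set I}, [/\ T \subset X,
    (1 - z - eps - 2 * h * (del + kap + (M + 1) * eps)) * q <= #|T|%:R &
    forall (v : 'I_m -> I) (w : I), (forall i, v i \in T) -> w \in T ->
      (forall i j, i != j -> e (v i) (v j)) -> ~ (forall i, e w (v i))].
Proof.
move=> x1 hkap small cov0 sum0; have cov := fcover_min1 cov0.
have q0 : 0 < q by rewrite ltr0n.
have := card_ge1; have := min_color_class_ge1; have := pred_chi_ge1; have := min_color_class_leR => lh M1 l1 h1.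
have /andP[x0 _] := x_itv.
pose d i := Num.min 1 (c i); have d1 i : d i <= 1 by rewrite ge_min lexx.
have [a [b [A [a0 /andP[b0 b1] ab sumX [AX cardA bA]]]]] := estimate_profile cov d1.
have sumX_le : \sum_(u in X) d u <= (x / h + del) * q.
  apply: le_trans sum0; rewrite [leRHS](bigID (mem X)) /= -[leLHS]addr0.
  rewrite lerD ?sumr_ge0 //; first by apply: ler_sum => u _; rewrite ge_min lexx orbT.
  by move=> u _; apply: cov0.1.
have akap : a <= kap.
  have k0 : 0 < (1 - x) / M by rewrite divr_gt0; lra.
  rewrite -(ler_pM2l k0); apply: le_trans small.
  have := le_trans sumX sumX_le; rewrite mulrC ler_pM2r //.
  by have := profile_bound a0 ab; lra.
have lb : 1 - h * kap <= l * b.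
  have M0 : 0 < M by lra.
  rewrite -(ler_pM2l M0).
  have k1 : (h - l) * a <= h * kap by apply: ler_pM => //; lra.
  have k2 : h * kap <= M * (h * kap).
    by rewrite ler_peMl // mulr_ge0 //; lra.
  by rewrite mulrBr mulr1 mulrA; lra.
(* A copy of [H] all of whose vertices have weight at most [eta] has weight at most 1/2; moreover
   [h * kap <= 1 / 2] ensures [eta <= b]. *)
pose eta : R := 1 / (2 * h).
have eta0 : 0 < eta by rewrite divr_gt0 //; lra.
have heta : 2 * h * eta = 1 by rewrite /eta mulrC divfK // gt_eqF //; lra.
have etab : eta <= b.
  have : h * eta <= l * b by lra.
  by nra.
pose S := [set u in X | eta < d u].
pose T := [set u in X | d u <= eta].
have XTS : #|X|%:R = #|T|%:R + #|S|%:R :> R.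
  rewrite -natrD -(cardsID [set u | d u <= eta] X); congr (_ + _)%:R.
    by apply: eq_card => u; rewrite !inE.
  by apply: eq_card => u; rewrite !inE andbC ltNge.
exists T; split; first by apply/subsetP => u; rewrite inE => /andP[].
  have zb : x / h - kap <= z * b.
    have -> : z * b = x / h * (l * b) by rewrite /z; ring.
    have xh0 : 0 <= x / h by rewrite divr_ge0 //; lra.
    have xh : x / h * (h * kap) = x * kap by rewrite mulrA divfK // gt_eqF //; lra.
    have : x / h * (1 - h * kap) <= x / h * (l * b) by rewrite ler_wpM2l.
    by rewrite mulrBr mulr1 xh; nra.
  have sumS : eta * #|S|%:R + (b - eta) * #|A|%:R <= \sum_(u in X) d u.
    rewrite -[leRHS](eq_bigr _ (fun _ _ => erefl)) (big_setID A) /= (setIidPr AX).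
    have s1 : b * #|A|%:R <= \sum_(u in A) d u.
      by rewrite mulr_natr -sumr_const; apply: ler_sum.
    have s2 : eta * (#|S|%:R - #|A|%:R) <= \sum_(u in X :\: A) d u.
      apply: (@le_trans _ _ (eta * #|S :\: A|%:R)).
        rewrite ler_pM2l // lerBlDr -natrD ler_nat -(cardsID A S) addnC leq_add2l.
        by rewrite subset_leq_card // subsetIr.
      rewrite mulr_natr -sumr_const [leRHS](bigID (mem S)) /= -[leLHS]addr0.
      apply: lerD; last by apply: sumr_ge0 => u _; apply: cov.1.
      rewrite [leRHS](eq_bigl (mem (S :\: A))) => [|u].
        by apply: ler_sum => u; rewrite !inE => /andP[_ /andP[_ /ltW]].
      by rewrite !inE; case: (u \in A); case: (u \in X).
    by lra.
  have bA' : (b - eta) * (q * (z - (M + 1) * eps)) <= (b - eta) * #|A|%:R.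
    by rewrite ler_wpM2l // subr_ge0.
  have k1 : eta * #|S|%:R <= q * (del + kap + (M + 1) * eps + eta * z).
    apply: le_trans (_ : (x / h + del) * q - (b - eta) * #|A|%:R <= _).
      by rewrite lerBrDr; apply: le_trans sumX_le.
    apply: le_trans (_ : (x / h + del) * q - (b - eta) * (q * (z - (M + 1) * eps)) <= _).
      by rewrite lerD2l lerN2.
    have -> : (x / h + del) * q - (b - eta) * (q * (z - (M + 1) * eps)) =
      q * (x / h + del - z * b + eta * z + (b - eta) * ((M + 1) * eps)) by ring.
    rewrite ler_pM2l //.
    have k2 : (b - eta) * ((M + 1) * eps) <= (M + 1) * eps.
      rewrite ler_piMl //; last by lra.
      by rewrite mulr_ge0 ?(ltW eps_gt0) //; lra.
    by lra.
  have h20 : 0 <= 2 * h by lra.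
  have := ler_wpM2l h20 k1; rewrite mulrA heta mul1r => k3.
  have k4 : 2 * h * (q * (del + kap + (M + 1) * eps + eta * z)) =
    2 * h * (del + kap + (M + 1) * eps) * q + (2 * h * eta) * z * q by ring.
  rewrite k4 heta mul1r in k3.
  have := X_large; rewrite XTS => k5.
  have -> : (1 - z - eps - 2 * h * (del + kap + (M + 1) * eps)) * q =
    (1 - eps) * q - (2 * h * (del + kap + (M + 1) * eps) * q + z * q) by ring.
  by lra.
move=> v w vT wT vv wv.
have k0 : M <= (h - l) * \sum_i d (v i) + M * l * d w :=
  clique_weight e_sym chi_ge2 chiE cov vv wv.
have vle i : d (v i) <= eta by have := vT i; rewrite inE => /andP[].
have wle : d w <= eta by move: wT; rewrite inE => /andP[].
have k1 : \sum_i d (v i) <= M * eta.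
  have -> : M * eta = \sum_(i < m) eta by rewrite sumr_const card_ord mulr_natl.
  by apply: ler_sum => i _; apply: vle.
have k2 : (h - l) * \sum_i d (v i) <= (h - l) * (M * eta).
  by rewrite ler_wpM2l // subr_ge0.
have k3 : M * l * d w <= M * l * eta by rewrite ler_wpM2l // mulr_ge0 ?ler0n.
have k4 : 2 * ((h - l) * (M * eta) + M * l * eta) = M * (2 * h * eta) by ring.
rewrite heta in k4; lra.
Qed.

End Estimate.
End CoverBound.

(** * Sampled sets *)

Lemma natr_card (R : realType) (T : finType) (P : pred T) :
  #|[set t | P t]|%:R = \sum_t (P t)%:R :> R.
Proof.
by rewrite -natr_sum cardsE -sum1_card big_mkcond.
Qed.

Definition clique_in (I : finType) (e : rel I) (Y : {set I}) k
    (v : {ffun 'I_k -> I}) :=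
  [forall i, v i \in Y] && [forall i, forall j, (i != j) ==> e (v i) (v j)].

Lemma clique_inP (I : finType) (e : rel I) (Y : {set I}) k (v : {ffun 'I_k -> I}) :
  reflect ((forall i, v i \in Y) /\ (forall i j, i != j -> e (v i) (v j)))
    (clique_in e Y v).
Proof.
apply: (iffP andP) => [[/forallP vY /forallP vv]|[vY vv]]; split=> //.
- by move=> i j; have /forallP/(_ j)/implyP := vv i.
- exact/forallP.
by apply/forallP => i; apply/forallP => j; apply/implyP; apply: vv.
Qed.

Lemma clique_in_fcons (I : finType) (e : rel I) (Y : {set I}) k u
    (v : {ffun 'I_k -> I}) : symmetric e -> u \in Y ->
  clique_in e [set w in Y | e u w] v -> clique_in e Y (fcons u v).
Proof.
move=> e_sym uY /clique_inP[vY vv].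
have {vY} vY i : v i \in Y /\ e u (v i) by have := vY i; rewrite inE => /andP.
apply/clique_inP; split=> [i|i j].
  by case: (unliftP ord0 i) => [i'|] ->; rewrite ?fconsS ?fcons0 //; case: (vY i').
case: (unliftP ord0 i) => [i'|] ->; case: (unliftP ord0 j) => [j'|] ->;
  rewrite ?fconsS ?fcons0 ?eqxx //.
- by rewrite (inj_eq (lift_inj (h := ord0))); apply: vv.
- by move=> _; rewrite e_sym; case: (vY i').
by move=> _; case: (vY j').
Qed.

(** Choosing the vertices one by one leaves at least [r] options at each of the [k] steps. *)
Lemma card_cliques_ge (R : realType) (I : finType) (e : rel I) (X : {set I})
    (D r : R) k (Y : {set I}) : symmetric e -> 0 <= D -> 0 <= r ->
  (forall v, v \in X -> #|[set u in X | ~~ e v u]|%:R <= D) ->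
  Y \subset X -> k%:R * D + r <= #|Y|%:R + D ->
  r ^+ k <= #|[set v : {ffun 'I_k -> I} | clique_in e Y v]|%:R.
Proof.
move=> e_sym D0 r0 nonadj; elim: k Y => [|k IH] Y YX le.
  rewrite expr0 ler1n; apply/card_gt0P.
  exists [ffun i : 'I_0 => False_rect _ (notF (ltn_ord i))].
  by rewrite inE; apply/clique_inP; split; case.
have cardY : r <= #|Y|%:R.
  have : 0 <= k%:R * D by rewrite mulr_ge0 ?ler0n.
  by move: le; rewrite -natr1 mulrDl mul1r; lra.
apply: (@le_trans _ _ (\sum_(u in Y) r ^+ k)).
  by rewrite sumr_const -[leRHS]mulr_natl exprS ler_wpM2r ?exprn_ge0.
rewrite natr_card big_fcons [leLHS]big_mkcond.
apply: ler_sum => u _; case: (boolP (u \in Y)) => uY; last first.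
  by apply: sumr_ge0 => v _.
have := card_neighbours_ge nonadj YX uY => cardN.
have le' : k%:R * D + r <= #|[set w in Y | e u w]|%:R + D.
  by move: le; rewrite -natr1 mulrDl mul1r; lra.
have NX : [set w in Y | e u w] \subset X.
  by apply: subset_trans YX; apply/subsetP => w; rewrite inE => /andP[].
apply: le_trans (IH _ NX le') _.
rewrite natr_card; apply: ler_sum => v _; rewrite ler_nat.
by case: (boolP (clique_in e _ v)) => [/(clique_in_fcons e_sym uY) ->|_].
Qed.

Section SampledSets.
Variables (R : realType) (C W : finType) (s : nat).
Hypothesis C_gt0 : (0 < #|C|)%N.
Hypothesis W_gt0 : (0 < #|W|)%N.
Hypothesis s_gt0 : (0 < s)%N.
Implicit Types (g : {ffun 'I_s -> C}).

Definition pull g (a : 'I_s * W) : C * W := (g a.1, a.2).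

Definition discrepancy (S : {ffun 'I_s -> C} -> {set C * W}) g : R :=
  #|[set a | pull g a \in S g]|%:R / #|{: 'I_s * W}|%:R
  - #|S g|%:R / #|{: C * W}|%:R.

(** This is [deviation] for the function that maps a cluster to the proportion of its points in
    [S g]. *)
Lemma set_deviation (S : {ffun 'I_s -> C} -> {set C * W}) (K : {set 'I_s})
    k (eps : R) : (#|K| <= k)%N ->
  (forall g j c, j \notin K -> S (upd g j c) = S g) -> 0 < eps ->
  eps ^+ 2 * s%:R * #|[set g | eps < `|discrepancy S g|]|%:R <=
  (k + 1)%:R * #|C|%:R ^+ s.
Proof.
move=> Kk S_dep eps0; have W0 : 0 < #|W|%:R :> R by rewrite ltr0n.
pose f g c : R := #|[set w | (c, w) \in S g]|%:R / #|W|%:R.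
have f_itv g c : 0 <= f g c <= 1.
  by rewrite divr_ge0 // ler_pdivrMr // mul1r ler_nat max_card.
have f_dep g j c d : j \notin K -> f (upd g j c) d = f g d.
  by move=> jK; rewrite /f S_dep.
have eE g : discrepancy S g = empirical f g - mean f g.
  rewrite /discrepancy /empirical /mean /f -!mulr_suml -!natr_sum !card_prod card_ord.
  rewrite -(card_pairs (fun j w => (g j, w) \in S g)).
  rewrite -(card_pairs (fun c w => (c, w) \in S g)).
  rewrite !natrM !invfM -!mulrA; congr (_%:R * _ - _%:R * _); try by rewrite mulrC.
  by apply: eq_card => p; rewrite inE; case: p.
have -> : [set g | eps < `|discrepancy S g|] =
    [set g | eps < `|empirical f g - mean f g|].
  by apply/setP => g; rewrite !inE eE.
apply: le_trans (deviation f_itv f_dep C_gt0 s_gt0 eps0) _.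
by rewrite ler_wpM2r ?exprn_ge0 ?ler0n // ler_nat leq_add2r.
Qed.

(** Markov's inequality over the index [a], on top of Chebyshev's over the sample; this costs one
    more factor [eps]. *)
Lemma set_deviation_family (A : finType)
    (S : A -> {ffun 'I_s -> C} -> {set C * W}) (K : A -> {set 'I_s}) k
    (eps : R) : (forall a, #|K a| <= k)%N ->
  (forall a g j c, j \notin K a -> S a (upd g j c) = S a g) -> 0 < eps ->
  eps ^+ 3 * s%:R *
    #|[set g | eps * #|A|%:R < #|[set a | eps < `|discrepancy (S a) g|]|%:R]|%:R <=
  (k + 1)%:R * #|C|%:R ^+ s.
Proof.
move=> Kk S_dep eps0; have [A0|A0] := posnP #|A|.
  rewrite (_ : [set g | _] = set0) ?cards0 ?mulr0 ?mulr_ge0 ?exprn_ge0 ?ler0n //.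
  apply/setP => g; rewrite !inE A0 mulr0 ltr0n; apply/negbTE; rewrite -leqNgt.
  by rewrite -A0 max_card.
have A0' : 0 < #|A|%:R :> R by rewrite ltr0n.
rewrite -(ler_pM2l A0').
pose F g : R := #|[set a | eps < `|discrepancy (S a) g|]|%:R.
have F0 g : 0 <= F g by apply: ler0n.
have := markov_count (eps * #|A|%:R) F0.
have e2s : 0 <= eps ^+ 2 * s%:R by rewrite mulr_ge0 ?exprn_ge0 ?ltW ?ltr0n.
move=> /(ler_wpM2l e2s) le.
have -> : #|A|%:R * (eps ^+ 3 * s%:R * #|[set g | eps * #|A|%:R < F g]|%:R) =
  eps ^+ 2 * s%:R * (eps * #|A|%:R * #|[set g | eps * #|A|%:R < F g]|%:R) by ring.
apply: le_trans le _.
have -> : \sum_g F g = \sum_a #|[set g | eps < `|discrepancy (S a) g|]|%:R.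
  rewrite /F; under eq_bigr do rewrite natr_card.
  by rewrite exchange_big /=; apply: eq_bigr => a _; rewrite natr_card.
rewrite mulr_sumr [leRHS]mulr_natl -[leRHS]sumr_const; apply: ler_sum => a _.
exact: set_deviation (Kk a) (S_dep a) eps0.
Qed.

End SampledSets.

(** * Maximum tilings and blocks *)

Lemma til_ge_family (H G : graph) (J : finType) (f : J -> {ffun H -> G}) :
  (0 < #|H|)%N -> (forall j, embedding (f j)) ->
  (forall i j u v, f i u = f j v -> i = j) -> (#|J| <= til H G)%N.
Proof.
move=> /card_gt0P[u0 _] emb disj.
have f_inj : injective f by move=> i j fij; apply: (disj i j u0 u0); rewrite fij.
rewrite -(card_imset predT f_inj) /til.
apply: (@leq_bigmax_cond _ (@tiling H G) (fun F => #|F|) [set f x | x in predT]).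
apply/andP; split; first by apply/forall_inP => _ /imsetP[j _ ->].
apply/forall_inP => _ /imsetP[i _ ->]; apply/forall_inP => _ /imsetP[j _ ->].
apply/implyP => fij; rewrite disjoint_has; apply/hasPn => w /codomP[u ->].
apply/codomP => -[v fuv]; move: fij.
by rewrite (disj _ _ _ _ fuv) eqxx.
Qed.

Lemma til_attained (H G : graph) :
  exists2 F : {set {ffun H -> G}}, tiling F & #|F| = til H G.
Proof.
have t0 : tiling (set0 : {set {ffun H -> G}}).
  by apply/andP; split; apply/forall_inP => f; rewrite inE.
have p0 : (0 < #|[pred F : {set {ffun H -> G}} | tiling F]|)%N.
  by apply/card_gt0P; exists set0.
by have [F FP FE] := eq_bigmax_cond (fun F : {set {ffun H -> G}} => #|F|) p0; exists F.
Qed.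

(* A partition of all but fewer than #|H| vertices of G into labelled copies of
   the vertex set of H, among which are the members of a maximum tiling. *)
Lemma cluster_partition (H G : graph) : (0 < #|H|)%N ->
  exists (C : finType) (copy : pred C) (vert : C * H -> G),
  [/\ injective vert, #|[set c | copy c]| = til H G,
      forall c, copy c -> embedding [ffun u => vert (c, u)] &
      (#|G| < #|C| * #|H| + #|H|)%N].
Proof.
move=> H0; have [F /andP[/forall_inP Femb /forall_inP Fdisj] FE] := til_attained H G.
pose used := \bigcup_(f in F) [set f u | u : H].
pose L := enum (~: used).
pose q := (size L %/ #|H|)%N.
have ltL (j : 'I_q) (u : H) : (j * #|H| + enum_rank u < size L)%N.
  apply: (@leq_trans (j.+1 * #|H|)).
    by rewrite mulSn addnC ltn_add2r.
  apply: leq_trans (leq_trunc_div (size L) #|H|).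
  by rewrite leq_mul2r ltn_ord orbT.
pose vert (p : ({f | f \in F} + 'I_q) * H) : G :=
  match p.1 with
  | inl f => val f p.2
  | inr j => tnth (in_tuple L) (Ordinal (ltL j p.2))
  end.
have inF (f : {f | f \in F}) u : val f u \in used.
  by apply/bigcupP; exists (val f); [apply: valP | apply: imset_f].
have inL j u : tnth (in_tuple L) (Ordinal (ltL j u)) \notin used.
  by have := mem_tnth (Ordinal (ltL j u)) (in_tuple L); rewrite mem_enum inE.
have Finj (f : {f | f \in F}) : injective (val f).
  by have /Femb/andP[/injectiveP] := valP f.
exists ({f | f \in F} + 'I_q)%type, (fun c => if c is inl _ then true else false), vert.
split.
- case=> [[f|j] u] [[g|i] v] /=; rewrite /vert /= => E.
  + case: (eqVneq f g) => [fg|fg].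
      by move: E; rewrite fg => /Finj ->.
    have /forall_inP/(_ _ (valP g))/implyP := Fdisj _ (valP f).
    rewrite (inj_eq val_inj) => /(_ fg) /disjointFr /(_ (codom_f _ u)).
    by rewrite E codom_f.
  + by have := inL i v; rewrite -E inF.
  + by have := inL j u; rewrite E inF.
  have /tuple_uniqP/(_ _ _ E) : uniq (in_tuple L) by apply: enum_uniq.
  case=> Eji.
  have := congr1 (fun n => n %/ #|H|)%N Eji; have := congr1 (fun n => n %% #|H|)%N Eji.
  rewrite /= !modnMDl !divnMDl // !modn_small ?ltn_ord // !divn_small ?ltn_ord // !addn0.
  move=> uv ji; have {}uv : enum_rank u = enum_rank v by apply: val_inj.
  by rewrite (val_inj ji) (enum_rank_inj uv).
- have inl_inj : injective (@inl {f | f \in F} 'I_q) by move=> f g [].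
  rewrite -FE; transitivity #|[set @inl _ 'I_q f | f : {f | f \in F}]|.
    apply: eq_card => -[f|j]; first by rewrite inE imset_f.
    by rewrite inE; apply/esym/negbTE/imsetP; case.
  by rewrite card_imset // card_sig.
- case=> [f|//] _; have -> : [ffun u => vert (inl f, u)] = val f.
    by apply/ffunP => u; rewrite ffunE.
  exact: Femb (valP f).
rewrite card_sum card_sig card_ord FE mulnDl.
have le : (#|used| <= til H G * #|H|)%N.
  rewrite -FE -sum_nat_const /used; elim/big_rec2: _ => [|f n A _ IH].
    by rewrite cards0.
  apply: leq_trans (leq_card_setU _ _) (leq_add _ IH).
  by rewrite (leq_trans (leq_imset_card _ _)) ?max_card.
rewrite -(cardsC used) [#|~: used|]cardE -/L.
have := ltn_ceil (size L) H0; lia.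
Qed.

Section Exchange.
Variables (R : realType) (H G : graph) (C : finType) (copy : pred C).
Variables (vert : C * H -> G) (E : rel (C * H)).
Hypothesis H_gt0 : (0 < #|H|)%N.
Hypothesis vert_inj : injective vert.
Hypothesis card_copy : #|[set c | copy c]| = til H G.
Hypothesis copy_emb : forall c, copy c -> embedding [ffun u => vert (c, u)].
Hypothesis E_adj : forall a b, E a b -> (a.1 != b.1) && adj (vert a) (vert b).

(* The copies found in a block may replace the members of the maximum tiling
   that the block contains. *)
Lemma exchange (s N T : nat) (b : 'I_s -> 'I_T -> C)
    (t : {ffun 'I_N -> {ffun H -> 'I_s * H}}) :
  (forall i j p q, b i p = b j q -> i = j /\ p = q) ->
  (forall tau : 'I_s -> 'I_T, forall k u v, adj u v ->
     E (b (t k u).1 (tau (t k u).1), (t k u).2)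
       (b (t k v).1 (tau (t k v).1), (t k v).2)) ->
  (forall a, (#|[set p : 'I_N * H | t p.1 p.2 == a]| <= T)%N) ->
  (N <= #|[set x : 'I_s * 'I_T | copy (b x.1 x.2)]|)%N.
Proof.
move=> b_inj t_hom load.
have rank_lt (x : 'I_N * H) :
    (index x (enum [set p : 'I_N * H | t p.1 p.2 == t x.1 x.2]) < T)%N.
  by apply: leq_trans (load (t x.1 x.2)); rewrite cardE index_mem mem_enum inE.
(* The pairs sent to the same point of the sample are ranked, and the rank below [T] tells which
   clone each of them uses. *)
pose rk x := Ordinal (rank_lt x).
have rk_inj x x' : t x.1 x.2 = t x'.1 x'.2 -> rk x = rk x' -> x = x'.
  move=> tE /(congr1 val) /=; rewrite -tE => iE.
  by apply: (index_inj x _ _ iE); rewrite mem_enum // inE tE.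
pose c (x : 'I_N * H) := b (t x.1 x.2).1 (rk x).
pose new k : {ffun H -> G} := [ffun u => vert (c (k, u), (t k u).2)].
have new_inj k k' u u' : new k u = new k' u' -> k = k' /\ u = u'.
  rewrite !ffunE => /vert_inj [/b_inj [e1 e2] e3].
  have tE : t k u = t k' u' by move: e1 e3; case: (t k u) (t k' u') => [? ?] [? ?] /= -> ->.
  by have [] := @rk_inj (k, u) (k', u') tE e2.
have new_emb k : embedding (new k).
  apply/andP; split; first by apply/injectiveP => u v /new_inj[].
  apply/forallP => u; apply/forallP => v; apply/implyP => uv; rewrite !ffunE.
  (* The hypothesis [t_hom] sees one cluster per class. Since [E] fails inside a cluster, a constant
     [tau] shows that adjacent vertices lie in different classes, so a single [tau] can select the
     clones of both. *)
  pose i0 := rk (k, u).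
  have : (t k u).1 != (t k v).1.
    have /E_adj/andP[/eqP ne _] := t_hom (fun=> i0) k u v uv.
    by apply/eqP => eq; apply: ne; rewrite /= eq.
  move=> ne; have := t_hom (fun i => if i == (t k u).1 then i0 else rk (k, v)) k u v uv.
  by rewrite eqxx eq_sym (negPf ne) => /E_adj/andP[_].
pose B := [set b x.1 x.2 | x : 'I_s * 'I_T].
pose J := ({c | copy c && (c \notin B)} + 'I_N)%type.
pose f (j : J) : {ffun H -> G} :=
  match j with inl c => [ffun u => vert (val c, u)] | inr k => new k end.
have : (#|{: J}| <= til H G)%N.
  apply: (til_ge_family (f := f)) => //.
    by case=> [a|k] //=; apply: copy_emb; case/andP: (valP a).
  case=> [a|k] [a'|k'] u v /=; rewrite ?ffunE.
  - by move/vert_inj => [/val_inj ->].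
  - move/vert_inj => [aE _]; have /andP[_ /negP[]] := valP a.
    by apply/imsetP; exists ((t k' v).1, rk (k', v)).
  - move/vert_inj => [aE _]; have /andP[_ /negP[]] := valP a'.
    by apply/imsetP; exists ((t k u).1, rk (k, u)).
  by move=> e; have [|-> _] // := @new_inj k k' u v; rewrite !ffunE.
rewrite card_sum card_ord card_sig -card_copy => le.
have : (#|[set c | copy c]| <= #|[pred c | copy c && (c \notin B)]| +
   #|[set x : 'I_s * 'I_T | copy (b x.1 x.2)]|)%N.
  rewrite -(cardsID B) addnC leq_add //.
    by apply: eq_leq; apply: eq_card => a; rewrite !inE andbC.
  apply: (@leq_trans #|[set b x.1 x.2 | x in [set x : 'I_s * 'I_T | copy (b x.1 x.2)]]|).
    apply: subset_leq_card; apply/subsetP => a; rewrite !inE => /andP[ca /imsetP[x _ aE]].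
    by apply/imsetP; exists x => //; rewrite inE -aE.
  exact: leq_imset_card.
by lia.
Qed.

End Exchange.

(** * Exchange in dense families of samples *)

Lemma double_count (R : realType) (A T : finType) (F : {set A}) (P : T -> pred A) :
  \sum_t #|[set g in F | P t g]|%:R = \sum_(g in F) #|[set t | P t g]|%:R :> R.
Proof.
under eq_bigr do rewrite natr_card.
rewrite exchange_big [RHS]big_mkcond /=; apply: eq_bigr => g _.
rewrite natr_card; case: (g \in F) => //.
by rewrite big1.
Qed.

Definition sampled (C W : finType) (E : rel (C * W)) s (g : {ffun 'I_s -> C}) :
    rel ('I_s * W) := fun a b => E (pull g a) (pull g b).

(** There are finitely many [t], so one of them tiles a proportion [gam'] of the samples, and these
    contain a complete block. Its clusters are distinct because its transversals are injective. The
    [T] transversals with constant [tau] partition it, so it contains at most [kap * T] members of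
    the maximum tiling, and [exchange] compares this with [N]. *)
Lemma dense_exchange (R : realType) (H : graph) (s N T : nat) (gam : R) :
  0 < gam -> (0 < #|H|)%N -> (0 < T)%N ->
  exists n0 : nat, forall (G : graph) (C : finType)
    (copy : pred C) (vert : C * H -> G) (E : rel (C * H)) (kap : R)
    (F : {set {ffun 'I_s -> C}}),
  injective vert -> #|[set c | copy c]| = til H G ->
  (forall c, copy c -> embedding [ffun u => vert (c, u)]) ->
  (forall a b, E a b -> (a.1 != b.1) && adj (vert a) (vert b)) ->
  (n0 < #|C|)%N -> gam * #|C|%:R ^+ s <= #|F|%:R ->
  (forall g, g \in F -> [/\ injective g, tileable H (sampled E g) N T &
     #|[set i | copy (g i)]|%:R <= kap]) ->
  N%:R <= kap * T%:R.
Proof.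
move=> gam0 H0 T0; pose Ty := {ffun 'I_N -> {ffun H -> 'I_s * H}}.
pose gam' := gam / (#|{: Ty}|%:R + 1).
have Ty0 : 0 < #|{: Ty}|%:R + 1 :> R by rewrite ltr_wpDl.
have gam'0 : 0 < gam' by rewrite divr_gt0.
have [n0 n0P] := @dense_block R s T gam' gam'0.
exists n0 => G C copy vert E kap F vert_inj card_copy copy_emb E_adj nC gF FP.
pose P (t : Ty) g := [forall k, is_hom (sampled E g) (t k)] &&
  [forall a, #|[set p : 'I_N * H | t p.1 p.2 == a]| <= T]%N.
have C0 : 0 < #|C|%:R :> R by rewrite ltr0n (leq_ltn_trans _ nC).
have [t tP] : exists t, gam' * #|C|%:R ^+ s < #|[set g in F | P t g]|%:R.
  apply: exists_average; rewrite double_count.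
  apply: lt_le_trans (_ : #|F|%:R <= _).
    apply: lt_le_trans gF; rewrite mulrAC ltr_pM2r ?exprn_gt0 //.
    rewrite /gam' mulrAC ltr_pdivrMr // ltr_pM2l //; lra.
  rewrite -sumr_const; apply: ler_sum => g /FP[_ [t thom tload] _].
  rewrite ler1n; apply/card_gt0P; exists t; rewrite inE.
  by apply/andP; split; apply/forallP.
have [b binj bP] := n0P C _ nC (ltW tP).
have {}bP tau : exists g : {ffun 'I_s -> C},
    [/\ g \in F, P t g & forall i, g i = b i (tau i)].
  exists [ffun i => b i (tau i)]; have := bP tau; rewrite inE => /andP[? ?].
  by split=> // i; rewrite ffunE.
have joint i j p q : b i p = b j q -> i = j /\ p = q.
  move=> bE; case: (eqVneq i j) => [ij|ij].
    by split=> //; apply: (binj i); rewrite bE ij.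
  have [g [/FP[ginj _ _] _ gE]] := bP (fun k => if k == i then p else q).
  have : g i = g j by rewrite !gE eqxx eq_sym (negPf ij).
  by move/ginj/eqP; rewrite (negPf ij).
have tload a : (#|[set p : 'I_N * H | t p.1 p.2 == a]| <= T)%N.
  by have [g [_ /andP[_ /forallP]]] := bP (fun=> Ordinal T0).
have thom (tau : 'I_s -> 'I_T) k u v : adj u v ->
     E (b (t k u).1 (tau (t k u).1), (t k u).2)
       (b (t k v).1 (tau (t k v).1), (t k v).2).
  move=> uv; have [g [_ /andP[/forallP/(_ k)/is_homP hom _] gE]] := bP tau.
  by have := hom u v uv; rewrite /sampled /pull !gE.
have := exchange H0 vert_inj card_copy copy_emb E_adj joint thom tload.
rewrite -(ler_nat R) => /le_trans; apply.
rewrite (card_pairs (fun i p => copy (b i p))).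
have -> : (\sum_i #|[set p | copy (b i p)]| = \sum_p #|[set i | copy (b i p)]|)%N.
  have sum_card (A : finType) (Q : pred A) : (#|[set a | Q a]| = \sum_a (Q a : nat))%N.
    by rewrite cardsE -sum1_card big_mkcond.
  under eq_bigr do rewrite sum_card.
  by rewrite exchange_big /=; apply: eq_bigr => p _; rewrite sum_card.
have -> : kap * T%:R = \sum_(p < T) kap by rewrite sumr_const card_ord mulr_natr.
rewrite natr_sum; apply: ler_sum => p _.
have [g [/FP[_ _ gk] _ gE]] := bP (fun=> p).
apply: le_trans gk; rewrite ler_nat; apply: eq_leq; apply: eq_card => i.
by rewrite !inE gE.
Qed.

Lemma non_injective_count (R : realType) (C : finType) (s : nat) :
  #|C|%:R * #|[set g : {ffun 'I_s -> C} | ~~ injectiveb g]|%:R <=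
  s%:R ^+ 2 * #|C|%:R ^+ s :> R.
Proof.
pose eqs (p : 'I_s * 'I_s) (g : {ffun 'I_s -> C}) := (p.1 != p.2) && (g p.1 == g p.2).
have le1 : #|[set g : {ffun 'I_s -> C} | ~~ injectiveb g]|%:R <=
    \sum_p #|[set g | eqs p g]|%:R :> R.
  rewrite natr_card; under [leRHS]eq_bigr do rewrite natr_card.
  rewrite [leRHS]exchange_big /=; apply: ler_sum => g _.
  case: (boolP (injectiveb g)) => [_|/injectivePn[i [j ij gij]]].
    by rewrite sumr_ge0.
  rewrite (bigD1 (i, j)) //= /eqs /= ij gij eqxx lerDl.
  by rewrite sumr_ge0.
have C0 : 0 <= #|C|%:R :> R by rewrite ler0n.
apply: le_trans (ler_wpM2l C0 le1) _; rewrite mulr_sumr.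
have -> : s%:R ^+ 2 * #|C|%:R ^+ s = \sum_(p : 'I_s * 'I_s) #|C|%:R ^+ s :> R.
  by rewrite sumr_const card_prod card_ord -[RHS]mulr_natl natrM -expr2.
apply: ler_sum => -[i j] _; rewrite natr_card /eqs /=.
case: (eqVneq i j) => [_|ij]; first by rewrite big1 ?mulr0 ?exprn_ge0.
rewrite (resample _ i) -card_samples -sumr_const; apply: ler_sum => g _.
have ji : j != i by rewrite eq_sym.
rewrite (bigD1 (g j)) //= big1 ?addr0 => [|c cg].
  by rewrite lern1; case: (_ == _).
by rewrite upd_eq upd_neq // (negPf cg).
Qed.

Section Clusters.
Variables (H G : graph) (C : finType) (copy : pred C) (vert : C * H -> G)
  (E : rel (C * H)).

Definition clustering :=
  [/\ injective vert, #|[set c | copy c]| = til H G,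
      forall c, copy c -> embedding [ffun u => vert (c, u)] &
      forall a b, E a b -> (a.1 != b.1) && adj (vert a) (vert b)].

End Clusters.

(* Samples without small covers have dense tilings, which blow up to tilings of
   blocks of G; by maximality, the tiling of G is at least as dense. *)
Lemma til_ge_of_uncovered (R : realType) (H : graph) (rho eps : R) (s : nat) :
  (0 < #|H|)%N -> 0 < eps -> 16 <= eps ^+ 2 * s%:R ->
  exists n0 : nat, forall (G : graph) (C : finType) (copy : pred C)
    (vert : C * H -> G) (E : rel (C * H)) (F : {set {ffun 'I_s -> C}}),
  clustering copy vert E -> (n0 < #|C|)%N ->
  1 / 4 * #|C|%:R ^+ s <= #|F|%:R :> R ->
  (forall g, g \in F -> forall c : 'I_s * H -> R, fcover H (sampled E g) c ->
     rho * #|{: 'I_s * H}|%:R < \sum_i c i) ->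
  #|C|%:R * ((rho - eps) * #|H|%:R - eps) <= (til H G)%:R.
Proof.
move=> H0 eps0 es.
have s0 : (0 < s)%N.
  by rewrite lt0n; apply: contraTneq es => ->; rewrite mulr0 -ltNge ltr0n.
have q0 : (0 < #|{: 'I_s * H}|)%N by rewrite card_prod card_ord muln_gt0 s0.
have [N [T [T0 NT tileP]]] := @tileable_of_no_cover R H rho eps _ eps0 q0.
have gam0 : 0 < 1 / 8 :> R by lra.
have [n1 n1P] := @dense_exchange R H s N T (1 / 8) gam0 H0 T0.
have [n2 n2P] := exists_nat_ge (16 * s%:R ^+ 2 : R).
exists (maxn n1 n2) => G C copy vert E F [vert_inj card_copy copy_emb E_adj].
rewrite gtn_max => /andP[n1C n2C] F4 Fun.
have C0 : (0 < #|C|)%N by apply: leq_ltn_trans n1C.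
have C0' : 0 < #|C|%:R :> R by rewrite ltr0n.
have s0' : 0 < s%:R :> R by rewrite ltr0n.
pose k : R := (til H G)%:R / #|C|%:R.
pose kap := (k + eps) * s%:R.
pose f (g : {ffun 'I_s -> C}) (c : C) : R := (copy c)%:R.
have f_itv g c : 0 <= f g c <= 1 by rewrite /f; case: (copy c); rewrite ?lexx ler01.
have f_dep g j c d : j \notin (set0 : {set 'I_s}) -> f (upd g j c) d = f g d by [].
(* Each kind of bad sample has proportion at most 1/16, which leaves at least 1/8 from the 1/4 in
   [F]. *)
pose bad1 := [set g | eps < `|empirical f g - mean f g|].
pose bad2 := [set g : {ffun 'I_s -> C} | ~~ injectiveb g].
have b1 : 16 * #|bad1|%:R <= #|C|%:R ^+ s :> R.
  have := deviation f_itv f_dep C0 s0 eps0; rewrite cards0 mul1r; apply: le_trans.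
  by rewrite ler_wpM2r.
have b2 : 16 * #|bad2|%:R <= #|C|%:R ^+ s :> R.
  have c16 : 16 * s%:R ^+ 2 <= #|C|%:R :> R.
    by apply: le_trans n2P _; rewrite ler_nat ltnW.
  rewrite -(ler_pM2l C0') mulrCA.
  have := non_injective_count R C s; rewrite -/bad2 => le.
  apply: (@le_trans _ _ (16 * (s%:R ^+ 2 * #|C|%:R ^+ s))).
    by rewrite ler_pM2l.
  by rewrite mulrA ler_wpM2r // exprn_ge0 // ltW.
pose F' := F :\: (bad1 :|: bad2).
have F'8 : 1 / 8 * #|C|%:R ^+ s <= #|F'|%:R :> R.
  have : (#|F| <= #|F'| + (#|bad1| + #|bad2|))%N.
    rewrite -(cardsID (bad1 :|: bad2) F) addnC leq_add2l.
    apply: leq_trans (leq_card_setU _ _).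
    by apply: subset_leq_card; apply: subsetIr.
  by rewrite -(ler_nat R) !natrD; lra.
have le : N%:R <= kap * T%:R.
  apply: (n1P G C copy vert E kap F' vert_inj card_copy copy_emb E_adj n1C F'8) => g.
  rewrite !inE negb_or negbK -leNgt => /andP[/andP[g1 /injectiveP g2] gF].
  split=> //; first by apply: tileP => // c; apply: Fun.
  have eE : empirical f g = #|[set i | copy (g i)]|%:R / s%:R.
    by rewrite /empirical natr_card.
  have mE : mean f g = k by rewrite /mean /k -card_copy natr_card.
  rewrite /kap -ler_pdivrMr // -eE -mE.
  by move: g1; rewrite ler_norml => /andP[_]; lra.
have := le_trans NT le.
have -> : (rho - eps) * #|{: 'I_s * H}|%:R * T%:R =
   ((rho - eps) * #|H|%:R) * (s%:R * T%:R).
  by rewrite card_prod card_ord natrM; ring.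
have -> : kap * T%:R = (k + eps) * (s%:R * T%:R) by rewrite /kap mulrA.
rewrite ler_pM2r ?mulr_gt0 ?ltr0n // => le2.
rewrite mulrC -ler_pdivlMr // -/k; lra.
Qed.

Section Degrees.
Variables (R : realType) (H C : finType) (E : rel (C * H)) (s : nat) (d eps : R).
Hypothesis C_gt0 : (0 < #|C|)%N.
Hypothesis H_gt0 : (0 < #|H|)%N.
Hypothesis s_gt0 : (0 < s)%N.
Hypothesis eps_gt0 : 0 < eps.
Hypothesis nonadj_le : forall v, #|[set u | ~~ E v u]|%:R <= d * #|{: C * H}|%:R.

Definition typical (g : {ffun 'I_s -> C}) : {set 'I_s * H} :=
  [set a | #|[set b | ~~ sampled E g a b]|%:R <= (d + eps) * #|{: 'I_s * H}|%:R].

Lemma typical_nonadjacent g v : v \in typical g ->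
  #|[set u in typical g | ~~ sampled E g v u]|%:R <=
  (d + eps) * #|{: 'I_s * H}|%:R.
Proof.
rewrite inE; apply: le_trans; rewrite ler_nat; apply: subset_leq_card.
by apply/subsetP => u; rewrite !inE => /andP[].
Qed.

(** The set of nonneighbours of the vertex at position [a] depends on the coordinate [a.1] of the
    sample only, so [set_deviation_family] applies with one coordinate per position. *)
Lemma typical_count :
  eps ^+ 3 * s%:R * #|[set g | #|typical g|%:R < (1 - eps) * #|{: 'I_s * H}|%:R]|%:R
  <= 2%:R * #|C|%:R ^+ s :> R.
Proof.
pose S (a : 'I_s * H) (g : {ffun 'I_s -> C}) := [set u | ~~ E (pull g a) u].
have S_dep a g j c : j \notin [set a.1] -> S a (upd g j c) = S a g.
  by rewrite inE eq_sym => ja; rewrite /S /pull upd_neq.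
have K1 (a : 'I_s * H) : (#|[set a.1]| <= 1)%N by rewrite cards1.
apply: le_trans (set_deviation_family C_gt0 H_gt0 s_gt0 K1 S_dep eps_gt0).
rewrite ler_wpM2l ?mulr_ge0 ?exprn_ge0 ?(ltW eps_gt0) // ler_nat.
apply: subset_leq_card; apply/subsetP => g; rewrite !inE => lt.
have CH0 : 0 < #|{: C * H}|%:R :> R by rewrite ltr0n card_prod muln_gt0 C_gt0.
have IH0 : 0 < #|{: 'I_s * H}|%:R :> R by rewrite ltr0n card_prod card_ord muln_gt0 s_gt0.
have : #|~: typical g|%:R <= #|[set a | eps < `|discrepancy R (S a) g|]|%:R :> R.
  rewrite ler_nat; apply: subset_leq_card; apply/subsetP => a; rewrite !inE -ltNge.
  move=> big; rewrite /discrepancy; set u := _ / _; set v := _ / _.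
  have v_le : v <= d by rewrite /v ler_pdivrMr //; apply: nonadj_le.
  have u_ge : d + eps < u.
    rewrite /u ltr_pdivlMr //; apply: lt_le_trans big _; rewrite ler_nat.
    by apply: eq_leq; apply: eq_card => b; rewrite !inE.
  by apply: lt_le_trans (ler_norm _); lra.
apply: lt_le_trans; have : #|typical g|%:R + #|~: typical g|%:R = #|{: 'I_s * H}|%:R :> R.
  by rewrite -natrD cardsC.
lra.
Qed.

End Degrees.

(** * Recovering the bottleneck partition *)

Section Partite.
Variables (V : finType) (E : rel V) (m : nat).
Implicit Types (z : {ffun 'I_m -> V}) (i j : 'I_m).

Definition common z := [set u | [forall j, E u (z j)]].

(** When the [z i] represent the independent classes of a bottleneck graph, its vertices that miss
    [z i] but see every other [z j] form the class of [z i], while [common z] lies in the last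
    class. *)
Definition part z i :=
  [set u | ~~ E u (z i) && [forall j, (j != i) ==> E u (z j)]].

Lemma partP z i u :
  reflect (~~ E u (z i) /\ forall j, j != i -> E u (z j)) (u \in part z i).
Proof.
rewrite inE; apply: (iffP andP) => -[? h]; split=> //.
  by move=> j; apply/implyP; apply: (forallP h).
by apply/forallP => j; apply/implyP; apply: h.
Qed.

Lemma part_disjoint z i j u : u \in part z i -> u \in part z j -> i = j.
Proof.
move=> /partP[_ hi] /partP[nj _]; apply/eqP; apply: contraNT nj => ij.
by apply: hi; rewrite eq_sym.
Qed.

Lemma part_common z i u : u \in part z i -> u \notin common z.
Proof.
move=> /partP[ni _]; rewrite inE; apply: contraNN ni.
by move/forallP.
Qed.

(** Vertices missing two or more of the [z i] also go to the last class; [nparts_ge] limits their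
    number. *)
Definition label z u : 'I_m.+1 :=
  if [pick i | u \in part z i] is Some i then widen_ord (leqnSn m) i else ord_max.

Lemma label_part z i u : (label z u == widen_ord (leqnSn m) i) = (u \in part z i).
Proof.
rewrite /label; case: pickP => [j uj|no]; last first.
  rewrite no; apply/negbTE; apply: contraTneq (ltn_ord i) => /(congr1 val) /= <-.
  by rewrite ltnn.
apply/eqP/idP => [/(congr1 val) /= ji|ui].
  by rewrite -(val_inj ji).
by rewrite (part_disjoint uj ui).
Qed.

Lemma label_lt z u : (label z u < m)%N -> exists2 i, u \in part z i &
  label z u = widen_ord (leqnSn m) i.
Proof.
by rewrite /label; case: pickP => [i ui _|_]; [exists i | rewrite ltnn].
Qed.

Definition heavy (R : realType) (beta : R) z i :=
  [set a in part z i |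
    beta * #|V|%:R < #|[set u in part z i | E a u]|%:R].

(* Pairs inside the last class are never misplaced: a bottleneck graph is
   arbitrary there. *)
Definition misplaced (p : V -> 'I_m.+1) u v :=
  ((p u != p v) && ~~ E u v) || [&& p u == p v, (p u < m)%N & E u v].

Section Count.
Variables (R : realType) (z : {ffun 'I_m -> V}) (y eps eps2 beta : R).
Hypothesis E_sym : symmetric E.
Hypothesis eps_ge0 : 0 <= eps.
Hypothesis y_ge0 : 0 <= y.
Hypothesis eps2_ge0 : 0 <= eps2.
Hypothesis beta_ge0 : 0 <= beta.
Let n : R := #|V|%:R.
Let M : R := m%:R.
Hypothesis nonadj_le : forall v, #|[set u | ~~ E v u]|%:R <= (y + eps) * n.
Hypothesis common_le : #|common z|%:R <= (1 - M * y + eps2) * n.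
Hypothesis heavy_le : forall i, #|heavy beta z i|%:R <= beta * n.

Let nparts : R := #|[set u | (label z u < m)%N]|%:R.

Lemma label_lt_sum u : (label z u < m)%N = (\sum_i (u \in part z i))%N :> nat.
Proof.
case: (boolP (label z u < m)%N) => [/label_lt[i ui _]|].
  rewrite (bigD1 i) //= ui big1 // => j ji.
  by apply/eqP; rewrite eqb0; apply: contraNN ji => /part_disjoint/(_ ui) ->.
move=> no; rewrite big1 // => i _; apply/eqP; rewrite eqb0; apply: contraNN no.
by rewrite -label_part => /eqP -> /=.
Qed.

Lemma npartsE : nparts = \sum_i #|part z i|%:R.
Proof.
rewrite /nparts natr_card; under eq_bigr do rewrite label_lt_sum natr_sum.
rewrite exchange_big; apply: eq_bigr => i _ /=.
by rewrite -natr_card; congr _%:R; apply: eq_card => u; rewrite inE.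
Qed.

Lemma part_le i : #|part z i|%:R <= (y + eps) * n.
Proof.
apply: le_trans (nonadj_le (z i)); rewrite ler_nat; apply: subset_leq_card.
by apply/subsetP => u /partP[nu _]; rewrite inE E_sym.
Qed.

(* Each vertex outside the parts and the common neighbourhood has at least two
   nonneighbours among the z i. *)
Lemma nparts_ge : (M * y - M * eps - 2 * eps2) * n <= nparts.
Proof.
have pt u : (2 <= \sum_i (~~ E (z i) u) + (label z u < m) + 2 * (u \in common z))%N.
  case: (boolP (u \in common z)) => [_|]; first by rewrite muln1 leq_addl.
  rewrite inE negb_forall => /existsP[i ni]; rewrite muln0 addn0.
  rewrite (bigD1 i) //= E_sym ni.
  case: (boolP [exists j, (j != i) && ~~ E u (z j)]) => [/existsP[j /andP[ji nj]]|].
    by rewrite (bigD1 j) //= (E_sym (z j)) nj.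
  rewrite negb_exists => /forallP no; have ui : u \in part z i.
    by apply/partP; split=> // j ji; have := no j; rewrite ji negbK.
  have := ui; rewrite -label_part => /eqP ->.
  by rewrite /= ltn_ord addn1 add1n.
have : \sum_(u : V) 2 <= \sum_u (\sum_i (~~ E (z i) u)%:R + (label z u < m)%:R
    + 2 * (u \in common z)%:R) :> R.
  by apply: ler_sum => u _; rewrite -natr_sum -natrM -!natrD ler_nat.
have -> : \sum_(u : V) 2 = 2 * n by rewrite sumr_const mulr_natr.
rewrite !big_split /= -mulr_sumr exchange_big /=.
rewrite -(natr_card R (fun u => (label z u < m)%N)) -(natr_card R (mem (common z))).
have -> : #|[set t | mem (common z) t]| = #|common z|.
  by apply: eq_card => u; rewrite inE.
have le : \sum_i \sum_u (~~ E (z i) u)%:R <= M * ((y + eps) * n).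
  have -> : M * ((y + eps) * n) = \sum_(i < m) (y + eps) * n.
    by rewrite sumr_const card_ord mulr_natl.
  by apply: ler_sum => i _; rewrite -natr_card.
rewrite -/nparts; move: le common_le; lra.
Qed.

(** The parts together have nearly [M * y * n] vertices and none exceeds [(y + eps) * n], so none is
    much smaller either. *)
Lemma part_ge i : (y - 2 * M * eps + eps - 2 * eps2) * n <= #|part z i|%:R.
Proof.
have := nparts_ge; rewrite npartsE (bigD1 i) //=.
have le : \sum_(j < m | j != i) #|part z j|%:R <= (M - 1) * ((y + eps) * n).
  have -> : (M - 1) * ((y + eps) * n) = \sum_(j < m | j != i) (y + eps) * n.
    rewrite sumr_const -mulr_natl; congr (_ * _).
    by rewrite cardC1 card_ord -subn1 natrB // (leq_trans _ (ltn_ord i)).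
  by apply: ler_sum => j _; apply: part_le.
move: le; set t := \sum_(_ | _) _; set p := #|part z i|%:R; move: t p => t p.
have -> : (y - 2 * M * eps + eps - 2 * eps2) * n =
  (M * y - M * eps - 2 * eps2) * n - (M - 1) * ((y + eps) * n) by ring.
lra.
Qed.

Let c := 2 * M * eps + 2 * eps2.

Lemma label_class_size i :
  `|#|[set u | label z u == widen_ord (leqnSn m) i]|%:R - y * n| <= c * n.
Proof.
have -> : #|[set u | label z u == widen_ord (leqnSn m) i]| = #|part z i|.
  by apply: eq_card => u; rewrite inE label_part.
have := part_ge i; have := part_le i; set p := #|part z i|%:R.
have M1 : 1 <= M by rewrite ler1n (leq_trans _ (ltn_ord i)).
have n0 : 0 <= n by rewrite ler0n.
have en : 0 <= eps * n by rewrite mulr_ge0.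
have := le_trans (part_ge i) (part_le i).
have -> : (y - 2 * M * eps + eps - 2 * eps2) * n =
  y * n - c * n + eps * n by rewrite /c; ring.
rewrite [(y + eps) * n]mulrDl ler_norml => k1 k2 k3; apply/andP; split; first by lra.
have : M * (eps * n) >= eps * n by rewrite ler_peMl.
have : 0 <= eps2 * n by rewrite mulr_ge0.
have -> : c * n = 2 * (M * (eps * n)) + 2 * (eps2 * n) by rewrite /c; ring.
by lra.
Qed.

Lemma card_label_last :
  #|[set u | label z u == ord_max]|%:R = n - nparts.
Proof.
have -> : n = #|[set u | (label z u < m)%N]|%:R + #|[set u | label z u == ord_max]|%:R.
  rewrite /n -(cardsC [set u | (label z u < m)%N]) natrD; congr (_ + _%:R).
  by apply: eq_card => u; rewrite !inE -leqNgt -val_eqE /= eqn_leq leq_ord.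
by rewrite addrAC subrr add0r.
Qed.

Lemma label_last_size :
  `|#|[set u | label z u == ord_max]|%:R - (1 - M * y) * n| <= c * n.
Proof.
have n0 : 0 <= n by rewrite ler0n.
have up : nparts <= M * ((y + eps) * n).
  rewrite npartsE; have -> : M * ((y + eps) * n) = \sum_(i < m) (y + eps) * n.
    by rewrite sumr_const card_ord mulr_natl.
  by apply: ler_sum => i _; apply: part_le.
rewrite card_label_last; have := nparts_ge.
have -> : (M * y - M * eps - 2 * eps2) * n = M * y * n - M * eps * n - 2 * eps2 * n by ring.
have -> : (1 - M * y) * n = n - M * y * n by ring.
have -> : c * n = 2 * (M * eps * n) + 2 * eps2 * n by rewrite /c; ring.
have k1 : 0 <= M * eps * n by rewrite !mulr_ge0 ?ler0n.
have k2 : 0 <= eps2 * n by rewrite mulr_ge0.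
have k3 : M * ((y + eps) * n) = M * y * n + M * eps * n by ring.
rewrite k3 in up.
by move=> k4; rewrite ler_norml; apply/andP; split; lra.
Qed.

(** A vertex that is not heavy misses almost all of its part, which already accounts for almost all
    of its at most [(y + eps) * n] nonneighbours; few remain outside. A heavy vertex gets a trivial
    bound. *)
Lemma misplaced_part i a : a \in part z i ->
  #|[set v | misplaced (label z) a v]|%:R <=
  (c + 2 * beta) * n + 2 * n * (a \in heavy beta z i)%:R.
Proof.
move=> ai; set nb := [set u in part z i | E a u].
have sub : (#|[set v | misplaced (label z) a v]| + #|part z i| <=
    #|[set v | ~~ E a v]| + (#|nb| + #|nb|))%N.
  have : (#|[set v | misplaced (label z) a v]| <=
      #|[set v | ~~ E a v] :\: part z i| + #|nb|)%N.
    apply: leq_trans (leq_card_setU _ _); apply: subset_leq_card.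
    apply/subsetP => v; rewrite !inE => /orP[/andP[av ->]|/and3P[/eqP av _ ->]].
      have := label_part z i a; rewrite ai => /eqP aE.
      move: av; rewrite aE eq_sym label_part inE => av.
      by rewrite av.
    have := label_part z i a; rewrite ai av label_part inE => /[!andbT] ->.
    by rewrite orbT.
  have := cardsID (part z i) [set v | ~~ E a v].
  have := cardsID [set v | E a v] (part z i).
  have -> : part z i :&: [set v | E a v] = nb by apply/setP => v; rewrite !inE.
  have -> : part z i :\: [set v | E a v] = [set v | ~~ E a v] :&: part z i.
    by apply/setP => v; rewrite !inE.
  lia.
have nb_le : #|nb|%:R <= beta * n + n * (a \in heavy beta z i)%:R.
  rewrite inE ai andTb; have [_|le] := ltrP (beta * #|V|%:R).
    rewrite mulr1 ler_wpDl ?mulr_ge0 ?ler0n // ler_nat max_card //.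
  by rewrite mulr0 addr0.
move: sub; rewrite -(ler_nat R) !natrD.
have := nonadj_le a; have := part_ge i; move: nb_le.
have -> : (y - 2 * M * eps + eps - 2 * eps2) * n = (y + eps) * n - c * n
  by rewrite /c; ring.
have -> : (c + 2 * beta) * n = c * n + 2 * (beta * n) by ring.
rewrite -[2 * n * _]mulrA; lra.
Qed.

Lemma misplaced_sym u v : misplaced (label z) u v = misplaced (label z) v u.
Proof.
rewrite /misplaced E_sym eq_sym; case: eqP => [->|] //=.
Qed.

(** A misplaced pair has an endpoint outside the last class, so twice the sum over such endpoints
    bounds the count. *)
Lemma misplaced_count :
  #|[set p : V * V | misplaced (label z) p.1 p.2]|%:R <=
  2 * (c + 2 * beta + 2 * M * beta) * n ^+ 2.
Proof.
have n0 : 0 <= n by rewrite ler0n.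
pose d u : R := #|[set v | misplaced (label z) u v]|%:R.
have half : #|[set p : V * V | misplaced (label z) p.1 p.2]|%:R <=
    2 * \sum_(u | (label z u < m)%N) d u.
  rewrite natr_card -(pair_bigA _ (fun u v => (misplaced (label z) u v)%:R)) /=.
  have pt u v : (misplaced (label z) u v)%:R <=
      (if (label z u < m)%N then (misplaced (label z) u v)%:R else 0) +
      (if (label z v < m)%N then (misplaced (label z) u v)%:R else 0) :> R.
    case: (boolP (misplaced (label z) u v)) => [|_]; last by rewrite !if_same addr0.
    case: ifP => [_ _|/negbT lu]; first by rewrite lerDl; case: ifP.
    case: ifP => [_ _|/negbT lv]; first by rewrite add0r.
    rewrite /misplaced (negPf lu) /= andbF orbF => /andP[/eqP[]].
    move: lu lv; rewrite -!leqNgt => lu lv; apply/val_inj/eqP.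
    by rewrite eqn_leq (leq_trans (leq_ord _) lv) (leq_trans (leq_ord _) lu).
  apply: (@le_trans _ _ (\sum_u \sum_v (
      (if (label z u < m)%N then (misplaced (label z) u v)%:R else 0) +
      (if (label z v < m)%N then (misplaced (label z) u v)%:R else 0)))).
    by apply: ler_sum => u _; apply: ler_sum => v _; apply: pt.
  have one : \sum_u \sum_v
      (if (label z u < m)%N then (misplaced (label z) u v)%:R else 0) =
      \sum_(u | (label z u < m)%N) d u :> R.
    rewrite [RHS]big_mkcond; apply: eq_bigr => u _; rewrite /d natr_card.
    by case: ifP => // _; rewrite big1.
  rewrite (eq_bigr _ (fun u _ => big_split _ _ _ _ _)) /= big_split /= one.
  rewrite [X in _ + X]exchange_big /= [X in _ + X](_ : _ = \sum_u \sum_v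
      (if (label z u < m)%N then (misplaced (label z) u v)%:R else 0)).
    by rewrite one; lra.
  by apply: eq_bigr => u _; apply: eq_bigr => v _; rewrite misplaced_sym.
apply: le_trans half _; rewrite -mulrA ler_pM2l //.
have bound u : (label z u < m)%N ->
  d u <= (c + 2 * beta) * n + 2 * n * \sum_i (u \in heavy beta z i)%:R.
  move=> /label_lt[i ui _]; apply: le_trans (misplaced_part ui) _.
  rewrite lerD2l ler_wpM2l ?mulr_ge0 //.
  by rewrite (bigD1 i) //= lerDl sumr_ge0.
have c0 : 0 <= (c + 2 * beta) * n.
  by rewrite mulr_ge0 // !addr_ge0 // !mulr_ge0 ?ler0n.
apply: (@le_trans _ _ (\sum_u
    ((c + 2 * beta) * n + 2 * n * \sum_i (u \in heavy beta z i)%:R))).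
  rewrite big_mkcond; apply: ler_sum => u _; case: ifP => [/bound //|_].
  by rewrite addr_ge0 // !mulr_ge0 // sumr_ge0.
have -> : \sum_(u : V) ((c + 2 * beta) * n
      + 2 * n * \sum_i (u \in heavy beta z i)%:R) =
    (c + 2 * beta) * n * n + 2 * n * \sum_i \sum_u (u \in heavy beta z i)%:R.
  rewrite big_split /=; congr (_ + _); last by rewrite -mulr_sumr exchange_big.
  by rewrite sumr_const -[LHS]mulr_natr.
have le : \sum_i \sum_u (u \in heavy beta z i)%:R <= M * (beta * n).
  have -> : M * (beta * n) = \sum_(i < m) beta * n.
    by rewrite sumr_const card_ord mulr_natl.
  apply: ler_sum => i _; apply: le_trans (heavy_le i).
  by rewrite -natr_card ler_nat; apply: eq_leq; apply: eq_card => u; rewrite inE.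
have n20 : 0 <= 2 * n by rewrite mulr_ge0.
have le2 := ler_wpM2l n20 le.
have -> : (c + 2 * beta + 2 * M * beta) * n ^+ 2 =
  (c + 2 * beta) * n * n + 2 * n * (M * (beta * n)) by ring.
by rewrite lerD2l.
Qed.

End Count.
End Partite.

Definition clique_free (I : finType) (e : rel I) (m : nat) (T : {set I}) :=
  [forall v : {ffun 'I_m -> I}, clique_in e T v ==>
     [forall w in T, ~~ [forall i, e w (v i)]]].

Lemma clique_freeP (I : finType) (e : rel I) (m : nat) (T : {set I})
    (v : {ffun 'I_m -> I}) w : clique_free e m T -> clique_in e T v ->
  w \in T -> ~ (forall i, e w (v i)).
Proof.
move=> /forallP/(_ v)/implyP free /free/forall_inP no /no /negP nall all.
by apply: nall; apply/forallP.
Qed.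

(** * Transfer of the structure from a sample *)

Section SampleStructure.
Variables (R : realType) (C W : finType) (E : rel (C * W)) (s m : nat).
Variables (iota : {ffun 'I_m -> 'I_s * W}) (y eps eps1 : R).
Hypothesis E_sym : symmetric E.
Hypothesis C_gt0 : (0 < #|C|)%N.
Hypothesis W_gt0 : (0 < #|W|)%N.
Hypothesis s_gt0 : (0 < s)%N.
Hypothesis eps_gt0 : 0 < eps.
Let n : R := #|{: C * W}|%:R.
Let q : R := #|{: 'I_s * W}|%:R.
Let M : R := m%:R.
Let beta := eps1 + (M + 3) * eps.
Hypothesis nonadj_le : forall v, #|[set u | ~~ E v u]|%:R <= (y + eps) * n.

(** The positions [iota] are fixed before the sample is drawn; thus a set defined from the frame
    depends on at most [m] coordinates, and second moments control its sampled density. *)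
Definition frame (g : {ffun 'I_s -> C}) : {ffun 'I_m -> C * W} :=
  [ffun i => pull g (iota i)].

Definition adjacent_part i a (g : {ffun 'I_s -> C}) :=
  [set u in part E (frame g) i | E (pull g a) u].

Lemma card_vertices_gt0 : 0 < n.
Proof. by rewrite ltr0n card_prod muln_gt0 C_gt0. Qed.

Lemma card_indices_gt0 : 0 < q.
Proof. by rewrite ltr0n card_prod card_ord muln_gt0 s_gt0. Qed.

Lemma discrepancy_le (S : {ffun 'I_s -> C} -> {set C * W}) g :
  `|discrepancy R S g| <= eps ->
  #|S g|%:R * q <= (#|[set a | pull g a \in S g]|%:R + eps * q) * n /\
  #|[set a | pull g a \in S g]|%:R * n <= (#|S g|%:R + eps * n) * q.
Proof.
have n0 := card_vertices_gt0; have q0 := card_indices_gt0.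
rewrite /discrepancy -/n -/q; move: (#|_|%:R) (#|S g|%:R) => a b.
rewrite ler_norml => /andP[lo hi]; have nq0 := mulr_gt0 n0 q0.
have k1 : (a / q - b / n) * (n * q) = a * n - b * q by field; rewrite !gt_eqF.
have := ler_wpM2r (ltW nq0) lo; have := ler_wpM2r (ltW nq0) hi.
rewrite k1; have -> : (a + eps * q) * n = a * n + eps * (n * q) by ring.
have -> : (b + eps * n) * q = b * q + eps * (n * q) by ring.
by rewrite mulNr => ? ?; split; lra.
Qed.

Lemma card_common_ge (z : {ffun 'I_m -> C * W}) :
  (1 - M * (y + eps)) * n <= #|common E z|%:R.
Proof.
have le : #|~: common E z|%:R <= \sum_i #|[set u | ~~ E (z i) u]|%:R :> R.
  rewrite -natr_sum ler_nat.
  apply: (@leq_trans #|\bigcup_i [set u | ~~ E (z i) u]|).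
    apply: subset_leq_card; apply/subsetP => u; rewrite !inE negb_forall.
    by case/existsP => j nj; apply/bigcupP; exists j; rewrite // inE E_sym.
  elim/big_rec2: _ => [|i k A _ IH]; first by rewrite cards0.
  by apply: leq_trans (leq_card_setU _ _) _; rewrite leq_add2l.
have le2 : \sum_i #|[set u | ~~ E (z i) u]|%:R <= M * ((y + eps) * n).
  have -> : M * ((y + eps) * n) = \sum_(i < m) (y + eps) * n.
    by rewrite sumr_const card_ord mulr_natl.
  by apply: ler_sum => i _; apply: nonadj_le.
have : #|common E z|%:R + #|~: common E z|%:R = n by rewrite -natrD cardsC.
have -> : (1 - M * (y + eps)) * n = n - M * ((y + eps) * n) by ring.
by lra.
Qed.

Section OneSample.
Variables (g : {ffun 'I_s -> C}) (T : {set 'I_s * W}).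
Let e := sampled E g.
Hypothesis T_large : (M * y - eps1) * q <= #|T|%:R.
Hypothesis T_free : clique_free e m T.
Hypothesis iota_clique : clique_in e T iota.
Hypothesis common_typical : `|discrepancy R (fun h => common E (frame h)) g| <= eps.
Hypothesis heavy_typical : forall i,
  `|discrepancy R (fun h => heavy E beta (frame h) i) g| <= eps.
Hypothesis adjacent_typical : forall i,
  #|[set a | eps < `|discrepancy R (adjacent_part i a) g|]|%:R <= eps * q.

Lemma sample_common_notin a : pull g a \in common E (frame g) -> a \notin T.
Proof.
rewrite inE => /forallP all; apply/negP => aT.
apply: (clique_freeP T_free iota_clique aT) => i.
by have := all i; rewrite ffunE.
Qed.

Lemma card_addC : #|T|%:R + #|~: T|%:R = q.
Proof. by rewrite -natrD cardsC. Qed.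

(** A position of [T] adjacent to the whole frame would complete the clique [iota] inside [T]. So
    the sampled common neighbours lie outside [T], and typicality carries the bound over to all
    vertices. *)
Lemma sample_common_le : #|common E (frame g)|%:R <= (1 - M * y + (eps1 + eps)) * n.
Proof.
have [+ _] := discrepancy_le common_typical; have q0 := card_indices_gt0; have n0 := card_vertices_gt0.
have : #|[set a | pull g a \in common E (frame g)]|%:R <= #|~: T|%:R :> R.
  rewrite ler_nat; apply: subset_leq_card; apply/subsetP => a; rewrite !inE => aC.
  by apply: sample_common_notin; rewrite inE.
move: card_addC T_large (#|[set _ | _]|%:R) => cT TL t le.
rewrite -(ler_pM2r q0 (#|_|%:R)) => /le_trans; apply.
rewrite [leRHS]mulrAC ler_pM2r //.
have -> : (1 - M * y + (eps1 + eps)) * q = q - (M * y - eps1) * q + eps * q by ring.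
by lra.
Qed.

Let eps4 := eps1 + (M + 1) * eps.

(** The complement of [T] has at most about [(1 - M * y) * q] positions, and the degree condition
    makes the sampled common neighbours fill almost all of it. *)
Lemma outside_le (A : {set 'I_s * W}) :
  (forall a, a \in A -> a \notin T /\ pull g a \notin common E (frame g)) ->
  #|A|%:R <= eps4 * q.
Proof.
move=> AP; have [+ _] := discrepancy_le common_typical.
have q0 := card_indices_gt0; have n0 := card_vertices_gt0.
have : #|A|%:R + #|[set a | pull g a \in common E (frame g)]|%:R <= #|~: T|%:R :> R.
  rewrite -natrD ler_nat -cardsUI.
  have -> : A :&: [set a | pull g a \in common E (frame g)] = set0.
    apply/setP => a; rewrite in_setI in_set in_set0; apply/negbTE/negP.
    by move=> /andP[/AP[_ /negP]].
  rewrite cards0 addn0; apply: subset_leq_card; apply/subsetP => a.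
  rewrite in_setU in_set in_setC => /orP[/AP[]|aC] //.
  exact: sample_common_notin.
have := card_common_ge (frame g); have := card_addC; have := T_large.
move: (#|A|%:R) (#|[set _ | _]|%:R) (#|T|%:R) (#|~: T|%:R) (#|common E _|%:R) => a b t t' k.
move=> tl tt' kl abt kq.
have := ler_wpM2r (ltW q0) kl => kl2; have := le_trans kl2 kq.
rewrite mulrAC ler_pM2r // => kb.
have -> : eps4 * q = (M * y + M * eps + eps + eps1 - M * y) * q by rewrite /eps4; ring.
have k1 : (1 - M * (y + eps)) * q = q - (M * y) * q - (M * eps) * q by ring.
have k2 : (M * y - eps1) * q = M * y * q - eps1 * q by ring.
have k3 : (M * y + M * eps + eps + eps1 - M * y) * q =
  (M * eps) * q + eps * q + eps1 * q by ring.
rewrite k3; rewrite k1 in kb; rewrite k2 in tl; lra.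
Qed.

(** A heavy position in [T] with typical adjacencies would have a neighbour of its own part in [T],
    for [outside_le] leaves too little room elsewhere; this yields a forbidden clique. Of the two
    terms [eps] by which [beta] exceeds [eps4], one pays for the atypical positions and one for the
    return from the sample. *)
Lemma sample_heavy_le i : #|heavy E beta (frame g) i|%:R <= beta * n.
Proof.
have q0 := card_indices_gt0; have n0 := card_vertices_gt0.
have [+ _] := discrepancy_le (heavy_typical i).
pose bad := [set a | eps < `|discrepancy R (adjacent_part i a) g|].
pose out := [set a | (pull g a \in part E (frame g) i) && (a \notin T)].
have out_le : #|out|%:R <= eps4 * q.
  apply: outside_le => a; rewrite inE => /andP[ai aT]; split=> //.
  exact: part_common ai.
have sub : [set a | pull g a \in heavy E beta (frame g) i] \subset bad :|: out.
  apply/subsetP => a; rewrite in_set => /setIdP[ai big].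
  rewrite in_setU [a \in bad]in_set [a \in out]in_set.
  have [//|typ /=] := ltrP eps; rewrite ai /=; apply/negP => aT.
  have [le _] := discrepancy_le typ.
  have lt : #|out|%:R < #|[set b | pull g b \in adjacent_part i a g]|%:R :> R.
    apply: le_lt_trans out_le _; rewrite -(ltr_pM2r n0).
    have : beta * n * q < (#|[set b | pull g b \in adjacent_part i a g]|%:R + eps * q) * n.
      by apply: lt_le_trans le; rewrite ltr_pM2r.
    rewrite [(_ + eps * q) * n]mulrDl; have -> : beta * n * q = eps4 * q * n + 2 * (eps * q * n).
      by rewrite /beta /eps4; ring.
    have : 0 < eps * q * n by rewrite !mulr_gt0.
    by lra.
  have /subsetPn[b] : ~~ ([set b | pull g b \in adjacent_part i a g] \subset out).
    by apply: contraTN lt => /subset_leq_card; rewrite -leNgt ler_nat.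
  rewrite in_set => /setIdP[bi ab]; rewrite in_set bi negbK /= => bT.
  (* Replacing the position [iota i] by [b] gives another clique in [T], which [a] completes. *)
  pose v : {ffun 'I_m -> 'I_s * W} := [ffun j => if j == i then b else iota j].
  have /clique_inP[iT ii] := iota_clique.
  have badj j : j != i -> e b (iota j).
    by move=> ji; have /partP[_ /(_ j ji)] := bi; rewrite ffunE.
  have aadj j : j != i -> e a (iota j).
    by move=> ji; have /partP[_ /(_ j ji)] := ai; rewrite ffunE.
  apply: (@clique_freeP _ e m T v a T_free _ aT).
    apply/clique_inP; split=> [j|j k]; rewrite !ffunE; first by case: ifP.
    case: (eqVneq j i) => [->|ji]; case: (eqVneq k i) => [_|ki] //.
    - by move=> _; apply: badj.
    - by move=> _; rewrite /e /sampled E_sym; apply: badj.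
    by apply: ii.
  by move=> j; rewrite ffunE; case: (eqVneq j i) => [_|ji]; [apply: ab | apply: aadj].
have : #|[set a | pull g a \in heavy E beta (frame g) i]|%:R <= eps * q + eps4 * q.
  apply: le_trans (lerD (adjacent_typical i) out_le).
  rewrite -natrD ler_nat; apply: leq_trans (leq_card_setU _ _).
  exact: subset_leq_card.
move: (#|[set _ | _]|%:R) => t le h; rewrite -(ler_pM2r q0); apply: le_trans h _.
rewrite [leRHS]mulrAC ler_pM2r //.
have -> : beta * q = eps * q + eps4 * q + eps * q by rewrite /beta /eps4; ring.
by rewrite lerD2r.
Qed.

End OneSample.
End SampleStructure.

Section GoodSample.
Variables (R : realType) (C W : finType) (E : rel (C * W)) (s m : nat).
Variables (iota : {ffun 'I_m -> 'I_s * W}) (eps beta : R).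
Hypothesis C_gt0 : (0 < #|C|)%N.
Hypothesis W_gt0 : (0 < #|W|)%N.
Hypothesis s_gt0 : (0 < s)%N.
Hypothesis eps_gt0 : 0 < eps.
Hypothesis eps_le1 : eps <= 1.

Let K := [set (iota j).1 | j : 'I_m].

Lemma card_coordinates : (#|K| <= m)%N.
Proof. by rewrite -[X in (_ <= X)%N](card_ord m) leq_imset_card. Qed.

Lemma frame_upd (g : {ffun 'I_s -> C}) j c : j \notin K -> frame iota (upd g j c) = frame iota g.
Proof.
move=> jK; apply/ffunP => i; rewrite !ffunE /pull upd_neq //.
by apply: contraNneq jK => <-; apply: imset_f.
Qed.

Definition atypical (g : {ffun 'I_s -> C}) :=
  [|| eps < `|discrepancy R (fun h : {ffun 'I_s -> C} => common E (frame iota h)) g|,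
     [exists i, eps < `|discrepancy R (fun h : {ffun 'I_s -> C} => heavy E beta (frame iota h) i) g|] |
     [exists i, eps * #|{: 'I_s * W}|%:R <
       #|[set a | eps < `|discrepancy R (adjacent_part E iota i a) g|]|%:R]].

(** There are [2 * m + 1] events, whose test sets depend on at most [m + 1] coordinates each; this
    explains the two factors. *)
Lemma atypical_count : eps ^+ 3 * s%:R * #|[set g | atypical g]|%:R <=
  ((2 * m + 1) * (m + 2))%:R * #|C|%:R ^+ s :> R.
Proof.
have es0 : 0 <= eps ^+ 3 * s%:R by rewrite mulr_ge0 ?exprn_ge0 // ltW.
have weak k (A : {set {ffun 'I_s -> C}}) :
    eps ^+ 2 * s%:R * #|A|%:R <= k%:R * #|C|%:R ^+ s :> R ->
    eps ^+ 3 * s%:R * #|A|%:R <= k%:R * #|C|%:R ^+ s :> R.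
  apply: le_trans; rewrite ler_wpM2r // ler_wpM2r // exprS ler_piMl //.
  by rewrite exprn_ge0 // ltW.
have C0 : 0 <= #|C|%:R ^+ s :> R by rewrite exprn_ge0.
pose A1 := [set g | eps < `|discrepancy R (fun h : {ffun 'I_s -> C} => common E (frame iota h)) g|].
pose A2 i := [set g | eps < `|discrepancy R (fun h : {ffun 'I_s -> C} => heavy E beta (frame iota h) i) g|].
pose A3 i := [set g | eps * #|{: 'I_s * W}|%:R <
  #|[set a | eps < `|discrepancy R (adjacent_part E iota i a) g|]|%:R].
have b1 : eps ^+ 3 * s%:R * #|A1|%:R <= (m + 2)%:R * #|C|%:R ^+ s :> R.
  apply: le_trans (weak _ _ (set_deviation C_gt0 W_gt0 s_gt0 card_coordinates _ eps_gt0)) _.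
    by move=> g j c jK; rewrite frame_upd.
  by rewrite ler_wpM2r // ler_nat leq_add2l.
have b2 i : eps ^+ 3 * s%:R * #|A2 i|%:R <= (m + 2)%:R * #|C|%:R ^+ s :> R.
  apply: le_trans (weak _ _ (set_deviation C_gt0 W_gt0 s_gt0 card_coordinates _ eps_gt0)) _.
    by move=> g j c jK; rewrite frame_upd.
  by rewrite ler_wpM2r // ler_nat leq_add2l.
have b3 i : eps ^+ 3 * s%:R * #|A3 i|%:R <= (m + 2)%:R * #|C|%:R ^+ s :> R.
  have K1 (a : 'I_s * W) : (#|a.1 |: K| <= m.+1)%N.
    by rewrite (leq_trans (leq_card_setU _ _)) // cards1 add1n ltnS card_coordinates.
  have dep (a : 'I_s * W) g j c : j \notin a.1 |: K ->
      adjacent_part E iota i a (upd g j c) = adjacent_part E iota i a g.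
    rewrite !inE negb_or => /andP[ja jK]; rewrite /adjacent_part frame_upd //.
    by rewrite /pull upd_neq // eq_sym.
  have := set_deviation_family C_gt0 W_gt0 s_gt0 K1 dep eps_gt0.
  by rewrite addSn -addnS.
have sub : #|[set g | atypical g]|%:R <=
    #|A1|%:R + \sum_i #|A2 i|%:R + \sum_i #|A3 i|%:R :> R.
  rewrite -!natr_sum -!natrD ler_nat.
  have card_bigcup (A : 'I_m -> {set {ffun 'I_s -> C}}) :
      (#|\bigcup_i A i| <= \sum_i #|A i|)%N.
    elim/big_rec2: _ => [|i k B _ IH]; first by rewrite cards0.
    by apply: leq_trans (leq_card_setU _ _) _; rewrite leq_add2l.
  apply: leq_trans (leq_add (leq_add (leqnn _) (card_bigcup A2)) (card_bigcup A3)).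
  apply: leq_trans (leq_add (leq_card_setU _ _) (leqnn _)).
  apply: leq_trans (leq_card_setU _ _); apply: subset_leq_card.
  apply/subsetP => g; rewrite in_set => /or3P[b|/existsP[i b]|/existsP[i b]].
  - by rewrite !in_setU [g \in A1]in_set b.
  - rewrite !in_setU; apply/orP; left; apply/orP; right.
    by apply/bigcupP; exists i => //; rewrite in_set.
  by rewrite !in_setU; apply/orP; right; apply/bigcupP; exists i => //; rewrite in_set.
apply: le_trans (ler_wpM2l es0 sub) _; rewrite !mulrDr !mulr_sumr.
have sum_le (A : 'I_m -> {set {ffun 'I_s -> C}}) :
    (forall i, eps ^+ 3 * s%:R * #|A i|%:R <= (m + 2)%:R * #|C|%:R ^+ s :> R) ->
    \sum_i eps ^+ 3 * s%:R * #|A i|%:R <= m%:R * ((m + 2)%:R * #|C|%:R ^+ s) :> R.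
  move=> le; have -> : m%:R * ((m + 2)%:R * #|C|%:R ^+ s) =
      \sum_(i < m) ((m + 2)%:R * #|C|%:R ^+ s) :> R.
    by rewrite sumr_const card_ord mulr_natl.
  exact: ler_sum.
have -> : ((2 * m + 1) * (m + 2))%:R * #|C|%:R ^+ s =
    (m + 2)%:R * #|C|%:R ^+ s + m%:R * ((m + 2)%:R * #|C|%:R ^+ s)
    + m%:R * ((m + 2)%:R * #|C|%:R ^+ s) :> R.
  by rewrite natrM natrD natrM; ring.
by rewrite !lerD // sum_le.
Qed.

End GoodSample.

Section StructuredFrame.
Variables (R : realType) (C W : finType) (E : rel (C * W)) (s m : nat).
Variables (y eps eps1 : R).
Hypothesis E_sym : symmetric E.
Hypothesis C_gt0 : (0 < #|C|)%N.
Hypothesis W_gt0 : (0 < #|W|)%N.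
Hypothesis s_gt0 : (0 < s)%N.
Hypothesis eps_gt0 : 0 < eps.
Hypothesis eps_le1 : eps <= 1.
Hypothesis y_gt0 : 0 < y.
Let n : R := #|{: C * W}|%:R.
Let q : R := #|{: 'I_s * W}|%:R.
Let M : R := m%:R.
Let beta := eps1 + (M + 3) * eps.
Hypothesis y_large : eps1 + 2 * M * eps <= y / 2.
Hypothesis s_large :
  ((2 * m + 1) * (m + 2))%:R <= eps ^+ 3 * s%:R * (1 / 4 * (y / 2) ^+ m).
Hypothesis nonadj_le : forall v, #|[set u | ~~ E v u]|%:R <= (y + eps) * n.

Definition candidate g (T : {set 'I_s * W}) :=
  [&& T \subset typical E (y + eps) eps g, (M * y - eps1) * q <= #|T|%:R &
      clique_free (sampled E g) m T].

Lemma candidate_cliques g T : candidate g T ->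
  (y / 2 * q) ^+ m <=
  #|[set v : {ffun 'I_m -> 'I_s * W} | clique_in (sampled E g) T v]|%:R.
Proof.
case/and3P => sT lT _; have q0 : 0 <= q by rewrite ler0n.
apply: (@card_cliques_ge _ _ _ T ((y + eps + eps) * q)) => //.
- by move=> a b; rewrite /sampled E_sym.
- by rewrite mulr_ge0 // !addr_ge0 // ltW.
- by rewrite mulr_ge0 // divr_ge0 // ltW.
- move=> v /(subsetP sT); rewrite inE; apply: le_trans; rewrite ler_nat.
  by apply: subset_leq_card; apply/subsetP => u; rewrite !inE => /andP[].
have : (eps1 + 2 * M * eps) * q <= (y / 2) * q by rewrite ler_wpM2r.
have : 0 <= eps * q by rewrite mulr_ge0 // ltW.
have -> : (eps1 + 2 * M * eps) * q = eps1 * q + 2 * (M * eps * q) by ring.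
have -> : m%:R * ((y + eps + eps) * q) = M * y * q + 2 * (M * eps * q) by rewrite /M; ring.
have -> : (y + eps + eps) * q = 2 * (y / 2 * q) + 2 * (eps * q) by field.
move: lT; have -> : (M * y - eps1) * q = M * y * q - eps1 * q by ring.
lra.
Qed.

(** The set [T] varies with the sample, whereas typicality requires fixed positions. Each candidate
    contains a proportion [(y / 2) ^+ m] of all position tuples as cliques, so some fixed [iota]
    works for more samples than the atypical ones can exhaust. *)
Lemma structured_frame (F : {set {ffun 'I_s -> C}}) :
  1 / 2 * #|C|%:R ^+ s <= #|F|%:R :> R ->
  (forall g, g \in F -> [exists T, candidate g T]) ->
  exists z : {ffun 'I_m -> C * W},
    #|common E z|%:R <= (1 - M * y + (eps1 + eps)) * n /\
    forall i, #|heavy E beta z i|%:R <= beta * n.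
Proof.
move=> F2 FT; have n0 : 0 < #|C|%:R ^+ s :> R by rewrite exprn_gt0 // ltr0n.
have q0 : 0 < q by rewrite ltr0n card_prod card_ord muln_gt0 s_gt0.
pose P (iota : {ffun 'I_m -> 'I_s * W}) g :=
  [exists T, candidate g T && clique_in (sampled E g) T iota].
pose a := 1 / 4 * (y / 2) ^+ m * #|C|%:R ^+ s.
have y2 : 0 < (y / 2) ^+ m by rewrite exprn_gt0 // divr_gt0.
have [iota iotaP] : exists iota, a < #|[set g in F | P iota g]|%:R.
  apply: exists_average; rewrite double_count.
  apply: (@lt_le_trans _ _ (\sum_(g in F) (y / 2 * q) ^+ m)).
    rewrite sumr_const -[ltRHS]mulr_natl card_ffun natrX card_ord -/q exprMn mulrA.
    rewrite ltr_pM2r ?exprn_gt0 //.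
    have := ler_wpM2r (ltW y2) F2; have := mulr_gt0 n0 y2; rewrite /a.
    by move: (#|C|%:R ^+ s) ((y / 2) ^+ m) => u v; lra.
  apply: ler_sum => g /FT/existsP[T cT].
  apply: le_trans (candidate_cliques cT) _; rewrite ler_nat.
  apply: subset_leq_card; apply/subsetP => v; rewrite !inE => cv.
  by apply/existsP; exists T; rewrite cT.
have [g gA gT] : exists2 g, g \in [set g in F | P iota g] & ~~ atypical E iota eps beta g.
  apply/exists_inP; apply: contraLR iotaP; rewrite negb_exists_in => /forall_inP bad.
  rewrite -leNgt.
  apply: (@le_trans _ _ #|[set g | atypical E iota eps beta g]|%:R).
    rewrite ler_nat; apply: subset_leq_card; apply/subsetP => g /bad.
    by rewrite negbK inE.
  have es0 : 0 < eps ^+ 3 * s%:R by rewrite mulr_gt0 ?exprn_gt0 // ltr0n.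
  rewrite -(ler_pM2l es0); apply: le_trans (atypical_count _ _ _ _ _ _ _ _) _ => //.
  by rewrite /a mulrA ler_wpM2r // ltW.
move: gA; rewrite inE => /andP[_ /existsP[T /andP[/and3P[_ Tl Tf] Tc]]].
move: gT; rewrite /atypical !negb_or -leNgt !negb_exists.
move=> /and3P[t1 /forallP t2 /forallP t3].
exists (frame iota g); split; first exact: sample_common_le Tl Tf Tc t1.
apply: sample_heavy_le Tl Tf Tc t1 _ _ => // i.
  by have := t2 i; rewrite -leNgt.
by have := t3 i; rewrite -leNgt.
Qed.

End StructuredFrame.

(** * Tilings and near-bottlenecks of clusterings *)

Section Samples.
Variables (R : realType) (H : graph) (m : nat) (x : R).
Hypothesis chi_ge2 : (2 <= chi H)%N.
Hypothesis chiE : chi H = m.+1.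
Hypothesis x_itv : 0 <= x <= 1.
Let h : R := #|H|%:R.
Let M : R := m%:R.
Let z : R := x * (min_color_class H)%:R / h.
Let y : R := (1 - z) / M.

Lemma card_typical_samples (C : finType) (E : rel (C * H)) (s : nat) (eps : R) :
  (0 < #|C|)%N -> (0 < s)%N -> 0 < eps -> 8 <= eps ^+ 3 * s%:R ->
  (forall v, #|[set u | ~~ E v u]|%:R <= (y + eps) * #|{: C * H}|%:R) ->
  3 / 4 * #|C|%:R ^+ s <=
  #|[set g : {ffun 'I_s -> C} |
     (1 - eps) * #|{: 'I_s * H}|%:R <= #|typical E (y + eps) eps g|%:R]|%:R :> R.
Proof.
move=> C0 s0 eps0 es nonadj.
have := typical_count C0 (card_gt0_of_chi chi_ge2) s0 eps0 nonadj.
set B := [set g | _ < _] => le.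
have cB : #|C|%:R ^+ s = #|~: B|%:R + #|B|%:R :> R.
  by rewrite -card_samples -natrD addnC cardsC.
have -> : [set g : {ffun 'I_s -> C} |
     (1 - eps) * #|{: 'I_s * H}|%:R <= #|typical E (y + eps) eps g|%:R] = ~: B.
  by apply/setP => g; rewrite !inE leNgt.
have : 8 * #|B|%:R <= eps ^+ 3 * s%:R * #|B|%:R by rewrite ler_wpM2r.
by lra.
Qed.

Lemma tiling_ge (e : R) : 0 < e -> exists (eps : R) (n0 : nat), 0 < eps /\
  forall (G : graph) (C : finType) (copy : pred C) (vert : C * H -> G)
    (E : rel (C * H)), clustering copy vert E -> symmetric E -> (n0 < #|C|)%N ->
  (forall v, #|[set u | ~~ E v u]|%:R <= (y + eps) * #|{: C * H}|%:R) ->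
  #|C|%:R * (x - e) <= (til H G)%:R.
Proof.
move=> e0; have h1 : 1 <= h by apply: card_ge1.
have M1 : 1 <= M by apply: pred_chi_ge1 chi_ge2 chiE.
have y0 : 0 < y by apply: first_density_gt0.
(* The loss is [2 * h * d + d], at most [3 * h * d = e]: one [d] from the cover bound, the rest from
   passing to tilings. *)
pose d : R := e / (3 * h).
have d0 : 0 < d by rewrite divr_gt0 //; lra.
have dE : 3 * h * d = e by rewrite /d mulrC divfK // gt_eqF //; lra.
pose eps : R := Num.min y d / (4 * (M + 1)).
have m0 : 0 < Num.min y d by rewrite lt_min y0.
have eps0 : 0 < eps by rewrite divr_gt0 //; lra.
have epsE : 4 * ((M + 1) * eps) = Num.min y d.
  by rewrite /eps mulrA mulrC divfK // gt_eqF //; lra.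
have epsy : 4 * ((M + 1) * eps) <= y by rewrite epsE ge_min lexx.
have epsd : 4 * ((M + 1) * eps) <= d by rewrite epsE ge_min lexx orbT.
have Me : 0 <= M * eps by rewrite mulr_ge0 ?ltW //; lra.
have [s1 s1P] := exists_nat_ge (8 / eps ^+ 3).
have [s2 s2P] := exists_nat_ge (16 / d ^+ 2).
pose s := maxn s1 s2.
have es : 8 <= eps ^+ 3 * s%:R.
  rewrite mulrC -ler_pdivrMr ?exprn_gt0 //; apply: le_trans s1P _.
  by rewrite ler_nat leq_maxl.
have ds : 16 <= d ^+ 2 * s%:R.
  rewrite mulrC -ler_pdivrMr ?exprn_gt0 //; apply: le_trans s2P _.
  by rewrite ler_nat leq_maxr.
have s0 : (0 < s)%N.
  by rewrite lt0n; apply: contraTneq es => ->; rewrite mulr0 -ltNge ltr0n.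
have H0 := card_gt0_of_chi chi_ge2.
have [n0 n0P] := @til_ge_of_uncovered R H (x / h - d) d s H0 d0 ds.
exists eps, n0; split=> // G C copy vert E clus Esym nC nonadj.
have C0 : (0 < #|C|)%N by apply: leq_ltn_trans nC.
have big := card_typical_samples C0 s0 eps0 es nonadj.
set F := [set g : {ffun 'I_s -> C} | _ <= _] in big.
have F4 : 1 / 4 * #|C|%:R ^+ s <= #|F|%:R :> R.
  by apply: le_trans big; rewrite ler_wpM2r ?exprn_ge0 //; lra.
have I0 : (0 < #|{: 'I_s * H}|)%N by rewrite card_prod card_ord muln_gt0 s0.
have := n0P G C copy vert E F clus nC F4.
have xh : x / h * h = x by rewrite divfK // gt_eqF //; lra.
have -> : (x / h - d - d) * h - d = x - 2 * h * d - d.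
  by rewrite !mulrBl xh; ring.
move=> til_le; apply: (@le_trans _ _ (#|C|%:R * (x - 2 * h * d - d))).
  rewrite ler_wpM2l //; have : d <= h * d by rewrite ler_peMl // ltW.
  by move: dE; lra.
apply: til_le => g; rewrite inE => gF c cov.
have I0' : 0 < #|{: 'I_s * H}|%:R :> R by rewrite ltr0n.
have sym : symmetric (sampled E g) by move=> a b; rewrite /sampled Esym.
have nonX v : v \in typical E (y + eps) eps g ->
    #|[set u in typical E (y + eps) eps g | ~~ sampled E g v u]|%:R <=
    (y + 2 * eps) * #|{: 'I_s * H}|%:R.
  have -> : y + 2 * eps = y + eps + eps by ring.
  exact: typical_nonadjacent.
have lt : M * (2 * eps) < y by lra.
have e2 : 0 < 2 * eps by rewrite mulr_gt0.
have X2 : (1 - 2 * eps) * #|{: 'I_s * H}|%:R <= #|typical E (y + eps) eps g|%:R.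
  by apply: le_trans gF; rewrite ler_wpM2r //; lra.
apply: lt_le_trans (cover_sum_ge chi_ge2 chiE x_itv sym e2 lt I0 X2 nonX cov).
by rewrite ltr_pM2r // ltrD2l ltrN2; lra.
Qed.

Definition near_bottleneck (V : finType) (E : rel V) (eta : R) :=
  exists p : V -> 'I_m.+1,
  [/\ forall i : 'I_m.+1, (i < m)%N ->
        `|#|[set u | p u == i]|%:R - y * #|V|%:R| <= eta * #|V|%:R,
      `|#|[set u | p u == ord_max]|%:R - z * #|V|%:R| <= eta * #|V|%:R &
      #|[set e : V * V | misplaced E p e.1 e.2]|%:R <= eta * #|V|%:R ^+ 2].

(** By [clique_free_part], a sample of typical degrees without a candidate has only large covers.
    Either such samples have proportion 1/4 and the tiling gains, or candidates exist in half of all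
    samples and produce a frame. *)
Lemma tiling_or_bottleneck (eta : R) : x < 1 -> 0 < eta ->
  exists (eps del : R) (n0 : nat), [/\ 0 < eps, 0 < del &
  forall (G : graph) (C : finType) (copy : pred C) (vert : C * H -> G)
    (E : rel (C * H)), clustering copy vert E -> symmetric E -> (n0 < #|C|)%N ->
  (forall v, #|[set u | ~~ E v u]|%:R <= (y + eps) * #|{: C * H}|%:R) ->
  #|C|%:R * (x + del) <= (til H G)%:R \/ near_bottleneck E eta].
Proof.
move=> x1 eta0; have h1 : 1 <= h by apply: card_ge1.
have M1 : 1 <= M by apply: pred_chi_ge1 chi_ge2 chiE.
have y0 : 0 < y by apply: first_density_gt0.
have y1 : y <= 1 by apply: first_density_le1.
have H0 := card_gt0_of_chi chi_ge2.
have Mh1 : 0 < 100 * (M * h) by rewrite !mulr_gt0 //; lra.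
(* This will be the bound [kap] on the greedy weight. All later errors are small multiples of
   [M * h * tau], which the generous factor 100 keeps below [y] and [eta]. *)
pose tau : R := Num.min y eta / (100 * (M * h)).
have tau0 : 0 < tau by rewrite divr_gt0 // lt_min y0.
have tauE : 100 * (M * (h * tau)) = Num.min y eta.
  have -> : 100 * (M * (h * tau)) = tau * (100 * (M * h)) by ring.
  by rewrite /tau divfK // gt_eqF.
have tauy : 100 * (M * (h * tau)) <= y by rewrite tauE ge_min lexx.
have taueta : 100 * (M * (h * tau)) <= eta by rewrite tauE ge_min lexx orbT.
have ht : tau <= h * tau by rewrite ler_peMl // ltW.
have Mht : h * tau <= M * (h * tau) by rewrite ler_peMl // mulr_ge0 // ltW //; lra.
(* With these choices [del] and the error [(M + 1) * (2 * eps)] each take half of the surplus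
   [(1 - x) / M * tau]. The factor 2 in [2 * eps] arises because sampling adds an [eps] to the
   nonneighbour density. *)
pose eps : R := (1 - x) * tau / (4 * (M * (M + 1))).
pose del : R := (1 - x) * tau / (2 * M).
have MM : 0 < 4 * (M * (M + 1)) by rewrite !mulr_gt0 //; lra.
have xtau : 0 < (1 - x) * tau by rewrite mulr_gt0 // subr_gt0.
have eps0 : 0 < eps by apply: divr_gt0.
have del0 : 0 < del by apply: divr_gt0 => //; lra.
have small : del + (M + 1) * (2 * eps) <= (1 - x) / M * tau.
  rewrite le_eqVlt; apply/orP; left; apply/eqP; rewrite /del /eps; field.
  by rewrite !gt_eqF //; lra.
have smalltau : (1 - x) / M * tau <= tau.
  rewrite ler_piMl // ?(ltW tau0) // ler_pdivrMr; last by lra.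
  by move: x_itv => /andP[? ?]; lra.
have Me : 0 < M * eps by rewrite mulr_gt0 //; lra.
have Meps : 2 * (M * eps) + 2 * eps + del <= tau.
  by apply: le_trans smalltau; apply: le_trans small; lra.
pose eps1 : R := 2 * eps + 2 * h * (del + tau + (M + 1) * (2 * eps)).
have eps1E : eps1 = 2 * eps + 2 * (h * tau + h * (del + (M + 1) * (2 * eps))).
  by rewrite /eps1; ring.
have hde : h * (del + (M + 1) * (2 * eps)) <= h * tau.
  by rewrite ler_pM2l //; lra.
have hde0 : 0 <= h * (del + (M + 1) * (2 * eps)) by rewrite mulr_ge0 //; lra.
have eps1_ge0 : 0 <= eps1 by rewrite eps1E; lra.
have eps1_le : eps1 <= 5 * (h * tau) by rewrite eps1E; lra.
have eps_le1 : eps <= 1 by lra.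
have b0 : 0 <= eps1 + (M + 3) * eps by rewrite addr_ge0 // mulr_ge0 ?(ltW eps0) // addr_ge0 // (le_trans ler01 M1).
have e2 : 0 <= eps1 + eps by lra.
have e0 : 0 <= eps by lra.
have cle : 2 * m%:R * eps + 2 * (eps1 + eps) <= eta.
  have -> : 2 * m%:R * eps = 2 * (M * eps) by rewrite mulrA.
  lra.
have bM : M * (eps1 + (M + 3) * eps) <= 7 * (M * (h * tau)).
  by rewrite [leRHS]mulrCA ler_wpM2l //; lra.
have fin : 2 * (2 * m%:R * eps + 2 * (eps1 + eps) + 2 * (eps1 + (M + 3) * eps)
    + 2 * m%:R * (eps1 + (M + 3) * eps)) <= eta.
  rewrite -[2 * m%:R * eps]mulrA -[2 * m%:R * _]mulrA -/M mulrDl.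
  by move: bM; rewrite mulrDl; lra.
have lt : M * (2 * eps) < y by lra.
have e20 : 0 < 2 * eps by rewrite mulr_gt0.
have yeps : y + eps + eps = y + 2 * eps by ring.
have eps_le2 : 1 - 2 * eps <= 1 - eps by lra.
have hk : h * tau <= 1 / 2 by lra.
have xh : x / h * h = x by rewrite divfK // gt_eqF //; lra.
have hd : del / 2 <= 3 / 4 * (h * del) - del / 4.
  have : del <= h * del by rewrite ler_peMl // ltW.
  by lra.
have y_large : eps1 + 2 * M * eps <= y / 2.
  by rewrite -mulrA; lra.
pose c1 : R := 1 / 4 * (y / 2) ^+ m.
have c10 : 0 < c1.
  by apply: mulr_gt0; [rewrite divr_gt0 | rewrite exprn_gt0 // divr_gt0].
have [s1 s1P] := exists_nat_ge (8 / eps ^+ 3).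
have [s2 s2P] := exists_nat_ge (16 / (del / 4) ^+ 2).
have [s3 s3P] := exists_nat_ge (((2 * m + 1) * (m + 2))%:R / (eps ^+ 3 * c1)).
pose s := maxn s1 (maxn s2 s3).
have e30 : 0 < eps ^+ 3 by rewrite exprn_gt0.
have es : 8 <= eps ^+ 3 * s%:R.
  rewrite mulrC -ler_pdivrMr //; apply: le_trans s1P _.
  by rewrite ler_nat leq_maxl.
have d40 : 0 < del / 4 by rewrite divr_gt0.
have ds : 16 <= (del / 4) ^+ 2 * s%:R.
  rewrite mulrC -ler_pdivrMr ?exprn_gt0 //; apply: le_trans s2P _.
  by rewrite ler_nat !leq_max leqnn orbT.
have cs : ((2 * m + 1) * (m + 2))%:R <= eps ^+ 3 * s%:R * c1.
  have -> : eps ^+ 3 * s%:R * c1 = s%:R * (eps ^+ 3 * c1) by ring.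
  rewrite -(ler_pdivrMr _ _ (mulr_gt0 e30 c10)); apply: le_trans s3P _.
  by rewrite ler_nat !leq_max leqnn !orbT.
have s0 : (0 < s)%N.
  by rewrite lt0n; apply: contraTneq es => ->; rewrite mulr0 -ltNge ltr0n.
have [n0 n0P] := @til_ge_of_uncovered R H (x / h + del) (del / 4) s H0 d40 ds.
exists eps, (del / 2), n0; split=> //; first by rewrite divr_gt0.
move=> G C copy vert E clus Esym nC nonadj.
have C0 : (0 < #|C|)%N by apply: leq_ltn_trans nC.
have big := card_typical_samples C0 s0 eps0 es nonadj.
set F := [set g : {ffun 'I_s -> C} | _ <= _] in big.
pose S := [set g in F | [exists T, candidate E m y eps eps1 g T]].
have Cs0 : 0 <= #|C|%:R ^+ s :> R by rewrite exprn_ge0.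
have FS : #|F|%:R = #|S|%:R + #|F :\: S|%:R :> R.
  rewrite -natrD -(cardsID S F); congr (_ + _)%:R; apply: eq_card => g.
  by rewrite !inE; case: (_ <= _).
have [F4|F4] := lerP (1 / 4 * #|C|%:R ^+ s) (#|F :\: S|%:R : R).
  left; have := n0P G C copy vert E (F :\: S) clus nC F4.
  have -> : (x / h + del - del / 4) * h - del / 4 = x + (3 / 4 * (h * del) - del / 4).
    by rewrite mulrBl mulrDl xh; field.
  move=> til_le; apply: (@le_trans _ _ (#|C|%:R * (x + (3 / 4 * (h * del) - del / 4)))).
    by rewrite ler_wpM2l // lerD2l.
  apply: til_le => g; rewrite in_setD => /andP[gS gF] c cov.
  rewrite ltNge; apply: contra gS => sum_le; rewrite in_set gF /=.
  have gX : (1 - eps) * #|{: 'I_s * H}|%:R <= #|typical E (y + eps) eps g|%:R.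
    by move: gF; rewrite inE.
  have I0 : (0 < #|{: 'I_s * H}|)%N by rewrite card_prod card_ord muln_gt0 s0.
  have I0' : 0 < #|{: 'I_s * H}|%:R :> R by rewrite ltr0n.
  have sym : symmetric (sampled E g) by move=> a b; rewrite /sampled Esym.
  have nonX v : v \in typical E (y + eps) eps g ->
      #|[set u in typical E (y + eps) eps g | ~~ sampled E g v u]|%:R <=
      (y + 2 * eps) * #|{: 'I_s * H}|%:R.
    by rewrite -yeps; apply: typical_nonadjacent.
  have X2 : (1 - 2 * eps) * #|{: 'I_s * H}|%:R <= #|typical E (y + eps) eps g|%:R.
    by apply: le_trans gX; rewrite ler_wpM2r.
  have [T [TX Tl Tf]] := clique_free_part chi_ge2 chiE x_itv sym e20 lt I0 X2 nonX
    x1 hk small cov sum_le.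
  apply/existsP; exists T; apply/and3P; split=> //.
    apply: le_trans Tl; rewrite (first_density_mul chi_ge2 chiE) -/h -/z -/M.
    by rewrite le_eqVlt; apply/orP; left; apply/eqP; rewrite /eps1; ring.
  apply/forallP => v; apply/implyP => /clique_inP[vT vv].
  by apply/forall_inP => u uT; apply/negP => /forallP; apply: Tf.
right.
have S2 : 1 / 2 * #|C|%:R ^+ s <= #|S|%:R :> R.
  by clear -big FS F4; lra.
have ST g : g \in S -> [exists T, candidate E m y eps eps1 g T].
  by rewrite inE => /andP[].
have [w [wc wh]] := structured_frame Esym C0 H0 s0 eps0 eps_le1 y0
  y_large cs nonadj S2 ST.
have n0' : 0 <= #|{: C * H}|%:R :> R by rewrite ler0n.
have clen := ler_wpM2r n0' cle.
exists (label E w); split.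
- move=> i im; apply: le_trans clen.
  have -> : i = widen_ord (leqnSn m) (Ordinal im) by apply: val_inj.
  exact: (label_class_size Esym e0 e2 nonadj wc).
- apply: le_trans clen.
  have zE : z = 1 - m%:R * y by rewrite (first_density_mul chi_ge2 chiE) opprB addrC subrK.
  by rewrite {1}zE; apply: (label_last_size Esym e0 e2 nonadj wc).
apply: le_trans (misplaced_count Esym e0 (ltW y0) e2 b0 nonadj wc wh) _.
by rewrite ler_wpM2r ?exprn_ge0.
Qed.

End Samples.

(** * Distance to bottleneck graphs *)

Lemma eq_of_leq_sum (I : finType) (f g : I -> nat) :
  (forall i, f i <= g i)%N -> (\sum_i f i = \sum_i g i)%N -> forall i, f i = g i.
Proof.
move=> le E i; have := leqif_sum (fun i (_ : true) => leqif_eq (le i)).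
by move=> /eq_leqif/esym; rewrite E eqxx => /forallP/(_ i)/eqP.
Qed.

(** Moving one vertex from a class that is too large to one that is too small lowers the total
    excess by 1. *)
Lemma resize_classes (V : finType) k (sz : 'I_k -> nat) (p : {ffun V -> 'I_k}) :
  (\sum_i sz i)%N = #|V| ->
  exists2 p' : {ffun V -> 'I_k}, (forall i, #|[set v | p' v == i]| = sz i) &
    (#|[set v | p' v != p v]| <= \sum_i (#|[set v | p v == i]| - sz i))%N.
Proof.
move=> szV; have [N leN] := ubnP (\sum_i (#|[set v | p v == i]| - sz i)).
elim: N p leN => // N IH p leN.
have pV (q : {ffun V -> 'I_k}) : (\sum_i #|[set v | q v == i]|)%N = #|V|.
  rewrite -[RHS]sum1_card (partition_big q xpredT) //=; apply: eq_bigr => i _.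
  by rewrite -sum1_card; apply: eq_bigl => v; rewrite inE.
case: (boolP [exists i, sz i < #|[set v | p v == i]|]%N) => [/existsP[i ibig]|]; last first.
  rewrite negb_exists => /forallP small.
  exists p => [i|].
    apply: (eq_of_leq_sum (f := fun i => #|[set v | p v == i]|)) => [j|].
      by rewrite leqNgt.
    by rewrite pV.
  by rewrite (_ : [set v | _] = set0) ?cards0 //; apply/setP => v; rewrite !inE eqxx.
have /existsP[j jsmall] : [exists j, #|[set v | p v == j]| < sz j]%N.
  apply/contraT; rewrite negb_exists => /forallP big.
  move: ibig; rewrite (eq_of_leq_sum (f := sz) (g := fun i => #|[set v | p v == i]|)).
  - by rewrite ltnn.
  - by move=> j; rewrite leqNgt.
  by rewrite szV pV.
have ij : j != i by apply: contraTneq jsmall => ->; rewrite -leqNgt ltnW.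
have /card_gt0P[v] : (0 < #|[set v | p v == i]|)%N by apply: leq_ltn_trans ibig.
rewrite inE => /eqP vi.
pose q : {ffun V -> 'I_k} := [ffun u => if u == v then j else p u].
have qi : #|[set u | p u == i]| = #|[set u | q u == i]|.+1.
  rewrite (cardsD1 v) inE vi eqxx add1n; congr _.+1; apply: eq_card => u.
  by rewrite !inE ffunE; case: eqP => //= _; rewrite (negPf ij).
have qj : #|[set u | q u == j]| = #|[set u | p u == j]|.+1.
  rewrite (cardsD1 v) inE ffunE !eqxx add1n; congr _.+1; apply: eq_card => u.
  rewrite !inE ffunE; case: eqP => //= ->.
  by rewrite vi eq_sym (negPf ij).
have qo t : t != i -> t != j -> #|[set u | q u == t]| = #|[set u | p u == t]|.
  move=> ti tj; apply: eq_card => u; rewrite !inE ffunE; case: (eqVneq u v) => [->|//].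
  by rewrite vi eq_sym (negPf tj) eq_sym (negPf ti).
have excess : (\sum_t (#|[set u | p u == t]| - sz t) =
    (\sum_t (#|[set u | q u == t]| - sz t)).+1)%N.
  rewrite (bigD1 i) // (bigD1 j) //= [in RHS](bigD1 i) // [in RHS](bigD1 j) //=.
  rewrite [in RHS](eq_bigr (fun t => #|[set u | p u == t]| - sz t)%N); last first.
    by move=> t /andP[ti tj]; rewrite qo.
  move: qi qj ibig jsmall; move: (\sum_(_ | _) _)%N => S.
  move: #|[set u | q u == i]| #|[set u | q u == j]| => qi qj -> ->.
  move: #|[set u | p u == j]| => pj; lia.
have [p' p'sz p'q] := IH q (leq_trans (eq_leq (esym excess)) leN).
exists p' => //; rewrite excess -add1n; apply: leq_trans (leq_add (leqnn 1) p'q).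
rewrite -(cards1 v); apply: leq_trans (leq_card_setU _ _); apply: subset_leq_card.
by apply/subsetP => u; rewrite !inE ffunE; case: (eqVneq u v).
Qed.

Lemma balanced_sizes (R : realType) (m n : nat) (y z : R) : (0 < m)%N ->
  0 <= z <= 1 -> m%:R * y = 1 - z ->
  exists sz : 'I_m.+1 -> nat,
  [/\ (\sum_i sz i)%N = n,
      forall i : 'I_m.+1, (i < m)%N -> `|(sz i)%:R - n%:R * y| < 1 &
      `|(sz ord_max)%:R - n%:R * z| < 1].
Proof.
move=> m0 /andP[z0 z1] my; have m0' : 0 < m%:R :> R by rewrite ltr0n.
have n0 : 0 <= n%:R :> R by rewrite ler0n.
have nz0 : 0 <= n%:R * z by rewrite mulr_ge0.
pose N0 := Num.truncn (n%:R * z).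
have N0le : N0%:R <= n%:R * z by rewrite -truncn_ge_nat.
have N0gt : n%:R * z < N0%:R + 1 by rewrite natr1 -truncn_le_nat.
have N0n : (N0 <= n)%N by rewrite -(ler_nat R); apply: le_trans N0le _; rewrite ler_piMr.
pose a := ((n - N0) %/ m)%N; pose k := ((n - N0) %% m)%N.
have E : (n - N0 = a * m + k)%N by apply: divn_eq.
have km : (k < m)%N by rewrite ltn_mod.
exists (fun i => if (i < m)%N then (a + (i < k))%N else N0); split.
- rewrite big_ord_recr /= ltnn.
  under eq_bigr => i _ do rewrite ltn_ord.
  rewrite big_split /= sum_nat_const card_ord.
  have -> : (\sum_(i < m) (i < k) = k)%N.
    rewrite -[RHS]card_ord -sum1_card (big_ord_widen m (fun=> 1%N)) ?(ltnW km) //.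
    by rewrite [RHS]big_mkcond; apply: eq_bigr => i _; case: ltnP.
  by rewrite mulnC -E subnK.
- move=> i im; rewrite im.
  have nE : n%:R - N0%:R = a%:R * m%:R + k%:R :> R.
    by rewrite -natrB // E natrD natrM.
  have ny : m%:R * (n%:R * y) = n%:R - n%:R * z by rewrite mulrCA my mulrBr mulr1.
  have kR : k%:R + 1 <= m%:R :> R by rewrite natr1 ler_nat.
  have k0 : 0 <= k%:R :> R by rewrite ler0n.
  have lo : -1 < (a + (i < k))%:R - n%:R * y :> R.
    rewrite -(ltr_pM2l m0') mulrBr ny natrD; case: ltnP => ik /=.
      by lra.
    by lra.
  have hi : (a + (i < k))%:R - n%:R * y < 1 :> R.
    rewrite -(ltr_pM2l m0') mulrBr ny natrD; case: ltnP => ik /=.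
      (* A class of size [a + 1] occurs only if [k] is positive, which absorbs the surplus below 1
         from rounding the last class down. *)
      have : 1 <= k%:R :> R by rewrite ler1n (leq_ltn_trans _ ik).
      by lra.
    by lra.
  by rewrite ltr_norml lo hi.
by rewrite ltnn ltr_norml; apply/andP; split; lra.
Qed.

(** * Densities in terms of the critical chromatic number *)

Section CriticalChromaticNumber.
Variables (R : realType) (H : graph) (m : nat) (x : R).
Hypothesis chi_ge2 : (2 <= chi H)%N.
Hypothesis chiE : chi H = m.+1.
Let h : R := #|H|%:R.
Let l : R := (min_color_class H)%:R.
Let M : R := m%:R.
Let z : R := x * l / h.
Let y : R := (1 - z) / M.

Lemma chi_crE : chi_cr R H = M * h / (h - l).
Proof. by rewrite /chi_cr chiE -natr1 addrK. Qed.

Lemma chi_cr_denominators : [/\ 0 < M, 0 < h, 0 < l & 0 < h - l].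
Proof.
have M1 := pred_chi_ge1 R chi_ge2 chiE; have h1 := card_ge1 R chi_ge2.
have l1 := min_color_class_ge1 R chi_ge2; have lh := min_color_class_mul_leR R chiE.
have : 0 < l * M by rewrite mulr_gt0 //; rewrite /l /M; lra.
by move: lh; rewrite mulrDr mulr1; rewrite /l /M /h => *; split; lra.
Qed.

Lemma ceil_chi_cr : `|Num.ceil (chi_cr R H)|%N = m.+1.
Proof.
have [M0 h0 l0 hl0] := chi_cr_denominators; have lh := min_color_class_mul_leR R chiE.
suff -> : Num.ceil (chi_cr R H) = m.+1 by [].
have hl0' : 0 < #|H|%:R - (min_color_class H)%:R :> R := hl0.
apply/eqP; rewrite ceil_eq chi_crE ltr_pdivlMr // ler_pdivrMr //.
have -> : ((m.+1%:Z - 1)%:~R : R) = M by rewrite intrB -addn1 PoszD intrD addrK.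
have -> : (m.+1%:Z%:~R : R) = M + 1 by rewrite /M natr1.
move: lh; rewrite -/l -/h -/M => lh; apply/andP; split.
  by rewrite ltr_pM2l //; lra.
have -> : (M + 1) * (h - l) = M * h + (h - l * (M + 1)) by ring.
by lra.
Qed.

Lemma degree_threshold :
  x * (1 - 1 / chi_cr R H) + (1 - x) * (1 - 1 / ((chi H)%:R - 1)) = 1 - y.
Proof.
have [M0 h0 l0 hl0] := chi_cr_denominators.
rewrite chi_crE chiE -natr1 addrK -/M /y /z; field.
by rewrite !gt_eqF.
Qed.

Lemma first_class_density :
  (chi_cr R H - x * (chi_cr R H + 1 - m.+1%:R)) / (chi_cr R H * (m.+1%:R - 1)) = y.
Proof.
have [M0 h0 l0 hl0] := chi_cr_denominators.
rewrite chi_crE -natr1 addrK -/M /y /z; field.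
by rewrite !gt_eqF.
Qed.

Lemma last_class_density :
  x * (chi_cr R H + 1 - m.+1%:R) / chi_cr R H = z.
Proof.
have [M0 h0 l0 hl0] := chi_cr_denominators.
rewrite chi_crE -natr1 -/M /z; field.
by rewrite !gt_eqF.
Qed.

End CriticalChromaticNumber.

(* Edges inside a cluster are dropped because a block of G has many clusters in
   each class, and only pairs from different classes are controlled. *)
Definition between_clusters (H G : graph) (C : finType) (vert : C * H -> G) :
    rel (C * H) := fun a b => (a.1 != b.1) && adj (vert a) (vert b).

Lemma between_clusters_sym (H G : graph) (C : finType) (vert : C * H -> G) :
  symmetric (between_clusters vert).
Proof. by move=> a b; rewrite /between_clusters eq_sym adj_sym. Qed.

Section Cluster.
Variables (H G : graph) (C : finType) (vert : C * H -> G).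
Hypothesis vert_inj : injective vert.

Lemma card_same_cluster (v : C * H) : (#|[set u : C * H | u.1 == v.1]| <= #|H|)%N.
Proof.
apply: (@leq_trans #|[set (v.1, w) | w : H]|); last exact: leq_imset_card.
apply: subset_leq_card; apply/subsetP => -[c w]; rewrite inE /= => /eqP ->.
exact: imset_f.
Qed.

Lemma card_clusters : (#|C| * #|H| <= #|G|)%N.
Proof. by rewrite -card_prod; apply: leq_card vert_inj. Qed.

Lemma nonadjacent_between_clusters v :
  (#|[set u | ~~ between_clusters vert v u]| <=
   #|[set u | ~~ adj (vert v) u]| + #|H|)%N.
Proof.
apply: leq_trans (leq_add (leqnn _) (card_same_cluster v)).
apply: (@leq_trans #|[set u | ~~ adj (vert v) (vert u)] :|: [set u : C * H | u.1 == v.1]|).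
  apply: subset_leq_card; apply/subsetP => u; rewrite !inE /between_clusters.
  by rewrite negb_and negbK eq_sym orbC.
apply: leq_trans (leq_card_setU _ _) _; rewrite leq_add2r.
rewrite -(card_imset _ vert_inj); apply: subset_leq_card.
by apply/subsetP => _ /imsetP[u + ->]; rewrite !inE.
Qed.

Variables (m : nat) (p : C * H -> 'I_m.+1).

Definition extend_partition : {ffun G -> 'I_m.+1} :=
  [ffun u => if [pick a | vert a == u] is Some a then p a else ord_max].

Lemma extend_vert a : extend_partition (vert a) = p a.
Proof.
rewrite ffunE; case: pickP => [b /eqP/vert_inj -> //|/(_ a)].
by rewrite eqxx.
Qed.

Let X := [set vert a | a : C * H].

Lemma extend_notin u : u \notin X -> extend_partition u = ord_max.
Proof.
rewrite ffunE; case: pickP => [a /eqP <- |//] /negP[].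
exact: imset_f.
Qed.

Lemma card_cover : (#|G| = #|C| * #|H| + #|~: X|)%N.
Proof. by rewrite -card_prod -(card_imset predT vert_inj) cardsC. Qed.

Lemma extend_class_le i : (#|[set u | extend_partition u == i]| <=
  #|[set a | p a == i]| + (i == ord_max) * #|~: X|)%N.
Proof.
rewrite -(cardsID X) leq_add //.
  rewrite -(card_imset [set a | p a == i] vert_inj); apply: subset_leq_card.
  apply/subsetP => u; rewrite inE => /andP[+ /imsetP[a _ uE]].
  by rewrite uE inE extend_vert => ai; apply: imset_f; rewrite inE.
case: (eqVneq i ord_max) => [_|ni]; rewrite ?mul1n ?mul0n.
  by apply: subset_leq_card; apply/subsetP => u; rewrite !inE => /andP[].
rewrite leqn0 cards_eq0; apply/eqP/setP => u; rewrite in_setD in_set0.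
apply/negP => /andP[uX]; rewrite inE extend_notin // eq_sym.
by apply/negP.
Qed.

(** The three terms count pairs misplaced among the clusters, pairs inside one cluster, and pairs
    with a vertex outside all clusters. *)
Lemma extend_misplaced :
  (#|[set e : G * G | misplaced (@adj G) extend_partition e.1 e.2]| <=
   #|[set e : (C * H) * (C * H) | misplaced (between_clusters vert) p e.1 e.2]|
   + #|C| * #|H| * #|H| + 2 * (#|~: X| * #|G|))%N.
Proof.
pose f (e : (C * H) * (C * H)) := (vert e.1, vert e.2).
pose M1 := [set e : (C * H) * (C * H) | misplaced (between_clusters vert) p e.1 e.2].
pose M2 := [set e : (C * H) * (C * H) | e.2.1 == e.1.1].
have sub : [set e : G * G | misplaced (@adj G) extend_partition e.1 e.2] \subset
    (f @: M1 :|: f @: M2) :|: (setX (~: X) setT :|: setX setT (~: X)).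
  apply/subsetP => -[u v]; rewrite inE /= => mis; rewrite !in_setU !in_setX !in_setT /= !andbT.
  case: (boolP (u \in X)) => [/imsetP[a _ uE]|uX]; last by rewrite !in_setC uX /= !orbT.
  case: (boolP (v \in X)) => [/imsetP[b _ vE]|vX]; last by rewrite !in_setC vX /= !orbT.
  apply/orP; left; case: (eqVneq b.1 a.1) => [ab|ab]; apply/orP; [right|left];
    apply/imsetP; exists (a, b); rewrite ?inE /f ?uE ?vE //=; first by rewrite ab.
  move: mis; rewrite uE vE /misplaced !extend_vert /between_clusters.
  by rewrite [a.1 == _]eq_sym ab.
apply: leq_trans (subset_leq_card sub) _.
apply: leq_trans (leq_card_setU _ _) (leq_add _ _).
  apply: leq_trans (leq_card_setU _ _) (leq_add _ _); first exact: leq_imset_card.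
  apply: leq_trans (leq_imset_card _ _) _.
  rewrite /M2 (card_pairs (fun a b : C * H => b.1 == a.1)) -card_prod -sum_nat_const.
  by apply: leq_sum => a _; apply: card_same_cluster.
apply: leq_trans (leq_card_setU _ _) _.
by rewrite !cardsX !cardsT [(#|G| * _)%N]mulnC mul2n addnn.
Qed.

End Cluster.

Section MakeBottleneck.
Variables (G : graph) (m : nat) (p : {ffun G -> 'I_m.+1}).

(** The edges of [G] inside the last class are kept, so nothing is edited there. *)
Definition bottleneck_adj u v :=
  (p u != p v) || [&& p u == p v, ~~ (p u < m)%N & adj u v].

Lemma bottleneck_adj_sym : symmetric bottleneck_adj.
Proof.
by move=> u v; rewrite /bottleneck_adj eq_sym adj_sym; case: eqP => [->|].
Qed.

Lemma bottleneck_adj_irr : irreflexive bottleneck_adj.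
Proof. by move=> u; rewrite /bottleneck_adj eqxx adj_irr !andbF. Qed.

Definition bottleneck_graph := Graph bottleneck_adj_sym bottleneck_adj_irr.

(** Under the identity map, an edited pair is misplaced for [q] or contains a vertex whose class
    differs in [p] and [q]. *)
Lemma edit_distance_bottleneck (q : {ffun G -> 'I_m.+1}) :
  (edit_distance G bottleneck_graph <=
   #|[set e : G * G | misplaced (@adj G) q e.1 e.2]| + 2 * (#|[set u | p u != q u]| * #|G|))%N.
Proof.
pose f : {ffun G -> bottleneck_graph} := [ffun u => u].
have finj : injectiveb f by apply/injectiveP => u v; rewrite !ffunE.
apply: leq_trans (bigminn_le _ _ finj) _.
apply: leq_trans (leq_imset_card _ _) _.
pose Mv := [set u | p u != q u].
have sub : [set e : G * G | adj e.1 e.2 != adj (f e.1) (f e.2)] \subset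
    [set e : G * G | misplaced (@adj G) q e.1 e.2] :|: (setX Mv setT :|: setX setT Mv).
  apply/subsetP => -[u v]; rewrite !inE /= !andbT !ffunE /bottleneck_adj /misplaced.
  case: (eqVneq (p u) (q u)) => [->|]; last by rewrite orbT.
  case: (eqVneq (p v) (q v)) => [->|]; last by rewrite !orbT.
  rewrite !orbF; case: (q u == q v) => /=; case: (q u < m)%N => /=;
    rewrite ?orbF ?eqxx //; by case: (@adj G u v).
apply: leq_trans (_ : #|[set e : G * G | adj e.1 e.2 != adj (f e.1) (f e.2)]| <= _)%N.
  by apply: eq_leq; apply: eq_card => e; rewrite inE.
apply: leq_trans (subset_leq_card sub) _.
apply: leq_trans (leq_card_setU _ _) (leq_add (leqnn _) _).
apply: leq_trans (leq_card_setU _ _) _.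
by rewrite !cardsX !cardsT [(#|G| * _)%N]mulnC mul2n addnn.
Qed.

End MakeBottleneck.

Lemma sqr_le_bin2 n : (2 <= n)%N -> (n * n <= 4 * 'C(n, 2))%N.
Proof.
case: n => [|[|k]] // _; have := bin_ffact k.+2 2.
rewrite ffactnS ffactn1 /= (_ : 2`! = 2)%N // => E; nia.
Qed.

(** * From clusterings back to the graph *)

Section Final.
Variables (R : realType) (H : graph) (m : nat) (x : R).
Hypothesis chi_ge2 : (2 <= chi H)%N.
Hypothesis chiE : chi H = m.+1.
Hypothesis x_itv : 0 <= x <= 1.
Let h : R := #|H|%:R.
Let M : R := m%:R.
Let z : R := x * (min_color_class H)%:R / h.
Let y : R := (1 - z) / M.

Lemma nonadjacent_le (G : graph) : (1 - y) * #|G|%:R <= (min_degree G)%:R ->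
  forall v : G, #|[set u | ~~ adj v u]|%:R <= y * #|G|%:R.
Proof.
move=> deg v; have : (min_degree G <= degree v)%N by apply: bigminn_le.
rewrite -(ler_nat R) => /(le_trans deg).
have -> : #|[set u | ~~ adj v u]|%:R = #|G|%:R - (degree v)%:R :> R.
  rewrite -(cardsC [set u | adj v u]) natrD addrAC subrr add0r; congr _%:R.
  by apply: eq_card => u; rewrite !inE.
by rewrite mulrBl mul1r; lra.
Qed.

(** Dropping the edges inside clusters costs at most [h] nonneighbours, and the vertices outside the
    clusters cost at most [h] more when the bound is expressed by the number of clusters; for many
    clusters, [2 * h] is below [eps * (#|C|%:R * h)]. *)
Lemma exists_clustering (eps : R) (n0 : nat) : 0 < eps ->
  exists n1 : nat, forall G : graph, (n1 < #|G|)%N ->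
  (1 - y) * #|G|%:R <= (min_degree G)%:R ->
  exists (C : finType) (copy : pred C) (vert : C * H -> G),
  [/\ clustering copy vert (between_clusters vert), (n0 < #|C|)%N,
      (#|G| < #|C| * #|H| + #|H|)%N &
      forall v, #|[set u | ~~ between_clusters vert v u]|%:R <=
        (y + eps) * #|{: C * H}|%:R].
Proof.
move=> eps0; have H0 := card_gt0_of_chi chi_ge2.
have [n2 n2P] := exists_nat_ge (2 / eps).
exists ((maxn n0 n2).+1 * #|H|)%N.
move=> G nG deg.
have [C [copy [vert [vert_inj cc ce nC]]]] := cluster_partition G H0.
have Cbig : (maxn n0 n2 < #|C|)%N.
  rewrite ltnNge; apply/negP => Csmall; move: nG nC; rewrite ltnNge => /negP nG nC.
  apply: nG; apply: leq_trans (ltnW nC) _; rewrite mulSn addnC leq_add2l.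
  by rewrite leq_mul2r Csmall orbT.
move: Cbig; rewrite gtn_max => /andP[C0 C2].
exists C, copy, vert; split=> //.
move=> v; have := nonadjacent_between_clusters vert_inj v.
rewrite -(ler_nat R) natrD => /le_trans; apply.
have := nonadjacent_le deg (vert v).
have y0 : 0 < y := first_density_gt0 chi_ge2 chiE x_itv.
have y1 : y <= 1 := first_density_le1 chi_ge2 chiE x_itv.
have h1 : 1 <= h := card_ge1 R chi_ge2.
have nC' : #|G|%:R <= #|C|%:R * h + h by rewrite -natrM -natrD ler_nat ltnW.
have eC : 2 * h <= eps * (#|C|%:R * h).
  rewrite mulrA ler_pM2r; last by lra.
  by rewrite mulrC -ler_pdivrMr //; apply: le_trans n2P _; rewrite ler_nat ltnW.
have yC : y * #|G|%:R <= y * (#|C|%:R * h) + h.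
  apply: (@le_trans _ _ (y * (#|C|%:R * h + h))); first by rewrite ler_pM2l.
  by rewrite mulrDr lerD2l ler_piMl //; lra.
by rewrite card_prod natrM -/h mulrDl; lra.
Qed.

Lemma til_ge_of_clusters (G : graph) (C : finType) (a b : R) :
  (#|G| < #|C| * #|H| + #|H|)%N -> 0 <= b ->
  #|C|%:R * b <= (til H G)%:R -> a * #|G|%:R + b * h <= b * #|G|%:R ->
  a * #|G|%:R / h <= (til H G)%:R.
Proof.
move=> nC b0 le ab; have h1 : 1 <= h := card_ge1 R chi_ge2.
have h0 : 0 < h by lra.
have nC' : #|G|%:R <= #|C|%:R * h + h by rewrite -natrM -natrD ler_nat ltnW.
apply: le_trans le; rewrite ler_pdivrMr //.
have := ler_wpM2l b0 nC'; lra.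
Qed.

(** The errors are split into a proportional part [eta] and a constant part [K]. Correcting the
    sizes moves at most [(M + 1) * (eta * n + K + 1)] vertices, each affecting [2 * n] ordered
    pairs. The factor 8 combines the 4 of [sqr_le_bin2] with a 2 for sharing [eps] between the
    quadratic and the linear errors. *)
Lemma edit_close_of_partition (G : graph) (q : {ffun G -> 'I_m.+1}) (eta K eps : R) :
  (2 <= #|G|)%N -> 0 <= eta -> 0 <= K ->
  (forall i : 'I_m.+1, (i < m)%N ->
     #|[set u | q u == i]|%:R <= y * #|G|%:R + eta * #|G|%:R + K) ->
  #|[set u | q u == ord_max]|%:R <= z * #|G|%:R + eta * #|G|%:R + K ->
  #|[set e : G * G | misplaced (@adj G) q e.1 e.2]|%:R <=
    eta * #|G|%:R ^+ 2 + K * #|G|%:R ->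
  8 * (2 * M + 3) * eta <= eps ->
  8 * (K + 2 * (M + 1) * (K + 1)) <= eps * #|G|%:R ->
  exists B : graph, bottleneck x (chi_cr R H) B /\ edit_close eps G B.
Proof.
move=> n2 eta0 K0 qi qmax mis etaeps Keps.
have m0 : (0 < m)%N by move: chi_ge2; rewrite chiE.
have z01 : 0 <= z <= 1.
  rewrite last_density_ge0 //=; have := last_density_le chi_ge2 chiE x_itv; rewrite -/h -/z.
  have := last_density_ge0 chi_ge2 x_itv; rewrite -/h -/z => z0.
  have : 0 <= z * M by rewrite mulr_ge0. 
  by rewrite -/M mulrDr mulr1; lra.
have [sz [szn szi szm]] := balanced_sizes #|G| m0 z01 (first_density_mul chi_ge2 chiE x).
have [p psz pq] := resize_classes q szn.
have n0 : 0 <= #|G|%:R :> R by rewrite ler0n.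
exists (bottleneck_graph p); split.
  rewrite /bottleneck (ceil_chi_cr R chi_ge2 chiE).
  rewrite (first_class_density _ chi_ge2 chiE) (last_class_density _ chi_ge2 chiE).
  exists p; split.
  - by move=> i im; rewrite psz; apply: szi.
  - by move=> i im; rewrite psz (_ : i = ord_max) //; apply: val_inj.
  - by move=> u v uv; rewrite /= /bottleneck_adj uv.
  move=> u v uv im; have {}im : (p v < m)%N by rewrite -uv.
  by rewrite /= /bottleneck_adj uv eqxx /= im.
split=> //; set n : R := #|G|%:R in n0 qi qmax mis Keps *.
have excess i : (#|[set v | q v == i]| - sz i)%N%:R <= eta * n + K + 1.
  have pos : 0 <= eta * n + K + 1 by rewrite !addr_ge0 // mulr_ge0.
  case: (leqP #|[set v | q v == i]| (sz i)) => [le|/ltnW le].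
    by move: le; rewrite -subn_eq0 => /eqP ->.
  rewrite natrB //; case: (ltnP i m) => im.
    have := qi i im; have := szi i im; rewrite ltr_norml -/n => /andP[+ _].
    by rewrite -/M -/z -/y; lra.
  have iE : i = ord_max by apply/val_inj/eqP; rewrite eqn_leq leq_ord.
  move: szm qmax; rewrite iE ltr_norml -/n => /andP[+ _].
  by lra.
have moved : #|[set v | p v != q v]|%:R <= (M + 1) * (eta * n + K + 1).
  apply: (@le_trans _ _ (\sum_(i < m.+1) (eta * n + K + 1))).
    by move: pq; rewrite -(ler_nat R) natr_sum => /le_trans; apply; apply: ler_sum.
  by rewrite sumr_const card_ord -[leLHS]mulr_natl -natr1.
have bound : (edit_distance G (bottleneck_graph p))%:R <=
    (eta * n ^+ 2 + K * n) + 2 * ((M + 1) * (eta * n + K + 1) * n).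
  have := edit_distance_bottleneck p q; rewrite -(ler_nat R) natrD => /le_trans; apply.
  by apply: lerD => //; rewrite !natrM ler_pM2l // ler_wpM2r.
apply: le_trans bound _.
have eps0 : 0 <= eps.
  by apply: le_trans etaeps; rewrite !mulr_ge0 // addr_ge0 // mulr_ge0.
have c4 : n ^+ 2 <= 4 * 'C(#|G|, 2)%:R.
  by rewrite expr2 -!natrM ler_nat sqr_le_bin2.
have e1 : eps * n ^+ 2 <= eps * (4 * 'C(#|G|, 2)%:R) by rewrite ler_wpM2l.
have e2 := ler_wpM2r (sqr_ge0 n) etaeps.
have e3 := ler_wpM2r n0 Keps.
have -> : eta * n ^+ 2 + K * n + 2 * ((M + 1) * (eta * n + K + 1) * n) =
  (2 * M + 3) * eta * n ^+ 2 + (K + 2 * (M + 1) * (K + 1)) * n by ring.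
have e4 : eps * n * n = eps * n ^+ 2 by ring.
by rewrite e4 in e3; lra.
Qed.

End Final.

Section Assembly.
Variables (R : realType) (H : graph) (m : nat) (x : R).
Hypothesis chi_ge2 : (2 <= chi H)%N.
Hypothesis chiE : chi H = m.+1.
Hypothesis x_itv : 0 <= x <= 1.
Let h : R := #|H|%:R.
Let y : R := (1 - x * (min_color_class H)%:R / h) / m%:R.

Lemma tiling_theorem (eps : R) : 0 < eps ->
  exists n0 : nat, forall G : graph, (n0 < #|G|)%N ->
  (1 - y) * #|G|%:R <= (min_degree G)%:R ->
  (x - eps) * #|G|%:R / h <= (til H G)%:R.
Proof.
move=> eps0; have h1 : 1 <= h := card_ge1 R chi_ge2.
have e20 : 0 < eps / 2 by rewrite divr_gt0.
have [d [n1 [d0 n1P]]] := tiling_ge chi_ge2 chiE x_itv e20.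
have [n2 n2P] := exists_clustering chi_ge2 chiE x_itv n1 d0.
have [n3 n3P] := exists_nat_ge (2 * h / eps).
exists (maxn n2 n3) => G; rewrite gtn_max => /andP[G2 G3] deg.
have G0 : 0 <= #|G|%:R :> R by rewrite ler0n.
have [neg|pos] := lerP (x - eps / 2) 0.
  apply: le_trans (ler0n _ _); rewrite ler_pdivrMr ?mul0r; last by lra.
  by rewrite mulr_le0_ge0 //; lra.
have [C [copy [vert [clus C1 nC nonadj]]]] := n2P G G2 deg.
have := n1P G C copy vert _ clus (between_clusters_sym vert) C1 nonadj.
move=> til_le; apply: til_ge_of_clusters nC (ltW pos) til_le _ => //.
have big : h <= eps / 2 * #|G|%:R.
  have : 2 * h / eps <= #|G|%:R by apply: le_trans n3P _; rewrite ler_nat ltnW.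
  by rewrite ler_pdivrMr //; lra.
have : (x - eps / 2) * h <= h.
  by rewrite ler_piMl //; move: x_itv => /andP[? ?]; lra.
have -> : (x - eps) * #|G|%:R = (x - eps / 2) * #|G|%:R - eps / 2 * #|G|%:R by field.
by lra.
Qed.

Lemma stability_theorem (eps : R) : x < 1 -> 0 < eps ->
  exists (n0 : nat) (delta : R), 0 < delta /\
  forall G : graph, (n0 < #|G|)%N ->
  (1 - y) * #|G|%:R <= (min_degree G)%:R ->
  (x + delta) * #|G|%:R / h <= (til H G)%:R \/
  exists B : graph, bottleneck x (chi_cr R H) B /\ edit_close eps G B.
Proof.
move=> x1 eps0; have h1 : 1 <= h := card_ge1 R chi_ge2; have /andP[x0 _] := x_itv.
have M1 : 1 <= m%:R :> R := pred_chi_ge1 R chi_ge2 chiE.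
have y0 : 0 < y := first_density_gt0 chi_ge2 chiE x_itv.
have y1 : y <= 1 := first_density_le1 chi_ge2 chiE x_itv.
have c0 : 0 < 8 * (2 * m%:R + 3) :> R by rewrite mulr_gt0 //; lra.
pose eta := eps / (8 * (2 * m%:R + 3)).
have eta0 : 0 < eta by apply: divr_gt0.
have etaE : 8 * (2 * m%:R + 3) * eta = eps by rewrite mulrC divfK // gt_eqF.
have [d [del [n1 [d0 del0 n1P]]]] := tiling_or_bottleneck chi_ge2 chiE x_itv x1 eta0.
have [n2 n2P] := exists_clustering chi_ge2 chiE x_itv n1 d0.
have [n3 n3P] := exists_nat_ge (2 * ((x + del) * h) / del).
(* Among the misplaced pairs, those inside clusters contribute at most [h * #|G|] and those meeting
   an uncovered vertex at most [2 * h * #|G|]. *)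
pose K : R := 3 * h.
have [n4 n4P] := exists_nat_ge (8 * (K + 2 * (m%:R + 1) * (K + 1)) / eps).
exists (maxn 2 (maxn n2 (maxn n3 n4))), (del / 2); split; first by rewrite divr_gt0.
move=> G; rewrite !gtn_max => /and4P[G1 G2 G3 G4] deg.
have n0 : 0 <= #|G|%:R :> R by rewrite ler0n.
have [C [copy [vert [clus C1 nC nonadj]]]] := n2P G G2 deg.
have [til_le|[p [pi pmax mis]]] :=
    n1P G C copy vert _ clus (between_clusters_sym vert) C1 nonadj.
  left; have xd : 0 <= x + del by lra.
  apply: til_ge_of_clusters nC xd til_le _ => //.
  have : 2 * ((x + del) * h) / del <= #|G|%:R.
    by apply: le_trans n3P _; rewrite ler_nat ltnW.
  rewrite ler_pdivrMr // => le.
  have -> : (x + del / 2) * #|G|%:R = (x + del) * #|G|%:R - #|G|%:R * del / 2 by field.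
  by lra.
right; have [vert_inj _ _ _] := clus.
have K0 : 0 <= K by rewrite mulr_ge0 //; lra.
set N : R := #|{: C * H}|%:R in pi pmax mis.
have N0 : 0 <= N by rewrite ler0n.
have NE : N = #|C|%:R * h by rewrite /N card_prod natrM.
have Nn : N <= #|G|%:R by rewrite NE -natrM ler_nat (card_clusters vert_inj).
set U := #|~: [set vert a | a : C * H]|.
have Uh : U%:R <= h :> R.
  by rewrite ler_nat -(leq_add2l (#|C| * #|H|)) -(card_cover vert_inj) ltnW.
have etaN : eta * N <= eta * #|G|%:R by rewrite ler_pM2l.
have z0 := last_density_ge0 chi_ge2 x_itv; rewrite -/h in z0 pmax.
apply: (@edit_close_of_partition R H m x chi_ge2 chiE x_itv G
  (extend_partition vert p) eta K eps).
- exact: ltnW.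
- exact: ltW.
- exact: K0.
- move=> i im; have := extend_class_le vert_inj p i.
  have -> : (i == ord_max) = false.
    by apply/negbTE; apply: contraTneq im => ->; rewrite ltnn.
  rewrite mul0n addn0 -(ler_nat R) => /le_trans; apply.
  have := pi i im; rewrite ler_norml => /andP[_ hi].
  have : y * N <= y * #|G|%:R by rewrite ler_pM2l.
  by rewrite -/y in hi *; lra.
- have := extend_class_le vert_inj p ord_max.
  rewrite eqxx mul1n -/U -(ler_nat R) natrD => /le_trans; apply.
  have := pmax; rewrite ler_norml => /andP[_ hi].
  have : x * (min_color_class H)%:R / h * N <= x * (min_color_class H)%:R / h * #|G|%:R.
    by rewrite ler_wpM2l.
  by rewrite /K -/h; lra.
- have := extend_misplaced vert_inj p.
  rewrite -/U -(ler_nat R) => /le_trans; apply.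
  rewrite !natrD !natrM -NE -/h.
  have NN : N ^+ 2 <= #|G|%:R ^+ 2 by rewrite ler_pXn2r ?nnegrE.
  have e1 : eta * N ^+ 2 <= eta * #|G|%:R ^+ 2 by rewrite ler_pM2l.
  have e2 : N * h <= #|G|%:R * h by rewrite ler_wpM2r //; lra.
  have e3 : U%:R * #|G|%:R <= h * #|G|%:R by rewrite ler_wpM2r.
  by rewrite /K; lra.
- by rewrite etaE.
have : 8 * (K + 2 * (m%:R + 1) * (K + 1)) / eps <= #|G|%:R.
  by apply: le_trans n4P _; rewrite ler_nat ltnW.
by rewrite ler_pdivrMr // [eps * _]mulrC.
Qed.

End Assembly.

Theorem theorem1p3 (R : realType) (H : graph) (x : R)
    (chi_ge2 : (2 <= chi H)%N) (x_itv : 0 <= x <= 1) :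
  (forall eps : R, 0 < eps ->
     exists n0 : nat, forall G : graph, (n0 < #|G|)%N ->
       (x * (1 - 1 / chi_cr R H) + (1 - x) * (1 - 1 / ((chi H)%:R - 1)))
         * #|G|%:R <= (min_degree G)%:R ->
       (x - eps) * #|G|%:R / #|H|%:R <= (til H G)%:R)
  /\
  (x < 1 -> forall eps : R, 0 < eps ->
     exists (n0 : nat) (delta : R), 0 < delta /\
     forall G : graph, (n0 < #|G|)%N ->
       (x * (1 - 1 / chi_cr R H) + (1 - x) * (1 - 1 / ((chi H)%:R - 1)))
         * #|G|%:R <= (min_degree G)%:R ->
       (x + delta) * #|G|%:R / #|H|%:R <= (til H G)%:R
       \/ exists B : graph,
            bottleneck x (chi_cr R H) B /\ edit_close eps G B).
Proof.
case chiE: (chi H) (chi_ge2) => [//|m] _; rewrite -chiE.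
rewrite (degree_threshold x chi_ge2 chiE); split.
  by move=> eps; apply: tiling_theorem.
by move=> x1 eps; apply: stability_theorem.
Qed.
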